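(* Consider the $n$-class queueing system of the context, with class $k$ Poisson arrivals at rate $\lambda_k$ and class $k$ job joint distribution $(R_k,\vec A_k)$. If $\rho=\sum_{k=1}^n\lambda_k\mathbb E[R_k]<1$, then the system is stable (positive recurrent).
   Context: Model: a single server; job classes $1,\dots,n$. Class $i$ jobs arrive according to independent Poisson processes of rates $\lambda_i>0$; original sizes of class $i$ jobs are i.i.d. with positive distribution $S_i$. Scheduling is preemptive priority (lower index = higher priority, FCFS within class, preempt-resume) with preemption overhead: when a class $k$ job in service is preempted by the arrival of a class $<k$ job, a nonpreemptible class $k$ pause (length $\sim C_k$) begins; whenever a job or pause completes and jobs remain, the best-priority job is identified and, if it is a previously paused class $k$ job, a nonpreemptible class $k$ resume (length $\sim D_k$) begins, else that job starts service; when a class $k$ resume completes, if a class $<k$ job arrived during it the resume fails and a class $k$ pause begins, otherwise the job continues service. Overhead lengths are i.i.d. and independent of everything else. A class $k$ job's pauses and resumes are attributed to it: its effective size $R_k$ is its original size plus the total length of its pauses and resumes, and $A_{k,i}$ is the number of class $i$ arrivals during its effective service time; $\vec A_k=(A_{k,1},\dots,A_{k,n})$. $\rho$ is called the total effective load. *)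

(* Defs.v *)
From HB Require Import structures.
From mathcomp Require Import all_boot all_order all_algebra.
From mathcomp Require Import all_classical all_reals all_analysis.
Set Implicit Arguments. Unset Strict Implicit. Unset Printing Implicit Defensive.
Import Order.TTheory GRing.Theory Num.Theory.
Local Open Scope classical_set_scope.
Local Open Scope ring_scope.

(* Deterministic dynamics of the n-class preemptive-priority queue with      *)
(* preemption overheads, as a function of a realisation of the inputs:       *)
(*   x i m : m-th interarrival time of class i (class-i arrival m happens at *)
(*           time x i 0 + ... + x i m),                                      *)
(*   sz i m : original size of the m-th class-i job,                         *)
(*   c k m : length of the m-th class-k pause,                               *)
(*   dd k m : length of the m-th class-k resume.                             *)
(* Classes are 'I_n, lower index = higher priority.                          *)

Section Dynamics.
Variables (R : realType) (n : nat).
Variables (x sz c dd : 'I_n -> nat -> R).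

Definition arrT (i : 'I_n) (m : nat) : R := \sum_(j < m.+1) x i j.

Inductive activity :=
  | Idle
  | Serve of 'I_n                 (* serving the head job of the class *)
  | Pause of 'I_n & R             (* class-k pause, with its end time *)
  | Resume of 'I_n & R & bool.    (* class-k resume, end time, "a higher
                                     priority job arrived during it" *)

Record state := State {
  now : R;
  narr : 'I_n -> nat;
  queue : 'I_n -> seq R;        (* FCFS queue of remaining original sizes *)
  paused : 'I_n -> bool;        (* head of the class queue is a paused job *)
  npause : 'I_n -> nat;
  nresume : 'I_n -> nat;
  cur : activity }.

Definition upd {T : Type} (f : 'I_n -> T) (k : 'I_n) (v : T) : 'I_n -> T :=
  fun j => if j == k then v else f j.

Definition set_cur (s : state) (a : activity) : state :=
  State (now s) (narr s) (queue s) (paused s) (npause s) (nresume s) a.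

(* next arrival: class (smallest index on ties) and time *)
Definition next_arr (s : state) : option ('I_n * R) :=
  foldr (fun i acc => let t := arrT i (narr s i) in
    match acc with
    | None => Some (i, t)
    | Some (_, u) => if t <= u then Some (i, t) else acc
    end) None (enum 'I_n).

Definition act_end (s : state) : option R :=
  match cur s with
  | Idle => None
  | Serve k => Some (now s + head 0 (queue s k))
  | Pause _ e => Some e
  | Resume _ e _ => Some e
  end.

Definition advance (t : R) (s : state) : state :=
  let q := match cur s with
           | Serve k => upd (queue s) k
                          ((head 0 (queue s k) - (t - now s)) :: behead (queue s k))
           | _ => queue s
           end in
  State t (narr s) q (paused s) (npause s) (nresume s) (cur s).

Definition start_pause (k : 'I_n) (s : state) : state :=
  State (now s) (narr s) (queue s) (upd (paused s) k true)
        (upd (npause s) k (npause s k).+1) (nresume s)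
        (Pause k (now s + c k (npause s k))).

Definition best (s : state) : option 'I_n :=
  [pick j | (queue s j != [::]) &&
            [forall i : 'I_n, (i < j)%N ==> (queue s i == [::])]].

Definition dispatch (s : state) : state :=
  match best s with
  | None => set_cur s Idle
  | Some j =>
      if paused s j then
        State (now s) (narr s) (queue s) (paused s) (npause s)
              (upd (nresume s) j (nresume s j).+1)
              (Resume j (now s + dd j (nresume s j)) false)
      else set_cur s (Serve j)
  end.

Definition arrive (i : 'I_n) (s : state) : state :=
  let s1 := State (now s) (upd (narr s) i (narr s i).+1)
                  (upd (queue s) i (rcons (queue s i) (sz i (narr s i))))
                  (paused s) (npause s) (nresume s) (cur s) in
  match cur s with
  | Idle => dispatch s1
  | Serve k => if (i < k)%N then start_pause k s1 else s1
  | Pause _ _ => s1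
  | Resume k e _ => if (i < k)%N then set_cur s1 (Resume k e true) else s1
  end.

Definition complete (s : state) : state :=
  match cur s with
  | Idle => s
  | Serve k =>
      dispatch (State (now s) (narr s) (upd (queue s) k (behead (queue s k)))
                      (paused s) (npause s) (nresume s) (cur s))
  | Pause _ _ => dispatch s
  | Resume k _ f =>
      if f then start_pause k s
      else State (now s) (narr s) (queue s) (upd (paused s) k false)
                 (npause s) (nresume s) (Serve k)
  end.

Definition step (s : state) : state :=
  match next_arr s, act_end s with
  | None, None => s
  | Some (i, t), None => arrive i (advance t s)
  | None, Some e => complete (advance e s)
  | Some (i, t), Some e =>
      if e <= t then complete (advance e s) else arrive i (advance t s)
  end.

Definition init : state :=
  State 0 (fun=> 0%N) (fun=> [::]) (fun=> false) (fun=> 0%N) (fun=> 0%N) Idle.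

Definition is_idle (s : state) : bool :=
  if cur s is Idle then true else false.

(* first time (after time 0) at which the system becomes empty again,
   i.e. the end of the first busy period; +oo if it never empties *)
Definition first_empty_time : \bar R :=
  match pselect (exists N, (0 < N)%N && is_idle (iter N step init)) with
  | left H => (now (iter (ex_minn H) step init))%:E
  | right _ => +oo%E
  end.

(* Effective size of a class-k job: the job is considered on its own         *)
(* "effective time" axis (its service, pauses and resumes only, waiting      *)
(* excluded); class < k arrivals on that axis are given by the arrival       *)
(* streams x i (i < k) started at 0, its size is sz k 0, its pauses and      *)
(* resumes are c k 0, c k 1, ... and dd k 0, dd k 1, ...                     *)

Inductive jphase :=
  | JServe | JPause of R | JResume of R & bool | JDone.

Record jstate := JState {
  ju : R;                 (* effective time elapsed *)
  jarr : 'I_n -> nat;     (* consumed higher-priority arrivals, per class *)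
  jrem : R;               (* remaining original size *)
  jpc : nat; jrc : nat;   (* pauses / resumes used *)
  jph : jphase }.

Definition jnext (k : 'I_n) (s : jstate) : option ('I_n * R) :=
  foldr (fun i acc => let t := arrT i (jarr s i) in
    match acc with
    | None => Some (i, t)
    | Some (_, u) => if t <= u then Some (i, t) else acc
    end) None (seq.filter (fun i : 'I_n => (i < k)%N) (enum 'I_n)).

Definition jconsume (i : 'I_n) (s : jstate) : 'I_n -> nat :=
  upd (jarr s) i (jarr s i).+1.

Definition jstep (k : 'I_n) (s : jstate) : jstate :=
  match jph s with
  | JDone => s
  | JServe =>
      let e := ju s + jrem s in
      match jnext k s with
      | Some (i, h) =>
          if h < e then
            JState h (jconsume i s) (jrem s - (h - ju s)) (jpc s).+1 (jrc s)
                   (JPause (h + c k (jpc s)))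
          else JState e (jarr s) 0 (jpc s) (jrc s) JDone
      | None => JState e (jarr s) 0 (jpc s) (jrc s) JDone
      end
  | JPause e =>
      match jnext k s with
      | Some (i, h) =>
          if h <= e then JState h (jconsume i s) (jrem s) (jpc s) (jrc s) (JPause e)
          else JState e (jarr s) (jrem s) (jpc s) (jrc s).+1
                      (JResume (e + dd k (jrc s)) false)
      | None => JState e (jarr s) (jrem s) (jpc s) (jrc s).+1
                       (JResume (e + dd k (jrc s)) false)
      end
  | JResume e f =>
      let fin := if f then JState e (jarr s) (jrem s) (jpc s).+1 (jrc s)
                                  (JPause (e + c k (jpc s)))
                 else JState e (jarr s) (jrem s) (jpc s) (jrc s) JServe in
      match jnext k s with
      | Some (i, h) =>
          if h < e then JState h (jconsume i s) (jrem s) (jpc s) (jrc s) (JResume e true)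
          else fin
      | None => fin
      end
  end.

Definition jinit (k : 'I_n) : jstate :=
  JState 0 (fun=> 0%N) (sz k 0) 0 0 JServe.

Definition is_done (s : jstate) : bool :=
  if jph s is JDone then true else false.

Definition effective_size (k : 'I_n) : \bar R :=
  match pselect (exists N, is_done (iter N (jstep k) (jinit k))) with
  | left H => (ju (iter (ex_minn H) (jstep k) (jinit k)))%:E
  | right _ => +oo%E
  end.

End Dynamics.

Definition mutually_independent {d} {T : measurableType d} {R : realType}
    (P : probability T R) {I : eqType} (Y : I -> T -> R) : Prop :=
  forall (J : seq I) (B : I -> set R), uniq J ->
    (forall j, measurable (B j)) ->
    P (\big[setI/setT]_(j <- J) (Y j @^-1` B j)) =
    (\prod_(j <- J) P (Y j @^-1` B j))%E.

(* all primitive inputs as one family; tags: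
   (false,false) interarrivals, (false,true) sizes,
   (true,false) pauses, (true,true) resumes *)
Definition inputs {T : Type} {R : realType} {n : nat}
    (X S C D : 'I_n -> nat -> T -> R) : (bool * bool * 'I_n * nat) -> T -> R :=
  fun t => match t with
           | (false, false, i, m) => X i m
           | (false, true, i, m) => S i m
           | (true, false, i, m) => C i m
           | (true, true, i, m) => D i m
           end.

Definition at_ {T : Type} {R : realType} {n : nat} (X : 'I_n -> nat -> T -> R)
    (w : T) : 'I_n -> nat -> R := fun i m => X i m w.

Definition total_effective_load {d} {T : measurableType d} {R : realType}
    (P : probability T R) {n : nat} (lam : 'I_n -> R)
    (X S C D : 'I_n -> nat -> T -> R) : \bar R :=
  (\sum_(k < n) (lam k)%:E *
     \int[P]_w effective_size (at_ X w) (at_ S w) (at_ C w) (at_ D w) k)%E.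

(* stability (positive recurrence): the system, started empty, regenerates
   at the end of each busy period; it is positive recurrent iff the
   regeneration cycle has finite mean, i.e. E[end of first busy period] < oo *)
Definition stable {d} {T : measurableType d} {R : realType}
    (P : probability T R) {n : nat} (X S C D : 'I_n -> nat -> T -> R) : Prop :=
  (\int[P]_w first_empty_time (at_ X w) (at_ S w) (at_ C w) (at_ D w)
     < +oo)%E.

(* Main.v *)
(* Let L_k be the total arrival rate of the classes < k. Compensating the arrival
   processes, the expected number of preemptions of a class-k job during its
   service is L_k E[S_k]. A resume succeeds with probability
   q_k = E[exp (- L_k D_k)], and every preemption costs pauses and resumes until
   one resume succeeds, so E[R_k] >= E[S_k] (1 + L_k (E[C_k] + E[D_k]) / q_k).
   The same compensation, applied to the queue stopped when it first empties,
   bounds q_k times the mean number of class-k resumes up to step N by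
   1 + L_k E[class-k service time up to step N]. With Wald's identity for sizes
   and overheads, the mean busy time B_N up to step N satisfies
   B_N <= const + rho B_N, so B_N is bounded in N. The number of busy steps is
   controlled by the same counters, hence is bounded in mean as well: the queue
   empties almost surely, and by monotone convergence in finite mean time. *)
Require Import Defs.
From HB Require Import structures.
From mathcomp Require Import all_boot all_order all_algebra.
From mathcomp Require Import all_classical all_reals all_analysis.
From mathcomp Require Import measurable_realfun.
From mathcomp Require Import ring lra.
Import Order.TTheory GRing.Theory Num.Theory.
Import numFieldNormedType.Exports.
Set Implicit Arguments. Unset Strict Implicit. Unset Printing Implicit Defensive.
Local Open Scope classical_set_scope.
Local Open Scope ring_scope.

(** * Resampling one input *)

(** The load concerns a job alone on its effective time axis, stability the interleaved queue, and
    the two are never coupled. They are compared through mean numbers of resumes: bounded below for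
    the isolated job, above for the queue, with the same factor [q_k]. The quantity
    [exp (- L * remaining length)] of an unfailed resume is a martingale up to failure: its growth
    and its loss at failure have equal means, so successes are counted without describing Poisson
    counts on random intervals. No filtration is used. Independence is a product formula, so the
    joint law is invariant under replacing one coordinate by an independent copy. Integrating that
    coordinate first gives Wald's identity when the run ignores it until it is read, and the
    compensator formula when it is an exponential time racing against the next other event. At a
    fixed step [N] all counters are at most [N], so common terms have finite means and may be
    cancelled. Overhead means are not assumed finite: for a class that can be preempted, finiteness
    comes from [E[R_k] < oo]. *)

Section InputSpace.
Context {R : realType} (I : choiceType).

(** Boxes constraining finitely many coordinates form a pi-system, and [mutually_independent] is a
    product formula on exactly these sets; laws of the inputs are therefore compared on boxes
    only. *)
Definition cylinder : set (set (I -> R)) :=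
  [set A | exists (J : seq I) (B : I -> set R),
    [/\ uniq J, forall j, measurable (B j) &
        A = [set z | forall j, j \in J -> B j (z j)]]].

Definition inputsp := g_sigma_algebraType cylinder.

HB.instance Definition _ := Measurable.on inputsp.

Lemma cylinder_setI_closed : setI_closed cylinder.
Proof.
move=> _ _ [J1 [B1 [u1 mB1 ->]]] [J2 [B2 [u2 mB2 ->]]].
pose B j := (if j \in J1 then B1 j else setT) `&` (if j \in J2 then B2 j else setT).
exists (undup (J1 ++ J2)), B; split; first exact: undup_uniq.
  by move=> j; apply: measurableI; case: ifP.
apply/seteqP; split => z /=.
  by move=> [h1 h2] j _; split; case: ifPn => // ?; [apply: h1|apply: h2].
move=> h; split => j jJ.
  have := h j; rewrite mem_undup mem_cat jJ => /(_ isT); rewrite /B jJ.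
  by case.
have := h j; rewrite mem_undup mem_cat jJ orbT => /(_ isT); rewrite /B jJ.
by case.
Qed.

Lemma measurable_coord (t : I) : measurable_fun setT (fun z : inputsp => z t).
Proof.
move=> _ B mB; rewrite setTI; apply: sub_sigma_algebra.
exists [:: t], (fun=> B); split => //; apply/seteqP; split => z /=.
  by move=> h j; rewrite inE => /eqP ->.
by apply; rewrite inE.
Qed.

Lemma measurable_to_inputsp d (X : measurableType d) (g : X -> inputsp) :
  (forall t, measurable_fun setT (fun x => g x t)) -> measurable_fun setT g.
Proof.
move=> mg; apply: (@measurability _ _ X inputsp setT g cylinder) => //.
move=> _ [_ [J [B [_ mB ->]]] <-]; rewrite setTI.
rewrite (_ : _ @^-1` _ = \big[setI/setT]_(j <- J) ((fun x => g x j) @^-1` B j)).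
  apply: big_ind => // [A A'|j _]; first exact: measurableI.
  by rewrite -[X in measurable X]setTI; exact: mg.
rewrite -bigcap_seq; apply/seteqP; split=> x /= h j jJ; exact: h.
Qed.

Definition resample (t : I) (z z' : inputsp) : inputsp :=
  fun s => if s == t then z' s else z s.

Lemma resample_eq t z z' : resample t z z' t = z' t.
Proof. by rewrite /resample eqxx. Qed.

Lemma resample_neq t s z z' : s != t -> resample t z z' s = z s.
Proof. by rewrite /resample => /negbTE ->. Qed.

Definition resample_pair (t : I) (p : inputsp * inputsp) : inputsp :=
  resample t p.1 p.2.

Lemma measurable_resample t : measurable_fun setT (resample_pair t).
Proof.
apply: measurable_to_inputsp => s; rewrite /resample_pair /resample; case: eqP => _.
  by apply: (measurableT_comp (measurable_coord s)); exact: measurable_snd.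
by apply: (measurableT_comp (measurable_coord s)); exact: measurable_fst.
Qed.

End InputSpace.

Section Resampling.
Context {R : realType} {I : choiceType}.
Notation Z := (@inputsp R I).
Local Open Scope ereal_scope.

Lemma cylinder_bigsetI (J : seq I) (B : I -> set R) :
  [set z : Z | forall j, j \in J -> B j (z j)] =
  \big[setI/setT]_(j <- J) ((fun z : Z => z j) @^-1` B j).
Proof. by rewrite -bigcap_seq; apply/seteqP; split=> z /= h j jJ; exact: h. Qed.

Lemma measurable_cylinder (J : seq I) (B : I -> set R) :
  (forall j, measurable (B j)) ->
  measurable [set z : Z | forall j, j \in J -> B j (z j)].
Proof.
move=> mB; rewrite cylinder_bigsetI; apply: big_ind => // [A A'|j _].
  exact: measurableI.
by rewrite -[X in measurable X]setTI; exact: measurable_coord.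
Qed.

Variable Q : probability Z R.
Hypothesis indepQ : mutually_independent Q (fun i (z : Z) => z i).

Let m2 (t : I) : {measure set Z -> \bar R} :=
  measure_function_pushforward__canonical__measure_function_Measure
    (Q \x Q) (measurable_resample t).

(** A box splits: [resample t z z'] lies in it iff [z] meets the constraints off [t] and [z'] the
    one at [t]. Independence multiplies the two probabilities back together, and agreement on the
    pi-system extends to all measurable sets. *)
Lemma resample_law t (A : set Z) : measurable A -> Q A = m2 t A.
Proof.
move=> mA.
apply: (@g_sigma_algebra_measure_unique _ _ Z (@cylinder R I) _ (fun=> setT) _ _ Q (m2 t)) => //.
- by move=> _ [J [B [_ mB ->]]]; exact: measurable_cylinder.
- by move=> _; exists [::], (fun=> setT); split => //; apply/seteqP; split.
- by apply/seteqP; split => // z _; exists 0%N.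
- exact: cylinder_setI_closed.
- move=> _ [J [B [uJ mB ->]]].
  pose A1 := [set z : Z | forall j, j \in rem t J -> B j (z j)].
  pose A2 := [set z : Z | t \in J -> B t (z t)].
  transitivity ((Q \x Q) (A1 `*` A2)); last first.
    congr ((Q \x Q) _); apply/seteqP.
    split => -[z z'] /=; rewrite /resample_pair /resample /=; last first.
      move=> h; split.
        move=> j; rewrite /= mem_rem_uniq// inE /= => /andP[jt jJ].
        by have := h _ jJ; rewrite (negbTE jt).
      by move=> /= /h; rewrite eqxx.
    move=> [h1 h2] j jJ; case: eqP => [jt|/eqP jt].
      by rewrite jt in jJ *; exact: h2.
    by apply: h1; rewrite /= mem_rem_uniq// inE jJ andbT.
  have mA1 : measurable A1 by exact: measurable_cylinder.
  have mA2 : measurable A2.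
    rewrite /A2; case: (boolP (t \in J)) => tJ.
      rewrite (_ : [set z | _] = (fun z : Z => z t) @^-1` B t).
        by rewrite -[X in measurable X]setTI; exact: measurable_coord.
      by apply/seteqP; split => z /=; [exact|move=> h _].
    by rewrite (_ : [set z | _] = setT)//; apply/seteqP; split.
  rewrite product_measure1E//= cylinder_bigsetI indepQ//.
  rewrite /A1 cylinder_bigsetI indepQ ?rem_uniq// /A2.
  case: (boolP (t \in J)) => tJ.
    rewrite (big_rem t)//= muleC; congr (_ * Q _).
    by apply/seteqP; split => z /=; [move=> h _|exact].
  have -> : [set z : Z | false -> B t (z t)] = setT by apply/seteqP; split.
  have -> : Q setT = 1 by exact: probability_setT.
  by rewrite mule1 rem_id.
- by move=> _; apply: (@le_lt_trans _ _ 1); [exact: probability_le1|exact: ltry].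
Qed.

(** This replaces conditioning on all inputs except [t]: the inner integral averages that single
    coordinate while the others stay fixed. *)
Lemma integral_resample (t : I) (f : Z -> \bar R) : measurable_fun setT f ->
  (forall z, 0 <= f z) ->
  \int[Q]_z f z = \int[Q]_z \int[Q]_z' f (resample t z z').
Proof.
move=> mf f0.
rewrite (@eq_measure_integral _ _ _ _ (m2 t)) => [|A mA _]; last exact: resample_law.
rewrite ge0_integral_pushforward//=; last exact: measurable_resample.
rewrite preimage_setT fubini_tonelli1//=.
by apply: (measurableT_comp mf); exact: measurable_resample.
Qed.

End Resampling.

(** * Exponential times racing against a deadline *)

Section Density.
Context d (T : measurableType d) (R : realType).
Variables (mu nu : {measure set T -> \bar R}) (g : T -> R).
Hypotheses (mg : measurable_fun setT g) (g0 : forall x, 0 <= g x).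
Hypothesis nuE : forall A, measurable A -> nu A = (\int[mu]_(x in A) (g x)%:E)%E.
Local Open Scope ereal_scope.
Import HBNNSimple.

(** [exponential_prob] is given by its values on sets; simple functions and monotone convergence
    turn integrals against it into Lebesgue integrals. *)
Lemma ge0_integral_density (f : T -> \bar R) : (forall x, 0 <= f x) ->
  measurable_fun setT f ->
  \int[nu]_x f x = \int[mu]_x (f x * (g x)%:E).
Proof.
move=> f0 mf.
have mT : measurable [set: T] by [].
pose h := nnsfun_approx mT mf.
have mgE : measurable_fun setT (EFin \o g) by exact/measurable_EFinP.
have -> : \int[nu]_x f x = lim (\int[nu]_x (EFin \o h n) x @[n --> \oo]).
  have fE x : f x = lim ((EFin \o h n) x @[n --> \oo]).
    by apply/esym/cvg_lim => //; apply: cvg_nnsfun_approx.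
  under eq_integral => x _ do rewrite fE.
  apply: monotone_convergence => //.
  - by move=> n; exact/measurable_EFinP/measurable_funP.
  - by move=> n x _ //=; rewrite lee_fin.
  - by move=> x _ a b ab; rewrite lee_fin; exact/lefP/nd_nnsfun_approx.
have -> : \int[mu]_x (f x * (g x)%:E) =
    lim (\int[mu]_x ((EFin \o h n) x * (g x)%:E) @[n --> \oo]).
  have fg x : f x * (g x)%:E = lim (((EFin \o h n) x * (g x)%:E) @[n --> \oo]).
    apply/esym/cvg_lim => //; apply: cvgeZr => //.
    by apply: cvg_nnsfun_approx.
  under eq_integral => x _ do rewrite fg.
  apply: monotone_convergence => // [n|n x _|x _ a b ab].
  - by apply/emeasurable_funM => //; exact/measurable_EFinP.
  - by rewrite /= mule_ge0 ?lee_fin.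
  - by rewrite /= lee_wpmul2r ?lee_fin//; exact/lefP/nd_nnsfun_approx.
suff suf n : \int[mu]_x ((EFin \o h n) x * (g x)%:E) = \int[nu]_x (EFin \o h n) x.
  by congr (limn _); apply/funext => n; rewrite suf.
transitivity (\int[nu]_x
   (\sum_(y \in range (h n)) (y * \1_(h n @^-1` [set y]) x)%:E)); last first.
  by apply: eq_integral => t tE; rewrite /= fimfunE -fsumEFin.
have indich r : measurable_fun setT (fun x => (r * \1_(h n @^-1` [set r]) x)%:E).
  by apply/measurable_EFinP; exact: measurable_funM.
rewrite ge0_integral_fsum//; last by move=> m y Ey; exact: nnfun_muleindic_ge0.
transitivity (\int[mu]_x (\sum_(y \in range (h n))
    (y * \1_(h n @^-1` [set y]) x)%:E * (g x)%:E)).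
  under [RHS]eq_integral => x xE.
    rewrite -ge0_mule_fsuml => [|y]; last exact: nnfun_muleindic_ge0.
    rewrite fsumEFin // -(fimfunE _ x); over.
  by [].
rewrite ge0_integral_fsum//; last 2 first.
  - by move=> y; apply: emeasurable_funM.
  - by move=> m y Ey; rewrite mule_ge0 ?lee_fin// -lee_fin nnfun_muleindic_ge0.
apply: eq_fsbigr => r rhn.
under [RHS]eq_integral do rewrite EFinM.
have r0 : (0 <= r)%R by move: rhn; rewrite inE => -[x _ <-].
rewrite integralZl_indic_nnsfun => //.
under eq_integral do rewrite EFinM -muleA.
rewrite ge0_integralZl//.
- under eq_integral do rewrite muleC.
  rewrite (eq_integral ((EFin \o g) \_ (h n @^-1` [set r]))); last first.
    by move=> x xE; rewrite epatch_indic.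
  by rewrite -integral_mkcondr setTI integral_indic// setIT nuE.
- by apply: emeasurable_funM => //; exact/measurable_EFinP.
- by move=> x _; rewrite mule_ge0 ?lee_fin.
Qed.

End Density.

Section ExponentialRace.
Context {R : realType} (lam : R) (lam0 : 0 < lam).
Notation mu := (@lebesgue_measure R).

Lemma continuous_expRM (c : R) : continuous (fun v : R => expR (c * v)).
Proof.
move=> v; apply: continuous_comp; last exact: continuous_expR.
by apply: continuousM; [exact: cst_continuous|exact: id].
Qed.

Lemma is_derive_expRM (c v : R) :
  is_derive v 1 (fun v : R => expR (c * v)) (c * expR (c * v)).
Proof.
have dc : is_derive v 1 (fun v : R => c * v) (c * 1).
  exact: (is_deriveZ c (is_derive_id v (1 : R))).
have := is_derive1_comp (is_derive_expR (c * v)) dc.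
by rewrite mulr1 mulrC.
Qed.

Lemma integral_exp_tail (b : R) :
  (\int[mu]_(x in `[b, +oo[) (lam * expR (- lam * x))%:E =
    (expR (- lam * b))%:E)%E.
Proof.
rewrite (@ge0_continuous_FTC2y _ _ (fun x => - expR (- lam * x)) _ 0).
- by rewrite EFinN oppeK add0e.
- by move=> x _; rewrite mulr_ge0 ?expR_ge0// ltW.
- apply: continuous_subspaceT => x.
  by apply: cvgM; [exact: cvg_cst|exact: continuous_expRM].
- rewrite -oppr0; apply: cvgN.
  rewrite (_ : (fun x => expR (- lam * x)) =
               (fun z => expR (- z)) \o (fun z => lam * z)); last first.
    by apply: eq_fun => x; rewrite mulNr.
  apply: (@cvg_comp _ _ _ _ _ _ (pinfty_nbhs R)); last exact: cvgr_expR.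
  exact: gt0_cvgMry.
- by move=> x _; have [] := is_derive_expRM (- lam) x => ? _; exact: derivableN.
- by apply/cvg_at_right_filter; apply: cvgN; exact: continuous_expRM.
- move=> x _; rewrite derive1E; apply: derive_val.
  have := is_deriveN (is_derive_expRM (- lam) x).
  by move=> /is_derive_eq; apply; rewrite -mulNr opprK.
Qed.

Variables (f F : R -> R) (a b : R).
Hypotheses (cf : continuous f) (dF : forall t : R, is_derive t 1 F (lam * f t)).
Hypotheses (F0 : F 0 = 0) (f_ge0 : forall t, 0 <= t -> 0 <= f t).
Hypotheses (F_ge0 : forall t, 0 <= t -> 0 <= F t).

(** By parts with [F (v - a) * exp (- lam v)]: the boundary term at [a] vanishes by [F 0 = 0], and
    the one at [b] is [F (b - a)] times the exponential tail beyond [b]. *)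
Lemma integral_exp_parts : a < b ->
  (\int[mu]_(v in `[a, b]) (f (v - a) * (lam * expR (- lam * v)))%:E =
   \int[mu]_(v in `[a, b]) (F (v - a) * (lam * expR (- lam * v)))%:E +
   (F (b - a) * expR (- lam * b))%:E)%E.
Proof.
move=> ab.
pose e (v : R) := expR (- lam * v).
have ce : continuous e by exact: continuous_expRM.
have cs : continuous (fun v : R => v - a).
  by move=> v; apply: cvgB; [exact: cvg_id|exact: cvg_cst].
have ds (v : R) : is_derive v 1 (fun v : R => v - a) 1.
  have := is_deriveB (is_derive_id v (1 : R)) (is_derive_cst a v 1).
  by rewrite subr0.
have cF : continuous F.
  by move=> x; apply: differentiable_continuous; apply/derivable1_diffP; exact: ex_derive.
pose f1 v := f (v - a) * (lam * e v).
pose f2 v := F (v - a) * (lam * e v).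
have cle : continuous (fun v => lam * e v).
  by move=> v; apply: continuousM; [exact: cst_continuous|exact: ce].
have cf1 : continuous f1.
  move=> v; apply: (@continuousM _ _ (fun v => f (v - a))); last exact: cle.
  by apply: continuous_comp; [exact: cs|exact: cf].
have cf2 : continuous f2.
  move=> v; apply: (@continuousM _ _ (fun v => F (v - a))); last exact: cle.
  by apply: continuous_comp; [exact: cs|exact: cF].
have dH (v : R) : is_derive v 1 (fun v : R => F (v - a) * e v) (f1 v - f2 v).
  have h1 := @is_derive1_comp _ F (fun v => v - a) v _ _ (dF (v - a)) (ds v).
  have h2 := is_deriveM h1 (is_derive_expRM (- lam) v).
  apply: (is_derive_eq h2).
  by rewrite /f1 /f2 /GRing.scale /= -/(e v); ring.
have i1 : mu.-integrable `[a, b] (EFin \o f1).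
  apply: continuous_compact_integrable; first exact: segment_compact.
  exact: continuous_subspaceT.
have i2 : mu.-integrable `[a, b] (EFin \o f2).
  apply: continuous_compact_integrable; first exact: segment_compact.
  exact: continuous_subspaceT.
have cH : continuous (fun v : R => F (v - a) * e v).
  move=> v; apply: (@continuousM _ _ (fun v => F (v - a))); last exact: ce.
  by apply: continuous_comp; [exact: cs|exact: cF].
have : (\int[mu]_(x in `[a, b]) (f1 x - f2 x)%:E =
       (F (b - a) * e b)%:E - (F (a - a) * e a)%:E)%E.
  apply: (@continuous_FTC2 _ _ (fun v : R => F (v - a) * e v)) => //.
  - apply: continuous_subspaceT => x.
    by apply: continuousB; [exact: cf1|exact: cf2].
  - split; last 2 first.
    + by apply/cvg_at_right_filter; exact: cH.
    + by apply/cvg_at_left_filter; exact: cH.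
    by move=> x _; exact: ex_derive.
  - by move=> x _; rewrite derive1E; exact: derive_val.
rewrite subrr F0 mul0r sube0.
under eq_integral do rewrite EFinB.
rewrite integralB_EFin// => /eqP; rewrite sube_eq//.
  by move=> /eqP ->; rewrite addeC.
exact: integrable_fin_num.
Qed.

Variable m : {measure set (measurableTypeR R) -> \bar R}.
Hypothesis mE : forall A, measurable A -> m A = exponential_prob lam A.

(** Races leave the integrands unspecified at 0 and at the ties [a], [b]; three points are
    Lebesgue-null. *)
Lemma ge0_integral_ae_itv3 (h k : R -> \bar R) (x y z : R) :
  measurable_fun setT h -> measurable_fun setT k ->
  (forall v, 0 <= h v)%E -> (forall v, 0 <= k v)%E ->
  (forall v, v != x -> v != y -> v != z -> h v = k v) ->
  (\int[mu]_v h v = \int[mu]_v k v)%E.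
Proof.
move=> mh mk h0 k0 hk; apply: ge0_ae_eq_integral => //.
exists [set x; y; z]; split.
- by apply: measurableU; first apply: measurableU.
- apply: countable_lebesgue_measure0.
  by apply: finite_set_countable; rewrite !finite_setU; split => //; split.
- move=> v /= /not_implyP[_ hv].
  have [->|vx] := eqVneq v x; first by left; left.
  have [->|vy] := eqVneq v y; first by left; right.
  have [->|vz] := eqVneq v z; first by right.
  by case: hv; exact: hk.
Qed.

(** Compensator formula for one race: [v] is an exponential time of which [a] has already elapsed,
    [b] is the deadline. Firing before [b] collects [f] of the time run since [a]; [F], with
    derivative [lam * f], is its compensator over the time actually run. *)
Lemma integral_exponential_race (h1 h2 : R -> \bar R) : 0 <= a -> a <= b ->
  measurable_fun setT h1 -> measurable_fun setT h2 ->
  (forall v, 0 <= h1 v)%E -> (forall v, 0 <= h2 v)%E ->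
  (forall v, 0 < v < a -> h1 v = 0%E /\ h2 v = 0%E) ->
  (forall v, a < v < b -> h1 v = (f (v - a))%:E /\ h2 v = (F (v - a))%:E) ->
  (forall v, b < v -> h1 v = 0%E /\ h2 v = (F (b - a))%:E) ->
  (\int[m]_v h1 v = \int[m]_v h2 v)%E.
Proof.
move=> a0 ab mh1 mh2 h10 h20 hlo hmid hhi.
have pdf0 x : 0 <= exponential_pdf lam x by apply: exponential_pdf_ge0; exact: ltW.
have mpdf := @measurable_exponential_pdf R lam.
have cle : continuous (fun v : R => lam * expR (- lam * v)).
  by move=> v; apply: cvgM; [exact: cvg_cst|exact: continuous_expRM].
have dens h : measurable_fun setT h -> (forall v, 0 <= h v)%E ->
    (\int[m]_v h v = \int[mu]_v (h v * (exponential_pdf lam v)%:E))%E.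
  move=> mh h0.
  exact: (@ge0_integral_density _ _ _ mu m (exponential_pdf lam)).
rewrite !dens//.
have pdfE v : 0 <= v -> exponential_pdf lam v = lam * expR (- lam * v).
  by move=> v0; rewrite exponential_pdfE.
have cs : continuous (fun v : R => v - a).
  by move=> v; apply: cvgB; [exact: cvg_id|exact: cvg_cst].
have cF : continuous F.
  by move=> x; apply: differentiable_continuous; apply/derivable1_diffP; exact: ex_derive.
pose k1 v := f (v - a) * (lam * expR (- lam * v)).
pose k2 v := F (v - a) * (lam * expR (- lam * v)).
pose k3 v := F (b - a) * (lam * expR (- lam * v)).
have ck1 : continuous k1.
  move=> v; apply: (@cvgM _ _ _ _ (fun v => f (v - a))); last exact: cle.
  by apply: continuous_comp; [exact: cs|exact: cf].
have ck2 : continuous k2.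
  move=> v; apply: (@cvgM _ _ _ _ (fun v => F (v - a))); last exact: cle.
  by apply: continuous_comp; [exact: cs|exact: cF].
have ck3 : continuous k3 by move=> v; apply: cvgM; [exact: cvg_cst|exact: cle].
have mk1 : measurable_fun setT k1 by exact: continuous_measurable_fun.
have mk2 : measurable_fun setT k2 by exact: continuous_measurable_fun.
have mk3 : measurable_fun setT k3 by exact: continuous_measurable_fun.
have le0 v : 0 <= lam * expR (- lam * v) by rewrite mulr_ge0 ?expR_ge0// ltW.
have mpatch (k : R -> R) (i : interval R) : measurable_fun setT k ->
    measurable_fun setT ((EFin \o k) \_ [set` i]).
  move=> mk; apply/(measurable_restrictT _ _).1 => //.
  by apply/measurable_EFinP; exact: measurable_funTS.
have pE (k : R -> R) (i : interval R) (v : R) :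
    ((EFin \o k) \_ [set` i]) v = if v \in i then (k v)%:E else 0%E.
  rewrite patchE; case: ifPn => [|vi]; first by rewrite inE /= => ->.
  by rewrite ifF//; apply: contraNF vi => vi; rewrite inE.
have k1_ge0 v : (0 <= ((EFin \o k1) \_ `[a, b]) v)%E.
  rewrite pE; case: ifPn => //; rewrite in_itv /= => /andP[av _].
  by rewrite lee_fin mulr_ge0// f_ge0 ?subr_ge0.
have k2_ge0 v : (0 <= ((EFin \o k2) \_ `[a, b]) v)%E.
  rewrite pE; case: ifPn => //; rewrite in_itv /= => /andP[av _].
  by rewrite lee_fin mulr_ge0// F_ge0 ?subr_ge0.
have k3_ge0 v : (0 <= ((EFin \o k3) \_ `[b, +oo[) v)%E.
  rewrite pE; case: ifPn => //; rewrite in_itv /= => /andP[av _].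
  by rewrite lee_fin mulr_ge0// F_ge0 ?subr_ge0.
have pdfneg v : v < 0 -> exponential_pdf lam v = 0 by exact: lt0_exponential_pdf.
rewrite (@ge0_integral_ae_itv3 _ ((EFin \o k1) \_ `[a, b]) 0 a b)//; last 4 first.
- by apply: emeasurable_funM => //; exact/measurable_EFinP.
- exact: mpatch.
- by move=> v; rewrite mule_ge0 ?lee_fin.
- move=> v v0 va vb; rewrite pE; case: ifPn; rewrite in_itv /=.
    move=> /andP[av bv]; rewrite (hmid v _).1.
      by rewrite pdfE// (le_trans a0).
    by rewrite !lt_neqAle av bv eq_sym va vb.
  rewrite negb_and -!ltNge => /orP[av|bv].
    have [v1|v1] := ltP v 0; first by rewrite pdfneg// mule0.
    by rewrite (hlo v _).1 ?mul0e// av andbT lt_neqAle eq_sym v0.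
  by rewrite (hhi v _).1// mul0e.
rewrite [RHS](@ge0_integral_ae_itv3 _
    (fun v => ((EFin \o k2) \_ `[a, b]) v + ((EFin \o k3) \_ `[b, +oo[) v)%E 0 a b)//; last 5 first.
- by apply: emeasurable_funM => //; exact/measurable_EFinP.
- by apply: emeasurable_funD; exact: mpatch.
- by move=> v; rewrite mule_ge0 ?lee_fin.
- by move=> v; rewrite adde_ge0.
- move=> v v0 va vb /=; rewrite !pE !in_itv /= !andbT.
  have [av|av|/eqP] := ltgtP a v; last by rewrite eq_sym (negbTE va).
    have [bv|bv|/eqP] := ltgtP v b; last by rewrite (negbTE vb).
      by rewrite (hmid v _).2 ?av// pdfE ?adde0// (le_trans a0)// ltW.
    by rewrite (hhi v _).2// pdfE ?add0e// (le_trans a0)// ltW.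
  rewrite (_ : (b <= v) = false) ?adde0; last first.
    by apply/negbTE; rewrite -ltNge (lt_le_trans av).
  have [v1|v1] := ltP v 0; first by rewrite pdfneg// mule0.
  by rewrite (hlo v _).2 ?mul0e// av andbT lt_neqAle eq_sym v0.
rewrite ge0_integralD//; [|exact: mpatch|exact: mpatch].
rewrite -!integral_mkcond /=.
(* Past the deadline the compensator stays at [F (b - a)]; this tail is the boundary term of the
   integration by parts. *)
have -> : (\int[mu]_(v in `[b, +oo[) (k3 v)%:E =
           (F (b - a) * expR (- lam * b))%:E)%E.
  under eq_integral do rewrite EFinM.
  rewrite ge0_integralZl_EFin//.
  - by rewrite integral_exp_tail.
  - by move=> v _; rewrite lee_fin.
  - by apply/measurable_EFinP/measurable_funTS; exact: continuous_measurable_fun.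
  - by rewrite F_ge0 ?subr_ge0.
move: ab; rewrite le_eqVlt => /orP[/eqP abE|ab]; last exact: integral_exp_parts.
by rewrite -abE set_itv1 !integral_set1 subrr F0 mul0r adde0.
Qed.

End ExponentialRace.

(** * Expectations of nonnegative real functions *)

Section NonnegativeExpectation.
Context d (T : measurableType d) (R : realType) (Q : probability T R).
Local Open Scope ereal_scope.

Definition Ex (f : T -> R) : \bar R := \int[Q]_z (f z)%:E.

Definition nnmeas (f : T -> R) := measurable_fun setT f /\ (forall z, (0 <= f z)%R).

Lemma nnmeas_cst (k : R) : (0 <= k)%R -> nnmeas (fun=> k).
Proof. by move=> k0; split => //; exact: measurable_cst. Qed.

Lemma nnmeasD f g : nnmeas f -> nnmeas g -> nnmeas (fun z => f z + g z)%R.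
Proof.
move=> [mf f0] [mg g0]; split; first exact: measurable_funD.
by move=> z; rewrite addr_ge0.
Qed.

Lemma nnmeasM f g : nnmeas f -> nnmeas g -> nnmeas (fun z => f z * g z)%R.
Proof.
move=> [mf f0] [mg g0]; split; first exact: measurable_funM.
by move=> z; rewrite mulr_ge0.
Qed.

Lemma nnmeas_sum (I : Type) (s : seq I) (p : pred I) (f : I -> T -> R) :
  (forall i, nnmeas (f i)) -> nnmeas (fun z => \sum_(i <- s | p i) f i z)%R.
Proof.
move=> mf; elim: s => [|i s IH].
  by under eq_fun do rewrite big_nil; exact: nnmeas_cst.
under eq_fun do rewrite big_cons; case: (p i) => //; exact: nnmeasD.
Qed.

Lemma Ex_ge0 f : (forall z, 0 <= f z)%R -> 0 <= Ex f.
Proof. by move=> f0; apply: integral_ge0 => z _; rewrite lee_fin. Qed.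

Lemma ExD f g : nnmeas f -> nnmeas g -> Ex (fun z => f z + g z)%R = Ex f + Ex g.
Proof.
move=> [mf f0] [mg g0]; rewrite /Ex; under eq_integral do rewrite EFinD.
by rewrite ge0_integralD//; first [exact/measurable_EFinP | move=> z _; rewrite lee_fin].
Qed.

Lemma ExZ (k : R) f : (0 <= k)%R -> nnmeas f -> Ex (fun z => k * f z)%R = k%:E * Ex f.
Proof.
move=> k0 [mf f0]; rewrite /Ex; under eq_integral do rewrite EFinM.
by rewrite ge0_integralZl_EFin//; first [exact/measurable_EFinP | move=> z _; rewrite lee_fin].
Qed.

Lemma Ex_sum (I : Type) (s : seq I) (p : pred I) (f : I -> T -> R) :
  (forall i, nnmeas (f i)) ->
  Ex (fun z => \sum_(i <- s | p i) f i z)%R = \sum_(i <- s | p i) Ex (f i).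
Proof.
move=> mf; elim: s => [|i s IH].
  rewrite big_nil /Ex; under eq_integral do rewrite big_nil.
  by rewrite integral0.
rewrite big_cons -IH; case: ifPn => pi.
  rewrite -ExD//; last exact: nnmeas_sum.
  by rewrite /Ex; under eq_integral do rewrite big_cons pi.
by rewrite /Ex; under eq_integral do rewrite big_cons (negbTE pi).
Qed.

Lemma Ex_le f g : nnmeas f -> nnmeas g -> (forall z, f z <= g z)%R -> Ex f <= Ex g.
Proof.
move=> [mf f0] [mg g0] fg; apply: ge0_le_integral => //.
- by move=> z _; rewrite lee_fin.
- exact/measurable_EFinP.
- exact/measurable_EFinP.
- by move=> z _; rewrite lee_fin.
Qed.

Lemma Ex_eq f g : f =1 g -> Ex f = Ex g.
Proof. by move=> /funext ->. Qed.

Lemma Ex_cst (k : R) : Ex (fun=> k) = k%:E.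
Proof.
rewrite /Ex integral_cst// (_ : _ setT = 1); first by rewrite mule1.
exact: probability_setT.
Qed.

Lemma Ex_fin f (k : R) : nnmeas f -> (forall z, f z <= k)%R -> Ex f \is a fin_num.
Proof.
move=> nf fk; rewrite ge0_fin_numE; last by apply: Ex_ge0; exact: nf.2.
apply: (@le_lt_trans _ _ (Ex (fun=> k))); last by rewrite Ex_cst ltry.
apply: Ex_le => //; apply: nnmeas_cst.
exact: le_trans (nf.2 point) (fk point).
Qed.

End NonnegativeExpectation.

(** * Wald's identity by leaving one input out *)

Section LeaveOneOut.
Context {R : realType} {I : choiceType} {St : Type}.
Notation Z := (@inputsp R I).
Variables (step : Z -> St -> St) (s0 : Z -> St).

Definition trajectory (z : Z) (j : nat) : St := iter j (step z) (s0 z).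

Lemma trajectoryS z j : trajectory z j.+1 = step z (trajectory z j).
Proof. by []. Qed.

Lemma le_iter_measure {T : numDomainType} (g : St -> T) z :
  (forall j, g (trajectory z j) <= g (trajectory z j.+1)) ->
  {homo (fun j => g (trajectory z j)) : i j / (i <= j)%N >-> i <= j}.
Proof. by move=> h; apply: homo_leq => // ? ? ?; exact: le_trans. Qed.

Section CounterInvariance.
Variables (cnt : St -> nat) (t : I) (m : nat).
Hypothesis s0_res : forall z z', s0 (resample t z z') = s0 z.
Hypothesis step_res : forall z z' s, (cnt s <= m)%N ->
  step (resample t z z') s = step z s \/
  (m < cnt (step z s) /\ m < cnt (step (resample t z z') s))%N.
Hypothesis cnt_mono : forall z s, (cnt s <= cnt (step z s))%N.

(** Stopping-time property: two runs that differ in one input coincide until it is read, and reading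
    it pushes both counters past [m], where monotonicity keeps them. *)
Lemma counter_resample z z' j :
  (m < cnt (trajectory (resample t z z') j))%N = (m < cnt (trajectory z j))%N.
Proof.
suff : trajectory (resample t z z') j = trajectory z j \/
    (m < cnt (trajectory (resample t z z') j) /\ m < cnt (trajectory z j))%N.
  by case=> [->//|[-> ->]].
elim: j => [|j [IH|[h1 h2]]]; first by left; rewrite /trajectory /= s0_res.
  rewrite !trajectoryS IH.
  have [cm|cm] := leqP (cnt (trajectory z j)) m; last first.
    by right; split; apply: (leq_trans cm).
  by case: (step_res z z' cm) => [|[]]; [left|right].
by right; rewrite !trajectoryS; split; [apply: (leq_trans h1)|apply: (leq_trans h2)].
Qed.

End CounterInvariance.

Section Wald.
Variable Q : probability Z R.
Hypothesis indepQ : mutually_independent Q (fun i (z : Z) => z i).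
Variables (cnt : St -> nat) (tag : nat -> I) (h : R -> R).
Hypothesis s0_res : forall m z z', s0 (resample (tag m) z z') = s0 z.
Hypothesis step_res : forall m z z' s, (cnt s <= m)%N ->
  step (resample (tag m) z z') s = step z s \/
  (m < cnt (step z s) /\ m < cnt (step (resample (tag m) z z') s))%N.
Hypothesis cnt_mono : forall z s, (cnt s <= cnt (step z s))%N.
Hypothesis cnt_le : forall z j, (cnt (trajectory z j) <= j)%N.
Hypothesis mcnt : forall j, measurable_fun setT
  (fun z => (cnt (trajectory z j))%:R : R).
Hypothesis mh : measurable_fun setT h.
Hypothesis h0 : forall v, 0 <= h v.
Hypothesis law : forall m, Ex Q (fun z => h (z (tag m))) = Ex Q (fun z => h (z (tag 0))).

Let mhc m : measurable_fun setT (fun z : Z => h (z (tag m))).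
Proof. by apply: (measurableT_comp mh); exact: measurable_coord. Qed.

Lemma measurable_counter_gt m j :
  measurable_fun setT (fun z => (m < cnt (trajectory z j))%N%:R : R).
Proof.
rewrite (_ : (fun z => _) = (fun k : R => (m%:R < k)%R%:R) \o
    (fun z => (cnt (trajectory z j))%:R)); last first.
  by apply/funext => z /=; rewrite ltr_nat.
apply: measurableT_comp => //.
have -> : (fun k : R => (m%:R < k)%R%:R : R) = \1_(`]m%:R, +oo[).
  by apply/funext => k; rewrite indicE mem_setE in_itv /= andbT.
exact: measurable_indic.
Qed.

Lemma sum_counter (F : nat -> R) z j :
  \sum_(m < cnt (trajectory z j)) F m =
  \sum_(m < j) (m < cnt (trajectory z j))%N%:R * F m.
Proof.
rewrite (big_ord_widen j F (cnt_le z j)) big_mkcond /=.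
by apply: eq_bigr => m _; case: ifP => _; rewrite ?mul1r ?mul0r.
Qed.

Lemma nnmeas_counter_sum j :
  nnmeas (fun z => \sum_(m < cnt (trajectory z j)) h (z (tag m))).
Proof.
rewrite (_ : (fun z => _) = fun z : Z =>
    \sum_(m < j) (m < cnt (trajectory z j))%N%:R * h (z (tag m))); last first.
  by apply/funext => z; exact: (sum_counter (fun m => h (z (tag m)))).
apply: nnmeas_sum => m; apply: nnmeasM; last by split => // z; exact: h0.
by split => //; exact: measurable_counter_gt.
Qed.

(** The [m]-th input is averaged first: by [counter_resample] the indicator is constant in it and
    leaves the inner integral. *)
Lemma Ex_wald_term m j :
  Ex Q (fun z => (m < cnt (trajectory z j))%N%:R * h (z (tag m))) =
  (Ex Q (fun z => (m < cnt (trajectory z j))%N%:R) * Ex Q (fun z => h (z (tag 0))))%E.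
Proof.
have nn1 : nnmeas (fun z : Z => (m < cnt (trajectory z j))%N%:R : R).
  by split=> //; exact: measurable_counter_gt.
have nnh : nnmeas (fun z : Z => h (z (tag m))) by split => // z; exact: h0.
have [mf f0] := nnmeasM nn1 nnh.
rewrite /Ex (integral_resample indepQ (tag m));
  [|exact/measurable_EFinP|by move=> z; rewrite lee_fin].
have inner (z : Z) : (\int[Q]_z' ((m < cnt (trajectory (resample (tag m) z z') j))%N%:R *
      h (resample (tag m) z z' (tag m)))%:E =
    ((m < cnt (trajectory z j))%N%:R)%:E * Ex Q (fun z => h (z (tag 0))))%E.
  rewrite -(law m) -ExZ//; apply: eq_integral => z' _.
  by rewrite (counter_resample (@s0_res m) (@step_res m))// resample_eq.
under eq_integral do rewrite inner.
rewrite ge0_integralZr//; last by apply: Ex_ge0 => z; exact: h0.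
have /measurable_EFinP := nn1.1.
exact.
Qed.

(** After [j] steps the counter is at most [j], so the random sum is a fixed sum of [j] terms
    weighted by [m < cnt], each of which factors. *)
Lemma wald j :
  Ex Q (fun z => \sum_(m < cnt (trajectory z j)) h (z (tag m))) =
  (Ex Q (fun z => (cnt (trajectory z j))%:R) * Ex Q (fun z => h (z (tag 0))))%E.
Proof.
have nn1 m : nnmeas (fun z : Z => (m < cnt (trajectory z j))%N%:R : R).
  by split=> //; exact: measurable_counter_gt.
have nnh m : nnmeas (fun z : Z => h (z (tag m))) by split => // z; exact: h0.
rewrite (Ex_eq Q (fun z : Z => sum_counter (fun m => h (z (tag m))) z j)).
rewrite Ex_sum => [|m]; last exact: nnmeasM.
under eq_bigr do rewrite Ex_wald_term.
rewrite -ge0_sume_distrl => [|m _]; last exact: Ex_ge0.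
rewrite -Ex_sum//; congr (_ * _)%E; apply: Ex_eq => z.
have := sum_counter (fun=> 1) z j; rewrite sumr_const card_ord => ->.
by under [RHS]eq_bigr do rewrite mulr1.
Qed.

End Wald.
End LeaveOneOut.

(** * Compensation of arrivals along a run *)

Section Compensator.
Context {R : realType} {I : choiceType} {St : Type}.
Notation Z := (@inputsp R I).
Variables (step : Z -> St -> St) (s0 : Z -> St).
Notation tr := (trajectory step s0).
Variables (tag : nat -> I) (x : R -> R) (cnt : St -> nat) (clock : St -> R).
Variable c : St -> R.

(** Arrival number [m], counted from 0, happens at [epoch z m.+1]; when the counter shows [m],
    [epoch z m] is the last arrival already seen, or time 0. *)
Definition epoch (z : Z) (m : nat) : R := \sum_(l < m) x (z (tag l)).

Hypothesis tag_inj : injective tag.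
Hypothesis x_pos : forall v, 0 < v -> x v = v.
Hypothesis s0_res : forall m z z', s0 (resample (tag m) z z') = s0 z.
Hypothesis step_before : forall m z z' s, (cnt s < m)%N ->
  step (resample (tag m) z z') s = step z s.
Hypothesis step_alt : forall m z z' s, cnt s = m -> (cnt (step z s) <= m)%N ->
  clock (step z s) < epoch z m + x (z' (tag m)) ->
  step (resample (tag m) z z') s = step z s.
Hypothesis step_race : forall m z s, cnt s = m -> c s != 0 ->
  exists B, forall z', let y := resample (tag m) z z' in
    [/\ clock (step y s) = Num.min (epoch z m + x (z' (tag m))) B,
        epoch z m + x (z' (tag m)) < B -> cnt (step y s) = m.+1 &
        B < epoch z m + x (z' (tag m)) -> cnt (step y s) = m].
Hypothesis cnt_mono : forall z s, (cnt s <= cnt (step z s))%N.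
Hypothesis clock_mono : forall z j, clock (tr z j) <= clock (tr z j.+1).
Hypothesis clock_ge : forall z j, epoch z (cnt (tr z j)) <= clock (tr z j).
Hypothesis clock_le : forall z j, clock (tr z j) <= epoch z (cnt (tr z j)).+1.
Hypothesis c_ge0 : forall s, 0 <= c s.

Lemma epoch_resample m z z' : epoch (resample (tag m) z z') m = epoch z m.
Proof.
apply: eq_bigr => l _; rewrite resample_neq//.
by apply/eqP => /tag_inj lm; have := ltn_ord l; rewrite lm ltnn.
Qed.

Lemma epoch_resampleS m z z' :
  epoch (resample (tag m) z z') m.+1 = epoch z m + x (z' (tag m)).
Proof.
rewrite /epoch big_ord_recr /= resample_eq; congr (_ + _).
exact: epoch_resample.
Qed.

Lemma resample_twice t (z z1 z2 : Z) :
  resample t (resample t z z1) z2 = resample t z z2.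
Proof. by apply/funext => s; rewrite /resample; case: eqP. Qed.

Lemma tr_cnt_mono z i j : (i <= j)%N -> (cnt (tr z i) <= cnt (tr z j))%N.
Proof.
by apply: (homo_leq leqnn leq_trans (f := fun j => cnt (tr z j))) => k; exact: cnt_mono.
Qed.

Lemma tr_clock_mono z i j : (i <= j)%N -> clock (tr z i) <= clock (tr z j).
Proof. by apply: (le_iter_measure (g := clock)) => k; exact: clock_mono. Qed.

(* Until its m-th arrival is reached, a trajectory does not depend on when
   that arrival is scheduled. *)
Lemma trajectory_resample m z z1 z2 j :
  cnt (tr (resample (tag m) z z1) j) = m ->
  clock (tr (resample (tag m) z z1) j) < epoch z m + x (z2 (tag m)) ->
  tr (resample (tag m) z z2) j = tr (resample (tag m) z z1) j.
Proof.
move=> cm cl.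
have H l : (l <= j)%N ->
    tr (resample (tag m) z z2) l = tr (resample (tag m) z z1) l.
  elim: l => [_|l IH lj]; first by rewrite /trajectory /= !s0_res.
  rewrite !trajectoryS IH 1?ltnW//.
  set y1 := resample (tag m) z z1.
  have -> : resample (tag m) z z2 = resample (tag m) y1 z2.
    by rewrite /y1 resample_twice.
  have cl1 : (cnt (tr y1 l.+1) <= m)%N by rewrite -cm; exact: tr_cnt_mono.
  have cl0 : (cnt (tr y1 l) <= m)%N by apply: leq_trans cl1; exact: tr_cnt_mono.
  move: cl0; rewrite leq_eqVlt => /orP[/eqP cl0|cl0]; last exact: step_before.
  apply: step_alt => //; rewrite /y1 epoch_resample.
  by apply: le_lt_trans cl; rewrite -trajectoryS; exact: tr_clock_mono.
exact: H.
Qed.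

(** With all inputs but the [m]-th interarrival time fixed, step [j] is reached with counter [m]
    exactly when that time exceeds [a], ties aside, and then always in the same state [s]. Here [a]
    is the time since the last arrival, and [b] runs from that arrival to the next competing
    event. *)
Lemma race_structure m z z0 j : let y0 := resample (tag m) z z0 in
  cnt (tr y0 j) = m -> c (tr y0 j) != 0 -> 
  let s := tr y0 j in let a := clock s - epoch z m in
  exists b, [/\ 0 <= a, a <= b & forall z', let y := resample (tag m) z z' in
    [/\ x (z' (tag m)) < a -> cnt (tr y j) <> m,
        a < x (z' (tag m)) -> tr y j = s &
        a < x (z' (tag m)) -> 
        [/\ clock (tr y j.+1) - clock s = Num.min (x (z' (tag m))) b - a,
        x (z' (tag m)) < b -> cnt (tr y j.+1) = m.+1 &
        b < x (z' (tag m)) -> cnt (tr y j.+1) = m]]].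
Proof.
move=> y0 cm c0 s a.
have [B HB] := @step_race m z s cm c0.
have a0 : 0 <= a.
  by rewrite subr_ge0 -(epoch_resample m z z0) -[X in epoch _ X]cm clock_ge.
have later z' : a < x (z' (tag m)) -> tr (resample (tag m) z z') j = s.
  by move=> av; apply: trajectory_resample => //; rewrite -ltrBlDl.
exists (B - epoch z m); split => //.
  (* A value beyond both [a] and the deadline: the competitor wins the next step, and monotonicity
     of the clock then yields [a <= b]. *)
  pose v := Num.max a (B - epoch z m) + 1.
  have va : a < v by rewrite /v ltr_pwDr// le_max lexx.
  have vB : B - epoch z m < v by rewrite /v ltr_pwDr// le_max lexx orbT.
  have v0 : 0 < v by exact: le_lt_trans va.
  pose z' : Z := fun=> v.
  have xv : x (z' (tag m)) = v by exact: x_pos.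
  have [h1 _ _] := HB z'; rewrite xv in h1.
  have sE : tr (resample (tag m) z z') j = s by apply: later; rewrite xv.
  have := clock_mono (resample (tag m) z z') j; rewrite trajectoryS sE h1.
  rewrite le_min => /andP[_ sB]; exact: lerB.
move=> z' y; split.
- move=> va cy.
  have vy : clock (tr y j) <= epoch z m + x (z' (tag m)).
    by rewrite -epoch_resampleS -/y -cy clock_le.
  have v0 : a <= x (z0 (tag m)).
    by rewrite lerBlDl -epoch_resampleS -/y0 -cm clock_le.
  have e : tr y0 j = tr y j.
    apply: trajectory_resample => //; apply: le_lt_trans vy _.
    by rewrite ltrD2l (lt_le_trans va).
  by move: va; rewrite ltNge /a /s e lerBlDl vy.
- exact: later.
- move=> av; rewrite trajectoryS (later _ av).
  have [h1 h2 h3] := HB z'; rewrite -/y in h1 h2 h3; split.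
  + rewrite h1 /a.
    by case: (leP _ B) => ?; case: (leP _ (B - _)) => ?; lra.
  + by move=> vB; apply: h2; rewrite -ltrBrDl.
  + by move=> vB; apply: h3; rewrite -ltrBlDl.
Qed.

Variables (Q : probability Z R) (lam : R) (f F : R -> R).
Hypothesis indepQ : mutually_independent Q (fun i (z : Z) => z i).
Hypothesis lam_gt0 : 0 < lam.
Hypothesis law : forall m A, measurable A ->
  Q ((fun z : Z => z (tag m)) @^-1` A) = exponential_prob lam A.
Hypothesis cnt_le : forall z j, (cnt (tr z j) <= j)%N.
Hypothesis mc : forall j, measurable_fun setT (fun z => c (tr z j)).
Hypothesis mcnt : forall j, measurable_fun setT (fun z => (cnt (tr z j))%:R : R).
Hypothesis mclock : forall j, measurable_fun setT (fun z => clock (tr z j)).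
Hypotheses (cf : continuous f) (dF : forall t : R, is_derive t 1 F (lam * f t)).
Hypotheses (F0 : F 0 = 0) (f_ge0 : forall t, 0 <= t -> 0 <= f t).
Hypotheses (F_ge0 : forall t, 0 <= t -> 0 <= F t).

Definition dt (z : Z) (j : nat) : R := clock (tr z j.+1) - clock (tr z j).

Definition fired (z : Z) (j : nat) : R :=
  (cnt (tr z j.+1))%:R - (cnt (tr z j))%:R.

Let dt_ge0 z j : 0 <= dt z j. Proof. by rewrite subr_ge0. Qed.

Let continuous_F : continuous F.
Proof.
by move=> y; apply: differentiable_continuous; apply/derivable1_diffP; exact: ex_derive.
Qed.

Let mf : measurable_fun setT f. Proof. exact: continuous_measurable_fun. Qed.
Let mF : measurable_fun setT F. Proof. exact: continuous_measurable_fun. Qed.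

Lemma measurable_dt j : measurable_fun setT (fun z => dt z j).
Proof. by apply: measurable_funB. Qed.

Lemma nnmeas_fired j : nnmeas (fun z => fired z j).
Proof.
split; first by apply: measurable_funB.
by move=> z; rewrite subr_ge0 ler_nat trajectoryS.
Qed.

Lemma nnmeas_fired_f j : nnmeas (fun z => c (tr z j) * (fired z j * f (dt z j))).
Proof.
apply: nnmeasM; first by split.
apply: nnmeasM; first exact: nnmeas_fired.
by split => [|z]; [apply: measurableT_comp => //; exact: measurable_dt|exact: f_ge0].
Qed.

Lemma nnmeas_F_dt j : nnmeas (fun z => c (tr z j) * F (dt z j)).
Proof.
apply: nnmeasM; first by split.
by split => [|z]; [apply: measurableT_comp => //; exact: measurable_dt|exact: F_ge0].
Qed.

Let at_cnt m j (z : Z) : R := (cnt (tr z j) == m)%:R.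

Let nnmeas_at_cnt m j : nnmeas (at_cnt m j).
Proof.
split => //.
rewrite (_ : at_cnt m j = \1_[set m%:R] \o (fun z => (cnt (tr z j))%:R : R)).
  by apply: measurableT_comp => //; exact: measurable_indic.
apply/funext => z; rewrite /at_cnt /= indicE; congr (_%:R); congr nat_of_bool.
by apply/idP/idP => [/eqP ->|]; rewrite inE//= => /eqP; rewrite eqr_nat.
Qed.

Let Ex_split G j : nnmeas G ->
  Ex Q G = (\sum_(m < j.+1) Ex Q (fun z => at_cnt m j z * G z)%R)%E.
Proof.
move=> mG; rewrite -(@Ex_sum _ _ _ Q _ _ _ (fun (m : 'I_j.+1) z => at_cnt m j z * G z)%R).
  apply: Ex_eq => z; rewrite -mulr_suml (bigD1 (Ordinal (cnt_le z j : cnt (tr z j) < j.+1)%N))//=.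
  rewrite /at_cnt eqxx big1 ?addr0 ?mul1r// => m mE.
  by apply/eqP; rewrite pnatr_eq0 eqb0; apply: contra mE => /eqP e; apply/eqP/val_inj.
by move=> m; exact: nnmeasM.
Qed.

(* Conditioning on all inputs but the m-th interarrival time, step j is a race
   between that exponential time and a deterministic bound. *)
Lemma compensator j :
  Ex Q (fun z => c (tr z j) * (fired z j * f (dt z j))) =
  Ex Q (fun z => c (tr z j) * F (dt z j)).
Proof.
(* Which coordinate to average depends on the counter, so the expectation is split along its value,
   at most [j] after [j] steps. *)
rewrite (Ex_split j (nnmeas_fired_f j)) (Ex_split j (nnmeas_F_dt j)).
apply: eq_bigr => m _.
set K1 := (X in Ex Q X = _); set K2 := (X in _ = Ex Q X).
have [mK1 K10] : nnmeas K1 by apply: nnmeasM => //; exact: nnmeas_fired_f.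
have [mK2 K20] : nnmeas K2 by apply: nnmeasM => //; exact: nnmeas_F_dt.
pose t := tag m.
have res (K : Z -> R) : measurable_fun setT K -> (forall z, 0 <= K z) ->
    Ex Q K = (\int[Q]_z \int[Q]_z' (K (resample t z z'))%:E)%E.
  move=> mK K0; rewrite /Ex (integral_resample indepQ t)//.
  exact/measurable_EFinP.
rewrite (res _ mK1 K10) (res _ mK2 K20).
apply: eq_integral => z _.
pose sub (v : measurableTypeR R) : Z := resample t z (fun=> v).
have msub : measurable_fun setT sub.
  apply: measurable_to_inputsp => s; rewrite /sub /resample.
  by case: eqP => _; [exact: measurable_id|exact: measurable_cst].
have subE z' : resample t z z' = sub (z' t).
  by apply/funext => s; rewrite /sub /resample; case: eqP => // ->.
have mco : measurable_fun setT (fun z : Z => z t : measurableTypeR R).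
  exact: measurable_coord.
pose mu := measure_function_pushforward__canonical__measure_function_Measure Q mco.
have push (K : Z -> R) : measurable_fun setT K -> (forall z, 0 <= K z) ->
    (\int[Q]_z' (K (resample t z z'))%:E = \int[mu]_v (K (sub v))%:E)%E.
  move=> mK K0; rewrite ge0_integral_pushforward//=.
  - by rewrite preimage_setT; apply: eq_integral => z' _; rewrite subE.
  - by apply/measurable_EFinP; exact: measurableT_comp.
  - by move=> v _; rewrite lee_fin.
rewrite !push//.
(* If no value of this interarrival time leads to counter [m] with a nonzero weight, both integrands
   vanish. *)
have [[z0 [cm c0]]|none] := pselect (exists z0,
    cnt (tr (resample t z z0) j) = m /\ c (tr (resample t z z0) j) != 0); last first.
  apply: eq_integral => v _; congr EFin; rewrite /K1 /K2 /at_cnt.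
  have [e|] := eqVneq (cnt _) m; last by rewrite !mul0r.
  have [->|h] := eqVneq (c (tr (sub v) j)) 0; first by rewrite !mul0r.
  by exfalso; apply: none; exists (fun=> v); split.
have [b [a0 ab H]] := race_structure cm c0.
set s := tr _ j in a0 ab H c0; set a := clock s - epoch z m in a0 ab H.
have sub_t v : sub v = resample t z (fun=> v) by [].
(* The weight [c s] is a constant factor, since every value above [a] leads to the same state
   [s]. *)
apply: (@integral_exponential_race _ lam lam_gt0 (fun t => c s * f t)
    (fun t => c s * F t) a b) => //.
- by move=> y; apply: cvgM; [exact: cvg_cst|exact: cf].
- move=> y; have h : is_derive y 1 (fun t => c s * F t) (c s * (lam * f y)).
    exact: (is_deriveZ (c s) (dF y)).
  by rewrite mulrCA.
- by rewrite F0 mulr0.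
- by move=> y y0; rewrite mulr_ge0// f_ge0.
- by move=> y y0; rewrite mulr_ge0// F_ge0.
- by move=> A mA; exact: law.
- by apply/measurable_EFinP; apply: (measurableT_comp mK1 msub).
- by apply/measurable_EFinP; apply: (measurableT_comp mK2 msub).
- by move=> v; rewrite lee_fin.
- by move=> v; rewrite lee_fin.
- move=> v /andP[v0 va]; have [h _ _] := H (fun=> v).
  rewrite x_pos// in h; rewrite /K1 /K2 /at_cnt.
  have [e|] := eqVneq (cnt _) m; last by rewrite !mul0r.
  by case: (h va e).
- move=> v /andP[av vb]; have v0 : 0 < v by exact: le_lt_trans av.
  have [_ h1 h2] := H (fun=> v); rewrite x_pos// in h1 h2.
  have {}h1 := h1 av; have [{}h2 h3 _] := h2 av.
  rewrite /K1 /K2 /at_cnt /fired /dt sub_t h1 cm eqxx !mul1r h3// h2 (min_idPl (ltW vb)).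
  by rewrite mulrSr addrAC subrr add0r mul1r.
- move=> v bv; have av : a < v by exact: le_lt_trans bv.
  have v0 : 0 < v by exact: le_lt_trans av.
  have [_ h1 h2] := H (fun=> v); rewrite x_pos// in h1 h2.
  have {}h1 := h1 av; have [{}h2 _ h3] := h2 av.
  rewrite /K1 /K2 /at_cnt /fired /dt sub_t h1 cm eqxx !mul1r h3// h2 (min_idPr (ltW bv)).
  by rewrite subrr mul0r mulr0.
Qed.

End Compensator.

(** * Measurability of the queue *)

Section Piecewise.
Context d (Z : measurableType d).

(* The events of a path are decided by comparing input-dependent times, so a state
   is a nice function of the inputs only on each piece of a countable measurable
   cover. *)
Inductive piecewise {St : Type} (E : (Z -> St) -> Prop) : (Z -> St) -> Prop :=
| piecewise_base s : E s -> piecewise E s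
| piecewise_glue (A : nat -> set Z) (s_ : nat -> Z -> St) s :
    (forall m, measurable (A m)) -> (forall z, exists m, A m z) ->
    (forall m z, A m z -> s z = s_ m z) ->
    (forall m, piecewise E (s_ m)) -> piecewise E s.

Lemma measurable_glue d' (V : measurableType d') (A : nat -> set Z)
    (g_ : nat -> Z -> V) (g : Z -> V) :
  (forall m, measurable (A m)) -> (forall z, exists m, A m z) ->
  (forall m z, A m z -> g z = g_ m z) ->
  (forall m, measurable_fun setT (g_ m)) -> measurable_fun setT g.
Proof.
move=> mA cA gA mg _ B mB; rewrite setTI.
rewrite (_ : g @^-1` B = \bigcup_m (A m `&` (g_ m @^-1` B))).
  apply: bigcup_measurable => m _; apply: measurableI => //.
  by rewrite -[X in measurable X]setTI; exact: mg.
apply/seteqP; split => z /=.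
  by have [m Am] := cA z; exists m => //; split => //=; rewrite -gA.
by move=> [m _ [Am /=]]; rewrite -gA.
Qed.

Lemma piecewise_measurable {St : Type} (E : (Z -> St) -> Prop) d'
    (V : measurableType d') (g : St -> V) s :
  (forall s, E s -> measurable_fun setT (g \o s)) -> piecewise E s ->
  measurable_fun setT (g \o s).
Proof.
move=> gE; elim=> [s' Es|A s_ {}s mA cA sA _ IH]; first exact: gE.
by apply: (measurable_glue mA cA (g_ := fun m => g \o s_ m)) => // m z /sA /= ->.
Qed.

(** A case analysis on a piecewise state need only be done on a base piece, which the analysis may
    split again. *)
Lemma piecewise_bind {St St' : Type} (E : (Z -> St) -> Prop)
    (E' : (Z -> St') -> Prop) (F : Z -> St -> St') s :
  (forall s, E s -> piecewise E' (fun z => F z (s z))) -> piecewise E s ->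
  piecewise E' (fun z => F z (s z)).
Proof.
move=> FE; elim=> [s' Es|A s_ {}s mA cA sA _ IH]; first exact: FE.
apply: (piecewise_glue (A := A) (s_ := fun m z => F z (s_ m z))) => //.
by move=> m z /sA ->.
Qed.

Lemma piecewise_if {St : Type} (E : (Z -> St) -> Prop) (b : Z -> bool) s1 s2 :
  measurable [set z | b z] -> piecewise E s1 -> piecewise E s2 ->
  piecewise E (fun z => if b z then s1 z else s2 z).
Proof.
move=> mb p1 p2.
apply: (@piecewise_glue _ _ (fun m => if m == 0%N then [set z | b z] else ~` [set z | b z])
   (fun m => if m == 0%N then s1 else s2)).
- by case=> //= m; exact: measurableC.
- by move=> z; case bz: (b z); [exists 0%N|exists 1%N; apply/negP; rewrite bz].
- by case=> [|m] z /= => [-> |/negP/negbTE ->].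
- by case.
Qed.

Context {R : realType}.

Lemma measurable_ler (f g : Z -> R) : measurable_fun setT f -> measurable_fun setT g ->
  measurable [set z | f z <= g z].
Proof. by move=> mf mg; rewrite -[X in measurable X]setTI; exact: measurable_fun_le. Qed.

Lemma measurable_ltr (f g : Z -> R) : measurable_fun setT f -> measurable_fun setT g ->
  measurable [set z | f z < g z].
Proof.
move=> mf mg; rewrite (_ : [set z | f z < g z] = ~` [set z | g z <= f z]).
  by apply: measurableC; exact: measurable_ler.
by apply/seteqP; split => z /=; rewrite ltNge => /negP.
Qed.

Lemma measurable_bool (b : Z -> bool) :
  measurable_fun setT (fun z => (b z)%:R : R) -> measurable [set z | b z].
Proof.
move=> mb; rewrite (_ : [set z | b z] = (fun z => (b z)%:R : R) @^-1` [set 1]).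
  by rewrite -[X in measurable X]setTI; exact: mb.
apply/seteqP; split => z /=; first by move=> ->.
by case: (b z) => // /eqP; rewrite eq_sym oner_eq0.
Qed.

End Piecewise.

Section QueueMeasurability.
Context d (Z : measurableType d) {R : realType} {n : nat}.
Variables (x sz c dd : Z -> 'I_n -> nat -> R).
Hypothesis mx : forall i m, measurable_fun setT (fun z => x z i m).
Hypothesis msz : forall i m, measurable_fun setT (fun z => sz z i m).
Hypothesis mc : forall i m, measurable_fun setT (fun z => c z i m).
Hypothesis mdd : forall i m, measurable_fun setT (fun z => dd z i m).
Notation mfunR := (fun f : Z -> R => measurable_fun setT f).

Lemma measurable_arrT i m : mfunR (fun z => arrT (x z) i m).
Proof. by apply: measurable_sum => j; exact: mx. Qed.

Inductive option_arrival_class : (Z -> option ('I_n * R)) -> Prop :=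
| class_none : option_arrival_class (fun=> None)
| class_some i t : mfunR t -> option_arrival_class (fun z => Some (i, t z)).

Lemma piecewise_next (na : 'I_n -> nat) (l : seq 'I_n) :
  piecewise option_arrival_class (fun z => foldr (fun i acc =>
    let t := arrT (x z) i (na i) in
    match acc with
    | None => Some (i, t)
    | Some (_, u) => if t <= u then Some (i, t) else acc
    end) None l).
Proof.
elim: l => [|i l IH] /=; first by apply: piecewise_base; exact: class_none.
apply: (piecewise_bind (F := fun z acc => match acc with
    | None => Some (i, arrT (x z) i (na i))
    | Some (_, u) => if arrT (x z) i (na i) <= u then Some (i, arrT (x z) i (na i)) else acc
    end) _ IH) => _ [|j t mt].
  by apply: piecewise_base; apply: class_some; exact: measurable_arrT.
apply: piecewise_if.
- by apply: measurable_ler => //; exact: measurable_arrT.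
- by apply: piecewise_base; apply: class_some; exact: measurable_arrT.
- by apply: piecewise_base; apply: class_some.
Qed.

Inductive activity_class : (Z -> activity R n) -> Prop :=
| class_idle : activity_class (fun=> Idle R n)
| class_serve k : activity_class (fun=> Serve R k)
| class_pause k e : mfunR e -> activity_class (fun z => Pause k (e z))
| class_resume k e b : mfunR e -> activity_class (fun z => Resume k (e z) b).

Definition mseq (q : seq (Z -> R)) := forall j, mfunR (nth (fun=> 0) q j).

Definition eval_seq (q : seq (Z -> R)) (z : Z) := [seq f z | f <- q].

(** On a piece, counters, flags, queue lengths and the kind of activity are constants; only the
    clock, remaining sizes and end times vary, measurably. A queue is thus a list of functions
    rather than a function into lists. *)
Inductive state_class : (Z -> state R n) -> Prop :=
| StateClass nw na qs pz np nr ca : mfunR nw -> (forall k, mseq (qs k)) ->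
    activity_class ca ->
    state_class (fun z => State (nw z) na (fun k => eval_seq (qs k) z) pz np nr (ca z)).

Lemma mseq_rcons q f : mseq q -> mfunR f -> mseq (rcons q f).
Proof.
move=> mq mf j; rewrite nth_rcons; case: ifP => _; first exact: mq.
by case: ifP => _ //; exact: measurable_cst.
Qed.

Lemma mseq_cons q f : mseq q -> mfunR f -> mseq (f :: q).
Proof. by move=> mq mf [|j] //=; exact: mq. Qed.

Lemma mseq_behead q : mseq q -> mseq (behead q).
Proof. by move=> mq j; rewrite nth_behead; exact: mq. Qed.

Lemma eval_head q z : head 0 (eval_seq q z) = head (fun=> 0) q z.
Proof. by case: q. Qed.

Lemma mseq_head q : mseq q -> mfunR (head (fun=> 0) q).
Proof. by move=> mq; rewrite -nth0; exact: mq. Qed.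

Lemma eval_upd (qs : 'I_n -> seq (Z -> R)) k q z :
  upd (fun k => eval_seq (qs k) z) k (eval_seq q z) =
  (fun j => eval_seq (upd qs k q j) z).
Proof. by apply/funext => j; rewrite /upd; case: eqP. Qed.

Lemma mseq_upd (qs : 'I_n -> seq (Z -> R)) k q :
  (forall j, mseq (qs j)) -> mseq q -> forall j, mseq (upd qs k q j).
Proof. by move=> mqs mq j; rewrite /upd; case: eqP. Qed.

Lemma state_class_advance s t : state_class s -> mfunR t ->
  state_class (fun z => advance (t z) (s z)).
Proof.
case=> nw na qs pz np nr ca mnw mqs mca mt; rewrite /advance /=.
case: mca => [|k|k e me|k e b me].
- by apply: (@StateClass t) => //; exact: class_idle.
- pose q z := head (fun=> 0) (qs k) z - (t z - nw z).
  rewrite (_ : (fun z => _) = fun z => State (t z) na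
    (fun j => eval_seq (upd qs k (q :: behead (qs k)) j) z) pz np nr (Serve R k)).
    apply: StateClass => //; last exact: class_serve.
    apply: mseq_upd => //; apply: mseq_cons; first exact: mseq_behead.
    apply: measurable_funB; first exact: mseq_head.
    exact: measurable_funB.
  apply/funext => z; rewrite -eval_upd /=; congr (State _ _ (upd _ _ _) _ _ _ _).
  by rewrite /q eval_head /eval_seq behead_map.
- by apply: (@StateClass t) => //; exact: class_pause.
- by apply: (@StateClass t) => //; exact: class_resume.
Qed.

Lemma state_class_start_pause s k : state_class s ->
  state_class (fun z => start_pause (c z) k (s z)).
Proof.
case=> nw na qs pz np nr ca mnw mqs mca; rewrite /start_pause /=.
apply: StateClass => //; apply: class_pause.
by apply: measurable_funD.
Qed.

Lemma state_class_dispatch s : state_class s ->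
  state_class (fun z => dispatch (dd z) (s z)).
Proof.
case=> nw na qs pz np nr ca mnw mqs mca.
(* The class to dispatch depends only on which queues are empty, so it is constant on the piece. *)
pose b := [pick j : 'I_n | (qs j != [::]) &&
            [forall i : 'I_n, (i < j)%N ==> (qs i == [::])]].
have evalE k z : (eval_seq (qs k) z == [::]) = (qs k == [::]) by case: (qs k).
have bE z ca' : best (State (nw z) na (fun k => eval_seq (qs k) z) pz np nr ca') = b.
  apply: eq_pick => j /=; rewrite evalE; congr (_ && _).
  by apply: eq_forallb => i; rewrite evalE.
rewrite (_ : (fun z => _) = fun z => match b with
  | None => State (nw z) na (fun k => eval_seq (qs k) z) pz np nr (Idle R n)
  | Some j => if pz j then State (nw z) na (fun k => eval_seq (qs k) z) pz np
       (upd nr j (nr j).+1) (Resume j (nw z + dd z j (nr j)) false) else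
     State (nw z) na (fun k => eval_seq (qs k) z) pz np nr (Serve R j) end).
  case: b {bE} => [j|]; last by apply: StateClass => //; exact: class_idle.
  case: (pz j); last by apply: StateClass => //; exact: class_serve.
  by apply: StateClass => //; apply: class_resume; apply: measurable_funD.
by apply/funext => z; rewrite /dispatch bE; case: b {bE}.
Qed.

Lemma state_class_set_cur s a : state_class s -> activity_class a ->
  state_class (fun z => set_cur (s z) (a z)).
Proof. by case=> nw na qs pz np nr ca mnw mqs mca ma; apply: StateClass. Qed.

Lemma state_class_arrive s i : state_class s ->
  state_class (fun z => arrive (sz z) (c z) (dd z) i (s z)).
Proof.
case=> nw na qs pz np nr ca mnw mqs mca; rewrite /arrive /=.
pose q := rcons (qs i) (fun z => sz z i (na i)).
pose s1 ca' z := State (nw z) (upd na i (na i).+1)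
  (fun j => eval_seq (upd qs i q j) z) pz np nr (ca' z).
have s1E ca' z : State (nw z) (upd na i (na i).+1)
    (upd (fun k => eval_seq (qs k) z) i (rcons (eval_seq (qs i) z) (sz z i (na i))))
    pz np nr (ca' z) = s1 ca' z.
  by rewrite /s1 -eval_upd /q /eval_seq map_rcons.
have cs1 ca' : activity_class ca' -> state_class (s1 ca').
  by move=> h; apply: StateClass => //; apply: mseq_upd => //; exact: mseq_rcons.
case: mca => [|k|k e me|k e b me].
- rewrite (_ : (fun z => _) = fun z => dispatch (dd z) (s1 (fun=> Idle R n) z)).
    by apply: state_class_dispatch; apply: cs1; exact: class_idle.
  by apply/funext => z; rewrite -s1E.
- have h : state_class (s1 (fun=> Serve R k)) by apply: cs1; exact: class_serve.
  case: (i < k)%N.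
    rewrite (_ : (fun z => _) = fun z => start_pause (c z) k (s1 (fun=> Serve R k) z)).
      exact: state_class_start_pause.
    by apply/funext => z; rewrite -s1E.
  rewrite (_ : (fun z => _) = s1 (fun=> Serve R k)) //.
  by apply/funext => z; rewrite -s1E.
- rewrite (_ : (fun z => _) = s1 (fun z => Pause k (e z))).
    by apply: cs1; exact: class_pause.
  by apply/funext => z; rewrite -s1E.
- have h : state_class (s1 (fun z => Resume k (e z) b)).
    by apply: cs1; exact: class_resume.
  case: (i < k)%N; last first.
    rewrite (_ : (fun z => _) = s1 (fun z => Resume k (e z) b)) //.
    by apply/funext => z; rewrite -s1E.
  rewrite (_ : (fun z => _) = fun z => set_cur (s1 (fun z => Resume k (e z) b) z)
      (Resume k (e z) true)).
    by apply: state_class_set_cur => //; exact: class_resume.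
  by apply/funext => z; rewrite -s1E.
Qed.

Lemma state_class_complete s : state_class s ->
  state_class (fun z => complete (c z) (dd z) (s z)).
Proof.
case=> nw na qs pz np nr ca mnw mqs mca; rewrite /complete /=.
case: mca => [|k|k e me|k e b me].
- by apply: StateClass => //; exact: class_idle.
- pose s1 z := State (nw z) na
    (fun j => eval_seq (upd qs k (behead (qs k)) j) z) pz np nr (Serve R k).
  rewrite (_ : (fun z => _) = fun z => dispatch (dd z) (s1 z)).
    apply: state_class_dispatch; apply: StateClass => //; last exact: class_serve.
    by apply: mseq_upd => //; exact: mseq_behead.
  by apply/funext => z; rewrite /s1 -eval_upd /eval_seq behead_map.
- by apply: state_class_dispatch; apply: StateClass => //; exact: class_pause.
- case: b.
    by apply: state_class_start_pause; apply: StateClass => //; exact: class_resume.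
  by apply: StateClass => //; exact: class_serve.
Qed.

(** Only two decisions depend on the inputs: which class arrives first, and whether the current
    activity ends before that. Both compare measurable times. *)
Lemma piecewise_step s : state_class s ->
  piecewise state_class (fun z => step (x z) (sz z) (c z) (dd z) (s z)).
Proof.
move=> cs; case: (cs) => nw na qs pz np nr ca mnw mqs mca.
pose s' z := State (nw z) na (fun k => eval_seq (qs k) z) pz np nr (ca z).
rewrite -/s' in cs *.
have next := piecewise_next na (enum 'I_n).
have [[e [me eE]]|eE] : (exists e, mfunR e /\ forall z, act_end (s' z) = Some (e z)) \/
    (forall z, act_end (s' z) = None).
  rewrite /s' /act_end /=; case: mca {cs s'} => [|k|k e me|k e b me]; first by right.
  - left; exists (fun z => nw z + head (fun=> 0) (qs k) z); split.
      by apply: measurable_funD => //; exact: mseq_head.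
    by move=> z; rewrite eval_head.
  - by left; exists e.
  - by left; exists e.
- apply: (piecewise_bind (F := fun z o => match o, act_end (s' z) with
    | None, None => s' z
    | Some (i, t), None => arrive (sz z) (c z) (dd z) i (advance t (s' z))
    | None, Some e => complete (c z) (dd z) (advance e (s' z))
    | Some (i, t), Some e =>
      if e <= t then complete (c z) (dd z) (advance e (s' z))
      else arrive (sz z) (c z) (dd z) i (advance t (s' z))
    end) _ next) => _ [|i t mt].
    under eq_fun do rewrite eE.
    by apply: piecewise_base; apply: state_class_complete; exact: state_class_advance.
  under eq_fun do rewrite eE.
  apply: piecewise_if; first exact: measurable_ler.
    by apply: piecewise_base; apply: state_class_complete; exact: state_class_advance.
  by apply: piecewise_base; apply: state_class_arrive; exact: state_class_advance.
- apply: (piecewise_bind (F := fun z o => match o, act_end (s' z) with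
    | None, None => s' z
    | Some (i, t), None => arrive (sz z) (c z) (dd z) i (advance t (s' z))
    | None, Some e => complete (c z) (dd z) (advance e (s' z))
    | Some (i, t), Some e =>
      if e <= t then complete (c z) (dd z) (advance e (s' z))
      else arrive (sz z) (c z) (dd z) i (advance t (s' z))
    end) _ next) => _ [|i t mt].
    under eq_fun do rewrite eE.
    exact: piecewise_base.
  under eq_fun do rewrite eE.
  by apply: piecewise_base; apply: state_class_arrive; exact: state_class_advance.
Qed.

End QueueMeasurability.

(** * Dynamics of the queue *)

Section NextArrival.
Context {R : realType} {n : nat}.
Implicit Types (tau : 'I_n -> R) (l : seq 'I_n).

(** Common form of the folds in [next_arr] and [jnext], depending on the due times alone; ties go to
    the class listed first. *)
Definition earliest tau l : option ('I_n * R) :=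
  foldr (fun i acc => let t := tau i in
    match acc with
    | None => Some (i, t)
    | Some (_, u) => if t <= u then Some (i, t) else acc
    end) None l.

Lemma earliest_none tau l : earliest tau l = None -> l = [::].
Proof. by case: l => [|i l] //=; case: earliest => // -[j u]; case: ifP. Qed.

Lemma earliest_some tau l j t : earliest tau l = Some (j, t) ->
  [/\ j \in l, t = tau j & forall i, i \in l -> t <= tau i].
Proof.
elim: l j t => [|h l IH] j t //=.
case e: earliest => [[j' u]|].
  have [jl uE umin] := IH _ _ e; case: leP => hu [<- <-].
    split; rewrite ?inE ?eqxx//= => i; rewrite inE => /orP[/eqP ->//|/umin].
    exact: le_trans.
  split; rewrite ?inE ?jl ?orbT// => i; rewrite inE => /orP[/eqP ->|/umin//].
  exact: ltW.
have -> := earliest_none e.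
by case=> <- <-; split; rewrite ?inE// => i; rewrite inE => /eqP ->.
Qed.

(** A losing candidate may be moved to any time after the winner. The inequality is strict because a
    tie goes to the candidate listed first, possibly the moved one. *)
Lemma earliest_delay tau tau' l i j t :
  (forall k, k != i -> tau' k = tau k) -> t < tau' i -> j != i ->
  earliest tau l = Some (j, t) -> earliest tau' l = Some (j, t).
Proof.
move=> agree ti ji; elim: l j ji => [|h l IH] j ji //=.
case e: (earliest tau l) => [[j' u]|]; last first.
  have -> := earliest_none e.
  by case=> hj ht; rewrite /= -ht agree ?hj.
have [jl uE umin] := earliest_some e.
case: leP => hu [hj ht].
  have hi : h != i by rewrite hj.
  case e' : (earliest tau' l) => [[j2 u2]|]; last by move: e; rewrite (earliest_none e').
  have [j2l u2E _] := earliest_some e'.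
  have h2 : tau h <= u2.
    rewrite u2E; have [->|j2i] := eqVneq j2 i; first by rewrite ht ltW.
    by rewrite agree//; apply: le_trans hu (umin _ j2l).
  by rewrite agree// h2 -ht hj.
rewrite hj ht in e; rewrite (IH _ ji e).
have [->|hi] := eqVneq h i; first by rewrite leNgt ti.
by rewrite agree// leNgt -ht hu.
Qed.

End NextArrival.

Section QueueDynamics.
Context {R : realType} {n : nat}.
Variables (x sz c dd : 'I_n -> nat -> R).
Notation st := (state R n).
Notation stp := (step x sz c dd).
Implicit Types (s : st) (i j k : 'I_n).

Definition due s i : R := arrT x i (narr s i).

Lemma next_arrE s : next_arr x s = earliest (due s) (enum 'I_n).
Proof. by []. Qed.

Variant step_spec s : st -> Type :=
| StepArrival i t of t = due s i & (forall j, t <= due s j) &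
    (forall e, act_end s = Some e -> t < e) &
    next_arr x s = Some (i, t) :
    step_spec s (arrive sz c dd i (advance t s))
| StepCompletion e of act_end s = Some e & (forall j, e <= due s j) :
    step_spec s (complete c dd (advance e s)).

(** The class [i0] guarantees a pending arrival, so a step is an arrival or a completion; a tie
    between them is resolved as the completion. *)
Lemma stepP (i0 : 'I_n) s : step_spec s (stp s).
Proof.
rewrite /step; case e: (next_arr x s) => [[i t]|]; last first.
  by have := mem_enum 'I_n i0; rewrite (earliest_none e).
have [_ tE tmin] := earliest_some e.
have tmin' j : t <= due s j by apply: tmin; rewrite mem_enum.
case ea: (act_end s) => [u|]; last by constructor => //; rewrite ea.
case: leP => ut; first by constructor => // j; exact: le_trans ut _.
by constructor => // u'; rewrite ea => -[<-].
Qed.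

Lemma now_dispatch s : now (dispatch dd s) = now s.
Proof. by rewrite /dispatch; case: best => // j; case: ifP. Qed.

Lemma now_arrive i s : now (arrive sz c dd i s) = now s.
Proof.
rewrite /arrive; case: (cur s) => [|k|k e|k e b].
- by rewrite now_dispatch.
- by case: ifP.
- by [].
- by case: ifP.
Qed.

Lemma now_complete s : now (complete c dd s) = now s.
Proof.
rewrite /complete; case: (cur s) => [|k|k e|k e b] //.
- by rewrite now_dispatch.
- by rewrite now_dispatch.
- by case: b.
Qed.

Lemma narr_dispatch s : narr (dispatch dd s) = narr s.
Proof. by rewrite /dispatch; case: best => // j; case: ifP. Qed.

Lemma narr_arrive i s : narr (arrive sz c dd i s) = upd (narr s) i (narr s i).+1.
Proof.
rewrite /arrive; case: (cur s) => [|k|k e|k e b].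
- by rewrite narr_dispatch.
- by case: ifP.
- by [].
- by case: ifP.
Qed.

Lemma narr_complete s : narr (complete c dd s) = narr s.
Proof.
rewrite /complete; case: (cur s) => [|k|k e|k e b] //.
- by rewrite narr_dispatch.
- by rewrite narr_dispatch.
- by case: b.
Qed.

Lemma queue_dispatch s : queue (dispatch dd s) = queue s.
Proof. by rewrite /dispatch; case: best => // j; case: ifP. Qed.

Lemma queue_arrive i s : queue (arrive sz c dd i s) =
  upd (queue s) i (rcons (queue s i) (sz i (narr s i))).
Proof.
rewrite /arrive; case: (cur s) => [|k|k e|k e b].
- by rewrite queue_dispatch.
- by case: ifP.
- by [].
- by case: ifP.
Qed.

Lemma upd_eq {T : Type} (f : 'I_n -> T) k v : upd f k v k = v.
Proof. by rewrite /upd eqxx. Qed.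

Lemma upd_neq {T : Type} (f : 'I_n -> T) k v j : j != k -> upd f k v j = f j.
Proof. by rewrite /upd => /negbTE ->. Qed.

Lemma narr_step (i0 : 'I_n) s i :
  narr (stp s) i = narr s i \/ narr (stp s) i = (narr s i).+1.
Proof.
case: (stepP i0) => [j t _ _ _ _|e _ _].
  rewrite narr_arrive /= /upd; case: eqP => [->|_]; [by right|by left].
by left; rewrite narr_complete.
Qed.

Lemma npause_dispatch s : npause (dispatch dd s) = npause s.
Proof. by rewrite /dispatch; case: best => // j; case: ifP. Qed.

Lemma npause_step (i0 : 'I_n) s k :
  npause (stp s) k = npause s k \/ npause (stp s) k = (npause s k).+1.
Proof.
case: (stepP i0) => [j t _ _ _ _|e _ _].
  rewrite /arrive /=; case: (cur s) => [|k'|k' e|k' e b] /=.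
  - by rewrite npause_dispatch; left.
  - case: ifP => _ /=; last by left.
    by rewrite /upd; case: eqP => [->|_]; [right|left].
  - by left.
  - by case: ifP; left.
rewrite /complete /=; case: (cur s) => [|k'|k' e'|k' e' b] /=.
- by left.
- by rewrite npause_dispatch; left.
- by rewrite npause_dispatch; left.
- case: b => /=; last by left.
  by rewrite /upd; case: eqP => [->|_]; [right|left].
Qed.

Lemma nresume_dispatch s k : nresume (dispatch dd s) k = nresume s k \/
  nresume (dispatch dd s) k = (nresume s k).+1.
Proof.
rewrite /dispatch; case: best => [j|]; last by left.
case: ifP => _; last by left.
by rewrite /= /upd; case: eqP => [->|_]; [right|left].
Qed.

Lemma nresume_step (i0 : 'I_n) s k :
  nresume (stp s) k = nresume s k \/ nresume (stp s) k = (nresume s k).+1.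
Proof.
case: (stepP i0) => [j t _ _ _ _|e _ _].
  rewrite /arrive /=; case: (cur s) => [|k'|k' e|k' e b] /=.
  - exact: nresume_dispatch.
  - by case: ifP => _ /=; left.
  - by left.
  - by case: ifP; left.
rewrite /complete /=; case: (cur s) => [|k'|k' e'|k' e' b] /=.
- by left.
- exact: nresume_dispatch.
- exact: nresume_dispatch.
- by case: b => /=; left.
Qed.

Definition resuming k (a : activity R n) : bool :=
  if a is Resume j _ _ then j == k else false.

Definition residual s : R :=
  match cur s with
  | Pause _ e => e - now s
  | Resume _ e _ => e - now s
  | _ => 0
  end.

(** [con_time] places the clock between the last and the next arrival of each class, which the
    compensator needs as [clock_ge] and [clock_le]. [con_low] says that the top class is never
    paused, so no overhead mean of that class has to be finite. *)
Record consistent s : Prop := Consistent {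
  con_time : forall i, \sum_(l < narr s i) x i l <= now s <= due s i;
  con_queue : forall k, all (fun r => 0 <= r) (queue s k);
  con_size : forall k, (size (queue s k) <= narr s k)%N;
  con_paused : forall k, paused s k -> queue s k != [::] /\ (0 < k)%N;
  con_low : forall k, (npause s k == 0)%N || (0 < k)%N }.

Definition activity_ok s : Prop :=
  match cur s with
  | Idle => forall k, queue s k = [::]
  | Serve k => queue s k != [::] /\ ~~ paused s k
  | Pause k e => paused s k /\ now s <= e
  | Resume k e b => paused s k /\ now s <= e
  end.

(** Pauses and resumes of a class alternate, starting with a pause; the excess is 1 exactly while a
    paused job has no resume under way. *)
Definition balanced s : Prop := forall k,
  npause s k = (nresume s k + (paused s k && ~~ resuming k (cur s)))%N.

Definition sound s : Prop := [/\ consistent s, activity_ok s & balanced s].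

Hypothesis x_gt0 : forall i m, 0 < x i m.
Hypothesis sz_gt0 : forall i m, 0 < sz i m.
Hypothesis c_ge0 : forall i m, 0 <= c i m.
Hypothesis dd_ge0 : forall i m, 0 <= dd i m.

Lemma arrTS i m : arrT x i m = \sum_(l < m.+1) x i l. Proof. by []. Qed.

Lemma sound_init : sound (init R n).
Proof.
split.
- split => //=.
  by move=> i; rewrite big_ord0 lexx /due /arrT /= big_ord1 ltW.
- by [].
- by [].
Qed.

Lemma act_end_ge s e : sound s -> act_end s = Some e -> now s <= e.
Proof.
move=> [hc ho _]; rewrite /act_end; move: ho; rewrite /activity_ok.
case: (cur s) => [|k|k u|k u b] // => [_|[_ h]|[_ h]] [<-] //.
have := con_queue hc k; case: (queue s k) => [|r q] /=; first by rewrite addr0.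
by move=> /andP[r0 _]; rewrite lerDl.
Qed.

Lemma due_ge s i : sound s -> now s <= due s i.
Proof. by move=> [hc _ _]; have /andP[] := con_time hc i. Qed.

Lemma sound_advance s t : sound s -> now s <= t -> (forall j, t <= due s j) ->
  (forall e, act_end s = Some e -> t <= e) -> sound (advance t s).
Proof.
move=> [hc ho hb] st td te.
have hq k : cur s = Serve R k ->
    (exists r q, queue s k = r :: q /\ 0 <= r - (t - now s)).
  move=> ck; move: ho te; rewrite /activity_ok /act_end ck => -[].
  case: (queue s k) => [|r q] //= _ _ /(_ _ erefl) h.
  by exists r, q; split => //; lra.
have ht i : \sum_(l < narr s i) x i l <= t <= due s i.
  have /andP[h1 _] := con_time hc i.
  by rewrite td andbT (le_trans h1).
split.
- split => //=.
  + move=> k; case ck: (cur s) => [|k'|k' e|k' e b]; try exact: con_queue.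
    rewrite /upd; case: eqP => [_|_]; last exact: con_queue.
    have [r [q [qE r0]]] := hq _ ck.
    by have := con_queue hc k'; rewrite qE /= r0 => /andP[].
  + move=> k; case ck: (cur s) => [|k'|k' e|k' e b]; try exact: con_size.
    rewrite /upd; case: eqP => [->|_]; last exact: con_size.
    have [r [q [qE r0]]] := hq _ ck.
    by have := con_size hc k'; rewrite qE.
  + move=> k pk; have [q0 k0] := con_paused hc pk; split => //.
    case ck: (cur s) => [|k'|k' e|k' e b] //.
    by rewrite /upd; case: ifP.
  + exact: con_low.
- move: ho te; rewrite /activity_ok /act_end /=.
  case: (cur s) => [|k|k e|k e b] //=.
  + by rewrite upd_eq => -[].
  + by move=> [? _] /(_ _ erefl).
  + by move=> [? _] /(_ _ erefl).
- exact: hb.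
Qed.

Lemma consistent_cur s a : consistent s -> consistent (set_cur s a).
Proof. by case=> *; split. Qed.

Lemma bestP s : match best s return Prop with
  | Some j => queue s j != [::]
  | None => forall k, queue s k = [::]
  end.
Proof.
rewrite /best; case: pickP => [j /andP[]//|none k].
apply/eqP; apply/negPn/negP => qk.
have [j0 qj0 jmin] := arg_minnP (fun j : 'I_n => j : nat) (qk : (fun j => queue s j != [::]) k).
have := none j0; rewrite qj0 /= => /negP; apply; apply/forallP => i; apply/implyP => ij.
by apply/negPn/negP => /jmin; rewrite leqNgt ij.
Qed.

Lemma sound_dispatch s : consistent s ->
  (forall k, npause s k = nresume s k + paused s k)%N -> sound (dispatch dd s).
Proof.
move=> hc hb; have := bestP s; rewrite /dispatch; case: best => [j|].
  case: ifPn => pj qj; split.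
  - by case: hc => *; split.
  - by split => //=; rewrite lerDl.
  - move=> k; rewrite /= hb /upd (eq_sym j).
    by have [->|_] := eqVneq k j; rewrite ?pj /= ?addn0 ?addn1 ?andbT.
  - exact: consistent_cur.
  - by split.
  - by move=> k; rewrite /= hb andbT.
move=> q0; split => //; first exact: consistent_cur.
by move=> k; rewrite /= hb andbT.
Qed.

Lemma sound_start_pause k s : consistent s -> queue s k != [::] -> (0 < k)%N ->
  (forall j, npause s j = nresume s j + (paused s j && (j != k)))%N ->
  sound (start_pause c k s).
Proof.
move=> hc qk k0 hb; split.
- case: hc => h1 h2 h3 h4 h5; split => //=.
    by move=> j; rewrite /upd; case: eqP => [->//|_]; exact: h4.
  by move=> j; rewrite /upd; have [->|_] := eqVneq j k; rewrite ?k0 ?orbT.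
- by split; rewrite /= ?upd_eq// lerDl.
- move=> j; rewrite /= /upd andbT; have [->|jk] := eqVneq j k.
    by rewrite hb eqxx andbF addn0 addn1.
  by rewrite hb jk andbT.
Qed.

Lemma consistent_enqueue s i : sound s -> now s = due s i ->
  consistent (State (now s) (upd (narr s) i (narr s i).+1)
    (upd (queue s) i (rcons (queue s i) (sz i (narr s i))))
    (paused s) (npause s) (nresume s) (cur s)).
Proof.
move=> [hc ho hb] si; split => //=.
- move=> j; rewrite /due /= /upd; case: eqP => [->|_]; last exact: con_time.
  rewrite -arrTS -/(due s i) -si lexx /= arrTS big_ord_recr /= -arrTS.
  by rewrite -/(due s i) -si lerDl ltW.
- move=> k; rewrite /upd; case: eqP => [_|_]; last exact: con_queue.
  by rewrite all_rcons (con_queue hc) ltW.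
- move=> k; rewrite /upd; have [_|_] := eqVneq k i; last exact: con_size.
  by rewrite size_rcons ltnS (con_size hc).
- move=> k pk; have [q0 k0] := con_paused hc pk; split => //.
  by rewrite /upd; case: ifP => // _; case: (queue s i).
- exact: con_low.
Qed.

Lemma sound_arrive s i : sound s -> now s = due s i -> sound (arrive sz c dd i s).
Proof.
move=> ss si; have := consistent_enqueue ss si; case: ss => hc ho hb.
rewrite /arrive; move: ho hb; rewrite /activity_ok /balanced.
set s1 := State _ _ _ _ _ _ _.
have qn k : queue s k != [::] -> queue s1 k != [::].
  by rewrite /s1 /= /upd; case: ifP => // _ _; case: (queue s i).
case ck: (cur s) => [|k|k e|k e b].
- move=> q0 hb hc1; apply: sound_dispatch => // k.
  by rewrite /= hb ?ck andbT.
- move=> [qk pk] hb hc1.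
  have hb1 j : npause s j = (nresume s j + paused s j)%N by rewrite hb ?ck andbT.
  case: ifPn => ik.
    apply: sound_start_pause => //; [exact: qn|exact: leq_ltn_trans ik|].
    move=> j /=; rewrite hb1; case: eqP => [->|_]; last by rewrite andbT.
    by rewrite (negbTE pk).
  split => //; first by rewrite /activity_ok /= ck; split => //; exact: qn.
  by move=> j /=; rewrite ck /= andbT.
- move=> [pk se] hb hc1; split => //; first by rewrite /activity_ok /= ck.
  by move=> j /=; rewrite ck hb ?ck.
- move=> [pk se] hb hc1; case: ifPn => ik.
    split => //; first exact: consistent_cur.
  split => //; first by rewrite /activity_ok /= ck.
  by move=> j /=; rewrite ck hb ?ck.
Qed.

Lemma sound_complete s : sound s -> act_end s = Some (now s) ->
  sound (complete c dd s).
Proof.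
move=> [hc ho hb]; rewrite /complete /act_end; move: ho hb; rewrite /activity_ok /balanced.
case ck: (cur s) => [|k|k e|k e b] //.
- move=> [qk pk] hb _; apply: sound_dispatch => [|j]; last by rewrite /= hb ?ck andbT.
  case: hc => h1 h2 h3 h4 h5; split => //=.
  + move=> j; rewrite /upd; case: eqP => [_|_]; last exact: h2.
    by have := h2 k; case: (queue s k) => //= r q /andP[].
  + move=> j; rewrite /upd; have [->|_] := eqVneq j k; last exact: h3.
    by rewrite size_behead (leq_trans (leq_pred _)).
  + move=> j pj; have [qj j0] := h4 _ pj; split => //.
    by rewrite /upd; case: ifP => // /eqP jk; move: pj; rewrite jk (negbTE pk).
- move=> [pk se] hb _; apply: sound_dispatch => // j.
  by rewrite hb ?ck andbT.
- move=> [pk se] hb _; have [qk k0] := con_paused hc pk.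
  case: b ck hb => ck hb.
    apply: sound_start_pause => // j.
    by rewrite hb ?ck /= eq_sym.
  split.
  + case: hc => h1 h2 h3 h4 h5; split => //=.
    by move=> j; rewrite /upd; case: eqP => // _; exact: h4.
  + by rewrite /activity_ok /= upd_eq.
  + move=> j; rewrite /= andbT hb ?ck /= /upd (eq_sym k).
    by have [->|_] := eqVneq j k; rewrite ?andbF ?andbT.
Qed.

Lemma sound_step (i0 : 'I_n) s : sound s -> sound (stp s) /\ now s <= now (stp s).
Proof.
move=> ss; case: (stepP i0) => [i t tE td te _|e ee ed].
  have st : now s <= t by rewrite tE due_ge.
  split; last by rewrite now_arrive.
  apply: sound_arrive; last by rewrite /= tE.
  by apply: sound_advance => // e /te/ltW.
have se : now s <= e by exact: act_end_ge ee.
split; last by rewrite now_complete.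
apply: sound_complete.
  by apply: sound_advance => // e'; rewrite ee => -[->].
move: ee; rewrite /act_end /=; case ck : (cur s) => [|k|k u|k u b] //=.
by rewrite upd_eq /= => -[<-]; congr Some; ring.
Qed.

End QueueDynamics.

(** * Exact balances over one step *)

Section StepIdentities.
Context {R : realType} {n : nat}.
Variables (x sz c dd : 'I_n -> nat -> R).
Notation st := (state R n).
Notation stp := (step x sz c dd).
Implicit Types (s : st) (i j k : 'I_n).

Definition serving k s : bool := if cur s is Serve j then j == k else false.

Definition blocked s : bool :=
  match cur s with Pause _ _ => true | Resume _ _ _ => true | _ => false end.

Definition backlog s k : R := \sum_(r <- queue s k) r.
Definition admitted s k : R := \sum_(m < narr s k) sz k m.
Definition overhead s : R :=
  \sum_k (\sum_(m < npause s k) c k m + \sum_(m < nresume s k) dd k m).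

(* [exp (- L * remaining length)] of an unfailed class-k resume: the probability
   that it still succeeds when higher-priority arrivals have rate L. *)
Definition survival (L : R) k s : R :=
  if cur s is Resume j e false then
    if j == k then expR (- L * (e - now s)) else 0
  else 0.

(** Sum of the initial survivals of all resumes started so far; by Wald its mean is [q_k] times the
    mean number of resumes when [L] is the higher-priority rate. *)
Definition resume_discount (L : R) s k : R := \sum_(m < nresume s k) expR (- L * dd k m).

Definition hits s s' k : R :=
  \sum_(i < n | (i < k)%N) ((narr s' i)%:R - (narr s i)%:R).

(** After subtracting [blocked], this is the number of events so far: [narr] arrivals, [narr - size]
    service completions and all started overheads except the one in progress. *)
Definition stage_count s : R :=
  \sum_k ((2 * narr s k + npause s k + nresume s k)%:R - (size (queue s k))%:R).

Lemma sum_upd (V : zmodType) (T : Type) (F : 'I_n -> T -> V) (f : 'I_n -> T) k v :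
  \sum_j F j (upd f k v j) = \sum_j F j (f j) + (F k v - F k (f k)).
Proof.
rewrite (bigD1 k)//= [in RHS](bigD1 k)//= upd_eq.
under eq_bigr => j jk do rewrite upd_neq//.
by rewrite [RHS]addrC subrKA; congr (_ + _).
Qed.

Lemma hits_eq s s' k : narr s' = narr s -> hits s s' k = 0.
Proof. by move=> e; rewrite /hits e big1 // => i _; rewrite subrr. Qed.

Lemma hits_arrival s s' k i : narr s' = upd (narr s) i (narr s i).+1 ->
  hits s s' k = (i < k)%N%:R.
Proof.
move=> e; rewrite /hits e big_mkcond (bigD1 i)//= upd_eq big1 ?addr0.
  by case: ifP => // _; rewrite mulrSr addrAC subrr add0r.
by move=> j ji; rewrite upd_neq// subrr if_same.
Qed.

Lemma overhead_start_pause k s :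
  overhead (start_pause c k s) = overhead s + c k (npause s k).
Proof.
rewrite /overhead /= (sum_upd (fun j m => \sum_(l < m) c j l +
  \sum_(m0 < nresume s j) dd j m0)); congr (_ + _).
by rewrite big_ord_recr /=; ring.
Qed.

Lemma overhead_dispatch s :
  residual (dispatch dd s) - overhead (dispatch dd s) = - overhead s.
Proof.
rewrite /dispatch; case: best => [j|]; last by rewrite /residual /= add0r.
case: ifP => _; last by rewrite /residual /= add0r.
rewrite /residual /overhead /= (sum_upd (fun k m => \sum_(l < npause s k) c k l +
  \sum_(m0 < m) dd k m0)).
by rewrite big_ord_recr /=; ring.
Qed.

(** A started pause or resume adds its length to [overhead] and to [residual] alike, so their
    difference changes only by elapsed blocked time. *)
Lemma overhead_step (i0 : 'I_n) s : 
  residual (stp s) - overhead (stp s) =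
  residual s - overhead s - (blocked s)%:R * (now (stp s) - now s).
Proof.
case: (stepP x sz c dd i0) => [i t _ _ _ _|e ee _].
  rewrite now_arrive /= /arrive /residual /blocked /=.
  case ck: (cur s) => [|k|k u|k u b] /=; rewrite ?mul0r ?mul1r ?subr0.
  - by rewrite -/(residual _) overhead_dispatch add0r.
  - case: ifP => _ /=; last by rewrite /overhead /=; ring.
    by rewrite -/(overhead (start_pause c k _)) overhead_start_pause /=; ring.
  - by rewrite /overhead /=; ring.
  - by case: ifP => _ /=; rewrite /overhead /=; ring.
move: ee; rewrite now_complete /= /act_end /complete /residual /blocked /=.
case ck: (cur s) => [|k|k u|k u b] //= -[eE]; rewrite ?mul0r ?mul1r ?subr0.
- by rewrite -/(residual _) overhead_dispatch add0r.
- by rewrite -/(residual _) overhead_dispatch /overhead /= -eE; ring.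
- case: b ck => ck /=; last by rewrite /overhead /= -eE; ring.
  by rewrite -/(overhead (start_pause c k _)) overhead_start_pause /overhead /= -eE; ring.
Qed.

Lemma backlog_arrive i s k :
  backlog (arrive sz c dd i s) k - admitted (arrive sz c dd i s) k =
  backlog s k - admitted s k.
Proof.
rewrite /backlog /admitted queue_arrive narr_arrive /upd.
have [->|_] := eqVneq k i => //.
by rewrite -cats1 big_cat /= big_seq1 big_ord_recr /=; ring.
Qed.

Lemma backlog_dispatch s k :
  backlog (dispatch dd s) k - admitted (dispatch dd s) k =
  backlog s k - admitted s k.
Proof. by rewrite /backlog /admitted queue_dispatch narr_dispatch. Qed.

Lemma backlog_advance s t k : sound x s ->
  backlog (advance t s) k = backlog s k - (serving k s)%:R * (t - now s).
Proof.
move=> [_ ho _]; move: ho; rewrite /backlog /serving /advance /activity_ok /=.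
case: (cur s) => [|j|j u|j u b] /=; rewrite ?mul0r ?subr0 // => -[qj _].
rewrite /upd (eq_sym j); have [kj|_] := eqVneq k j; last by rewrite mul0r subr0.
rewrite kj; case: (queue s j) qj => // r q _.
by rewrite !big_cons /=; ring.
Qed.

Lemma backlog_step (i0 : 'I_n) s k : sound x s ->
  backlog (stp s) k - admitted (stp s) k =
  backlog s k - admitted s k - (serving k s)%:R * (now (stp s) - now s).
Proof.
move=> ss; case: (stepP x sz c dd i0) => [i t _ _ _ _|e ee _].
  by rewrite backlog_arrive backlog_advance// now_arrive /admitted /=; ring.
rewrite now_complete /=; have := backlog_advance e k ss.
rewrite /complete /=; move: ee; rewrite /act_end.
case ck: (cur s) => [|j|j u|j u b] //= -[eE] adv.
- rewrite backlog_dispatch [RHS]addrAC -adv.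
  rewrite /backlog /admitted /advance /= ck /upd eqxx /=; congr (_ - _).
  by case: (k == j) => //; rewrite big_cons -eE; ring.
- by rewrite backlog_dispatch adv /admitted /=; ring.
- by case: b ck adv => ck adv; rewrite [RHS]addrAC -adv /backlog /admitted /advance /= ck.
Qed.

Lemma stage_dispatch s :
  stage_count (dispatch dd s) - (blocked (dispatch dd s))%:R = stage_count s.
Proof.
rewrite /dispatch; case: best => [j|]; last by rewrite /blocked /= subr0.
case: ifP => _; last by rewrite /blocked /= subr0.
rewrite /blocked /stage_count /= (sum_upd (fun k m =>
  (2 * narr s k + npause s k + m)%:R - (size (queue s k))%:R)).
by rewrite -(addn1 (nresume s j)) !natrD /=; ring.
Qed.

Lemma stage_start_pause k s :
  stage_count (start_pause c k s) = stage_count s + 1.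
Proof.
rewrite /stage_count /= (sum_upd (fun j m =>
  (2 * narr s j + m + nresume s j)%:R - (size (queue s j))%:R)).
by rewrite -(addn1 (npause s k)) !natrD /=; ring.
Qed.

Lemma stage_advance t s : sound x s -> stage_count (advance t s) = stage_count s.
Proof.
move=> [_ ho _]; apply: eq_bigr => k _; congr (_ - _%:R).
move: ho; rewrite /activity_ok /=.
case: (cur s) => [|j|j u|j u b] // -[qj _].
by rewrite /upd; have [->|_] := eqVneq k j => //=; case: (queue s j) qj.
Qed.

Lemma stage_enqueue s i a : stage_count (State (now s) (upd (narr s) i (narr s i).+1)
    (upd (queue s) i (rcons (queue s i) (sz i (narr s i))))
    (paused s) (npause s) (nresume s) a) = stage_count s + 1.
Proof.
rewrite /stage_count (bigD1 i)//= [in RHS](bigD1 i)//= !upd_eq size_rcons.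
rewrite [RHS]addrAC -(addn1 (narr s i)) -(addn1 (size _)) !(natrD, natrM).
congr (_ + _); first by ring.
by apply: eq_bigr => j ji; rewrite !upd_neq.
Qed.

Lemma stage_step (i0 : 'I_n) s : sound x s ->
  stage_count (stp s) - (blocked (stp s))%:R =
  stage_count s - (blocked s)%:R + 1.
Proof.
move=> ss; case: (stepP x sz c dd i0) => [i t _ _ _ _|e ee _].
  have sa := stage_advance t ss; rewrite -sa -[blocked s]/(blocked (advance t s)).
  move: (advance t s) => {sa}s1.
  rewrite /arrive; case ck: (cur s1) => [|j|j u|j u b].
  - by rewrite stage_dispatch stage_enqueue /blocked ck /= subr0.
  - case: ifP => _.
      by rewrite stage_start_pause stage_enqueue /blocked ck /=; ring.
    by rewrite stage_enqueue /blocked /= ck /=; ring.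
  - by rewrite stage_enqueue /blocked /= ck /=; ring.
  - case: ifP => _; last by rewrite stage_enqueue /blocked /= ck /=; ring.
    by rewrite /set_cur /= stage_enqueue /blocked /= ck /=; ring.
have sa := stage_advance e ss; rewrite -sa -[blocked s]/(blocked (advance e s)).
have : if cur s is Serve j then queue (advance e s) j != [::] else true.
  by case ck: (cur s) => [|j|j u|j u b] //=; rewrite ck /= upd_eq.
have : cur (advance e s) <> Idle R n by rewrite /=; move: ee; rewrite /act_end; case: (cur s).
rewrite -[cur s]/(cur (advance e s)).
move: (advance e s) => {sa ee}s1; rewrite /complete.
case ck: (cur s1) => [|j|j u|j u b] // _ qj.
- rewrite stage_dispatch /blocked ck subr0 /stage_count /=.
  rewrite (sum_upd (fun k (q : seq R) => (2 * narr s1 k + npause s1 k + nresume s1 k)%:R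
    - (size q)%:R)); congr (_ + _).
  by case: (queue s1 j) qj => //= r q _; rewrite -(addn1 (size q)) !natrD; ring.
- by rewrite stage_dispatch /blocked ck /=; ring.
- case: b ck => ck; first by rewrite stage_start_pause /blocked ck /=; ring.
  by rewrite /blocked /= ck /stage_count /=; ring.
Qed.

Lemma survival_dispatch L s k :
  survival L k (dispatch dd s) - (paused (dispatch dd s) k)%:R -
  resume_discount L (dispatch dd s) k = - (paused s k)%:R - resume_discount L s k.
Proof.
rewrite /dispatch; case: best => [j|]; last by rewrite /survival /= sub0r.
case: ifP => _; last by rewrite /survival /= sub0r.
rewrite /survival /resume_discount /= /upd (eq_sym k).
have [->|_] := eqVneq j k; last by rewrite sub0r.
rewrite big_ord_recr /=.
by rewrite (_ : now s + dd k (nresume s k) - now s = dd k (nresume s k)); ring.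
Qed.

(** A preemption is a hit during service and sets [paused]. Starting a resume adds the same amount
    to survival and discount. While unfailed, its survival grows exponentially, and a hit removes
    the grown value. At success the survival has reached 1 and is exchanged against [paused]; a
    failed resume has survival 0 and leaves [paused] set. *)
Lemma resume_step (i0 : 'I_n) (L : R) s k : sound x s ->
  let s' := stp s in let h := hits s s' k in
  survival L k s' - (paused s' k)%:R - resume_discount L s' k + (serving k s)%:R * h =
  survival L k s - (paused s k)%:R - resume_discount L s k +
  survival L k s * (expR (L * (now s' - now s)) - 1) -
  survival L k s * (h * expR (L * (now s' - now s))).
Proof.
move=> ss /=.
have [hc ho _] := ss.
have sv t u : expR (- L * (u - t)) = expR (- L * (u - now s)) * expR (L * (t - now s)).
  by rewrite -expRD; congr expR; ring.
case: (stepP x sz c dd i0) => [i t _ _ _ _|e ee _].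
  rewrite (@hits_arrival s _ k i); last by rewrite narr_arrive.
  rewrite now_arrive /= /arrive /serving.
  move: ho; rewrite /activity_ok /=.
  case ck: (cur s) => [|j|j u|j u b] /= ho.
  - by rewrite survival_dispatch /survival ck /=; ring.
  - case: ifP => ij; rewrite /survival /= ck /resume_discount /=; last first.
      have [<-|_] := eqVneq j k; last by rewrite /= ?mulr0n; ring.
      by rewrite ij /= ?mulr1n ?mulr0n; ring.
    rewrite /upd (eq_sym k); have [<-|_] := eqVneq j k; last by rewrite /= ?mulr0n; ring.
    by rewrite ij (negbTE ho.2) /= ?mulr1n ?mulr0n; ring.
  - by rewrite /survival /= ck /resume_discount /=; ring.
  - case: ifP => ij; rewrite /survival /= ck /resume_discount /=.
      case: b ck ho => ck ho; first by rewrite /=; ring.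
      have [<-|_] := eqVneq j k; last by rewrite /= ?mulr0n; ring.
      by rewrite ij /= ?mulr1n ?mulr0n; ring.
    case: b ck ho => ck ho; first by rewrite /=; ring.
    have [<-|_] := eqVneq j k; last by rewrite /= ?mulr0n; ring.
    by rewrite ij (sv t) /= ?mulr1n ?mulr0n; ring.
rewrite (@hits_eq s) ?narr_complete//.
rewrite now_complete /= /complete /=.
move: ee ho; rewrite /act_end /activity_ok.
case ck: (cur s) => [|j|j u|j u b] //= -[eE] ho; rewrite !mul0r !mulr0 subr0 addr0.
- by rewrite survival_dispatch /survival ck /resume_discount /=; ring.
- by rewrite survival_dispatch /survival ck /resume_discount /=; ring.
- case: b ck => ck.
    rewrite /survival /= ck /resume_discount /= /upd.
    by have [->|_] := eqVneq k j; rewrite ?ho.1 /= ?mulr1n ?mulr0n; ring.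
  rewrite /survival /= ck /resume_discount /= /upd (eq_sym k).
  have [<-|_] := eqVneq j k; last by rewrite /= ?mulr0n; ring.
  rewrite ho.1 eE.
  (* A successful resume ends with survival 1: the growth term supplies exactly the missing
     amount. *)
  have -> : expR (- L * (e - now s)) * (expR (L * (e - now s)) - 1) =
      1 - expR (- L * (e - now s)).
    by rewrite mulrBr mulr1 -expRD mulNr addNr expR0.
  by rewrite /= ?mulr1n ?mulr0n; ring.
Qed.

End StepIdentities.

(** * Which inputs a step reads *)

Section InputDependence.
Context {R : realType} {n : nat}.
Implicit Types (x sz c dd : 'I_n -> nat -> R) (s : state R n) (i j k : 'I_n).

Definition agree_off (k : 'I_n) (m : nat) (f g : 'I_n -> nat -> R) :=
  forall j l, (j, l) != (k, m) -> g j l = f j l.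

Lemma step_due_eq x x' sz c dd s : (forall i, due x' s i = due x s i) ->
  step x' sz c dd s = step x sz c dd s.
Proof. by move=> e; rewrite /step !next_arrE (funext e). Qed.

(** The step neither consumed arrival [i] nor reached its new due time, so moving that arrival goes
    unnoticed. *)
Lemma step_delay x x' sz c dd s i :
  (forall j, j != i -> due x' s j = due x s j) ->
  (narr (step x sz c dd s) i <= narr s i)%N ->
  now (step x sz c dd s) < due x' s i ->
  step x' sz c dd s = step x sz c dd s.
Proof.
move=> xx'; rewrite [step x _ _ _ _]/step [step x' _ _ _ _]/step !next_arrE.
case e: (earliest (due x s)) => [[j t]|]; last first.
  by rewrite (earliest_none e).
have [jl tE tmin] := earliest_some e.
have delayed : t < due x' s i -> j != i ->
    earliest (due x' s) (enum 'I_n) = Some (j, t).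
  by move=> h1 h2; exact: (earliest_delay xx').
have late u : u <= t -> u < due x' s i ->
    forall j' t', earliest (due x' s) (enum 'I_n) = Some (j', t') -> u <= t'.
  move=> ut ui j' t' /earliest_some[_ -> _].
  have [->|ji] := eqVneq j' i; first exact: ltW.
  by rewrite xx'//; apply: le_trans ut _; apply: tmin; rewrite mem_enum.
have ne : exists j' t', earliest (due x' s) (enum 'I_n) = Some (j', t').
  case e': (earliest _ _) => [[j' t']|]; first by exists j', t'.
  by move: jl; rewrite (earliest_none e').
case: (act_end s) => [u|].
  have [ut|ut] := leP u t.
    rewrite now_complete /= => _ ui; have [j' [t' e']] := ne.
    by rewrite e' (late u ut ui _ _ e').
  rewrite narr_arrive now_arrive /= => ni ti.
  have ji : j != i by apply: contraTneq ni => ->; rewrite upd_eq ltnn.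
  by rewrite delayed// leNgt ut.
rewrite narr_arrive now_arrive /= => ni ti.
have ji : j != i by apply: contraTneq ni => ->; rewrite upd_eq ltnn.
by rewrite delayed.
Qed.

(** [B] is the earliest among the end of the current activity and the pending arrivals of the other
    classes. A busy server makes it finite: an idle queue with a single class waits for arrival [i]
    alone. At equality the count depends on the tie rules, hence the strict inequalities. *)
Lemma step_race_bound x sz c dd s i : cur s <> Idle R n ->
  exists B, forall x', (forall j, j != i -> due x' s j = due x s j) ->
    [/\ now (step x' sz c dd s) = Num.min (due x' s i) B,
        due x' s i < B -> narr (step x' sz c dd s) i = (narr s i).+1 &
        B < due x' s i -> narr (step x' sz c dd s) i = narr s i].
Proof.
move=> busy.
have [e ee] : exists e, act_end s = Some e.
  by move: busy; rewrite /act_end; case: (cur s) => // *; eexists.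
pose B := \big[Num.min/e]_(j | j != i) due x s j.
have Be : B <= e.
  by rewrite /B; elim/big_rec: _ => // j y _ h; rewrite ge_min h orbT.
have Bj j : j != i -> B <= due x s j.
  by move=> ji; rewrite /B (bigD1 j)//= ge_min lexx.
have Bge y : y <= e -> (forall j, j != i -> y <= due x s j) -> y <= B.
  move=> ye yj; rewrite /B; elim/big_rec: _ => // j z ji h.
  by rewrite le_min h yj.
exists B => x' xx'; case: (stepP x' sz c dd i) => [j t tE tmin te _|u].
  have {}te := te _ ee.
  rewrite now_arrive narr_arrive /=; have [ji|ji] := eqVneq j i.
    rewrite ji in tE *; rewrite -tE upd_eq.
    have tB : t <= B.
      by apply: Bge; [exact: ltW|move=> j' j'i; rewrite -xx'].
    by split => //; [rewrite (min_idPl tB)|rewrite ltNge tB].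
  have tB : B = t.
    apply/eqP; rewrite eq_le {1}tE xx'// Bj//=.
    by apply: Bge; [exact: ltW|move=> j' j'i; rewrite -xx'].
  rewrite upd_neq 1?eq_sym// tB; split => //; first by rewrite (min_idPr (tmin i)).
  by rewrite ltNge tmin.
rewrite ee => -[<-] emin; rewrite now_complete narr_complete /=.
have eB : B = e.
  by apply/eqP; rewrite eq_le Be/=; apply: Bge => // j' j'i; rewrite -xx'.
rewrite eB; split => //; first by rewrite (min_idPr (emin i)).
by rewrite ltNge emin.
Qed.

(** Input number [m] is read in the step that lifts its counter from [m] to [m.+1], in either run;
    this is what Wald's identity asks for. Pauses and resumes follow the same pattern. *)
Lemma step_size_dep x sz sz' c dd s k m : agree_off k m sz sz' ->
  step x sz' c dd s = step x sz c dd s \/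
  narr s k = m /\ narr (step x sz' c dd s) k = m.+1 /\
  narr (step x sz c dd s) k = m.+1.
Proof.
move=> ag; rewrite /step.
have dep i t : arrive sz' c dd i (advance t s) = arrive sz c dd i (advance t s) \/
  narr s k = m /\ narr (arrive sz' c dd i (advance t s)) k = m.+1 /\
  narr (arrive sz c dd i (advance t s)) k = m.+1.
  have [[ik nm]|ne] := eqVneq (i, narr s i) (k, m).
    by right; rewrite !narr_arrive /= -ik upd_eq nm.
  by left; rewrite /arrive /= ag.
case: next_arr => [[i t]|]; case: act_end => [e|]; try by left.
  by case: leP => _; [left|exact: dep].
exact: dep.
Qed.

Lemma start_pause_dep c c' s j k m : agree_off k m c c' ->
  start_pause c' j s = start_pause c j s \/
  npause s k = m /\ npause (start_pause c' j s) k = m.+1 /\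
  npause (start_pause c j s) k = m.+1.
Proof.
move=> ag; have [[jk nm]|ne] := eqVneq (j, npause s j) (k, m).
  by right; rewrite /= -jk upd_eq nm.
by left; rewrite /start_pause ag.
Qed.

Lemma step_pause_dep x sz c c' dd s k m : agree_off k m c c' ->
  step x sz c' dd s = step x sz c dd s \/
  npause s k = m /\ npause (step x sz c' dd s) k = m.+1 /\
  npause (step x sz c dd s) k = m.+1.
Proof.
move=> ag; rewrite /step.
have depA i t : arrive sz c' dd i (advance t s) = arrive sz c dd i (advance t s) \/
  npause s k = m /\ npause (arrive sz c' dd i (advance t s)) k = m.+1 /\
  npause (arrive sz c dd i (advance t s)) k = m.+1.
  rewrite /arrive /=; case: (cur s) => [|j|j u|j u b]; try by left.
  by case: ifP => _; [exact: start_pause_dep|left].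
have depC t : complete c' dd (advance t s) = complete c dd (advance t s) \/
  npause s k = m /\ npause (complete c' dd (advance t s)) k = m.+1 /\
  npause (complete c dd (advance t s)) k = m.+1.
  rewrite /complete /=; case: (cur s) => [|j|j u|j u b]; try by left.
  by case: b; [exact: start_pause_dep|left].
case: next_arr => [[i t]|]; case: act_end => [e|]; try by left.
- by case: leP => _; [exact: depC|exact: depA].
- exact: depA.
- exact: depC.
Qed.

Lemma dispatch_dep dd dd' s k m : agree_off k m dd dd' ->
  dispatch dd' s = dispatch dd s \/
  nresume s k = m /\ nresume (dispatch dd' s) k = m.+1 /\
  nresume (dispatch dd s) k = m.+1.
Proof.
move=> ag; rewrite /dispatch; case: best => [j|]; last by left.
case: ifP => _; last by left.
have [[jk nm]|ne] := eqVneq (j, nresume s j) (k, m).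
  by right; rewrite /= -jk upd_eq nm.
by left; rewrite ag.
Qed.

Lemma step_resume_dep x sz c dd dd' s k m : agree_off k m dd dd' ->
  step x sz c dd' s = step x sz c dd s \/
  nresume s k = m /\ nresume (step x sz c dd' s) k = m.+1 /\
  nresume (step x sz c dd s) k = m.+1.
Proof.
move=> ag; rewrite /step.
have depA i t : arrive sz c dd' i (advance t s) = arrive sz c dd i (advance t s) \/
  nresume s k = m /\ nresume (arrive sz c dd' i (advance t s)) k = m.+1 /\
  nresume (arrive sz c dd i (advance t s)) k = m.+1.
  rewrite /arrive /=; case: (cur s) => [|j|j u|j u b]; try by left.
  exact: dispatch_dep.
have depC t : complete c dd' (advance t s) = complete c dd (advance t s) \/
  nresume s k = m /\ nresume (complete c dd' (advance t s)) k = m.+1 /\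
  nresume (complete c dd (advance t s)) k = m.+1.
  rewrite /complete /=; case: (cur s) => [|j|j u|j u b]; try by left.
  - exact: dispatch_dep.
  - exact: dispatch_dep.
case: next_arr => [[i t]|]; case: act_end => [e|]; try by left.
- by case: leP => _; [exact: depC|exact: depA].
- exact: depA.
- exact: depC.
Qed.

End InputDependence.

(** * The coordinate space of all inputs *)

Section ClampedInputs.
Context {R : realType} {n : nat}.

Definition tagT : choiceType := (bool * bool * 'I_n * nat)%type.
Notation Z := (@inputsp R tagT).
Implicit Types z : Z.

(* Off a null set the inputs are positive (resp. nonnegative); clamping makes
   this hold everywhere. *)
Definition pos (v : R) : R := if 0 < v then v else 1.
Definition nonneg (v : R) : R := if 0 <= v then v else 0.

Definition xin z (i : 'I_n) (m : nat) : R := pos (z (false, false, i, m)).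
Definition szin z (i : 'I_n) (m : nat) : R := pos (z (false, true, i, m)).
Definition cin z (i : 'I_n) (m : nat) : R := nonneg (z (true, false, i, m)).
Definition ddin z (i : 'I_n) (m : nat) : R := nonneg (z (true, true, i, m)).

Lemma pos_gt0 v : 0 < pos v. Proof. by rewrite /pos; case: ifP. Qed.
Lemma pos_id v : 0 < v -> pos v = v. Proof. by rewrite /pos => ->. Qed.
Lemma nonneg_ge0 v : 0 <= nonneg v. Proof. by rewrite /nonneg; case: ifP. Qed.

Lemma xin_gt0 z i m : 0 < xin z i m. Proof. exact: pos_gt0. Qed.
Lemma szin_gt0 z i m : 0 < szin z i m. Proof. exact: pos_gt0. Qed.
Lemma cin_ge0 z i m : 0 <= cin z i m. Proof. exact: nonneg_ge0. Qed.
Lemma ddin_ge0 z i m : 0 <= ddin z i m. Proof. exact: nonneg_ge0. Qed.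

Lemma measurable_pos : measurable_fun setT pos.
Proof.
apply: measurable_fun_ifT; [|exact: measurable_id|exact: measurable_cst].
exact: measurable_fun_ltr.
Qed.

Lemma measurable_nonneg : measurable_fun setT nonneg.
Proof.
apply: measurable_fun_ifT; [|exact: measurable_id|exact: measurable_cst].
exact: measurable_fun_ler.
Qed.

Lemma measurable_xin i m : measurable_fun setT (fun z => xin z i m).
Proof. by apply: (measurableT_comp measurable_pos); exact: measurable_coord. Qed.
Lemma measurable_szin i m : measurable_fun setT (fun z => szin z i m).
Proof. by apply: (measurableT_comp measurable_pos); exact: measurable_coord. Qed.
Lemma measurable_cin i m : measurable_fun setT (fun z => cin z i m).
Proof. by apply: (measurableT_comp measurable_nonneg); exact: measurable_coord. Qed.
Lemma measurable_ddin i m : measurable_fun setT (fun z => ddin z i m).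
Proof. by apply: (measurableT_comp measurable_nonneg); exact: measurable_coord. Qed.

Lemma resample_xin a b i m z z' : ~~ (~~ a && ~~ b) ->
  xin (resample (a, b, i, m) z z') = xin z.
Proof.
move=> ab; apply/funext => j; apply/funext => l; rewrite /xin resample_neq//.
by apply: contra ab => /eqP[<- <-].
Qed.

Lemma resample_szin a b i m z z' : ~~ (~~ a && b) ->
  szin (resample (a, b, i, m) z z') = szin z.
Proof.
move=> ab; apply/funext => j; apply/funext => l; rewrite /szin resample_neq//.
by apply: contra ab => /eqP[<- <-].
Qed.

Lemma resample_cin a b i m z z' : ~~ (a && ~~ b) ->
  cin (resample (a, b, i, m) z z') = cin z.
Proof.
move=> ab; apply/funext => j; apply/funext => l; rewrite /cin resample_neq//.
by apply: contra ab => /eqP[<- <-].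
Qed.

Lemma resample_ddin a b i m z z' : ~~ (a && b) ->
  ddin (resample (a, b, i, m) z z') = ddin z.
Proof.
move=> ab; apply/funext => j; apply/funext => l; rewrite /ddin resample_neq//.
by apply: contra ab => /eqP[<- <-].
Qed.

Lemma agree_xin i m z z' :
  agree_off i m (xin z) (xin (resample (false, false, i, m) z z')).
Proof. by move=> j l jl; rewrite /xin resample_neq//; apply: contra jl => /eqP[-> ->]. Qed.
Lemma agree_szin i m z z' :
  agree_off i m (szin z) (szin (resample (false, true, i, m) z z')).
Proof. by move=> j l jl; rewrite /szin resample_neq//; apply: contra jl => /eqP[-> ->]. Qed.
Lemma agree_cin i m z z' :
  agree_off i m (cin z) (cin (resample (true, false, i, m) z z')).
Proof. by move=> j l jl; rewrite /cin resample_neq//; apply: contra jl => /eqP[-> ->]. Qed.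
Lemma agree_ddin i m z z' :
  agree_off i m (ddin z) (ddin (resample (true, true, i, m) z z')).
Proof. by move=> j l jl; rewrite /ddin resample_neq//; apply: contra jl => /eqP[-> ->]. Qed.

Lemma agree_arrT (x x' : 'I_n -> nat -> R) i m j l : agree_off i m x x' ->
  (j != i) || (l < m)%N -> arrT x' j l = arrT x j l.
Proof.
move=> ag h; apply: eq_bigr => q _; apply: ag; apply/eqP => -[ji qm].
by move: h; rewrite ji eqxx /= -qm ltnNge -ltnS ltn_ord.
Qed.

End ClampedInputs.

(** * The queue stopped when it empties *)

Section StoppedQueue.
Context {R : realType} {n : nat}.
Notation Z := (@inputsp R (@tagT n)).
Implicit Types (z : Z) (s : state R n) (i k : 'I_n).
Variable i0 : 'I_n.

(* The first arrival separates the return to emptiness from the empty start. *)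
Definition halted s : bool := is_idle s && [exists i, narr s i != 0%N].

(** Freezing the run at the end of the first busy period replaces a random number of steps by a
    fixed [N]: later steps contribute nothing and the clock stands still. *)
Definition qstep z s : state R n :=
  if halted s then s else step (xin z) (szin z) (cin z) (ddin z) s.

Notation tr := (trajectory qstep (fun=> init R n)).

Lemma sound_tr z j : sound (xin z) (tr z j).
Proof.
elim: j => [|j IH]; first by apply: sound_init => i m; exact: xin_gt0.
rewrite trajectoryS /qstep; case: ifP => // _.
by apply: (sound_step _ _ _ _ i0 IH).1;
  [exact: xin_gt0|exact: szin_gt0|exact: cin_ge0|exact: ddin_ge0].
Qed.

Lemma clock_mono_tr z j : now (tr z j) <= now (tr z j.+1).
Proof.
rewrite trajectoryS /qstep; case: ifP => // _.
by apply: (sound_step _ _ _ _ i0 (sound_tr z j)).2;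
  [exact: xin_gt0|exact: szin_gt0|exact: cin_ge0|exact: ddin_ge0].
Qed.

(** A step moves a counter by at most one, so it is at most [j] after [j] steps; the means of all
    counters are thus finite from the outset. *)
Lemma counter_qstep (cnt : state R n -> 'I_n -> nat) :
  (forall x sz c dd s k, cnt (step x sz c dd s) k = cnt s k \/
     cnt (step x sz c dd s) k = (cnt s k).+1) ->
  (forall k, cnt (init R n) k = 0%N) ->
  (forall z s k, cnt s k <= cnt (qstep z s) k)%N /\
  (forall z j k, cnt (tr z j) k <= j)%N.
Proof.
move=> h c0; have h1 z s k : (cnt s k <= cnt (qstep z s) k <= (cnt s k).+1)%N.
  rewrite /qstep; case: ifP => _; first by rewrite leqnn leqnSn.
  by case: (h (xin z) (szin z) (cin z) (ddin z) s k) => ->; rewrite ?leqnn ?leqnSn.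
split=> [z s k|z j k]; first by have /andP[] := h1 z s k.
elim: j => [|j IH]; first by rewrite /trajectory /= c0.
by rewrite trajectoryS; have /andP[_ h2] := h1 z (tr z j) k; rewrite (leq_trans h2).
Qed.

Lemma narr_counter : (forall z s k, narr s k <= narr (qstep z s) k)%N /\
  (forall z j k, narr (tr z j) k <= j)%N.
Proof. by apply: counter_qstep => // *; exact: narr_step. Qed.

Lemma npause_counter : (forall z s k, npause s k <= npause (qstep z s) k)%N /\
  (forall z j k, npause (tr z j) k <= j)%N.
Proof. by apply: counter_qstep => // *; exact: npause_step. Qed.

Lemma nresume_counter : (forall z s k, nresume s k <= nresume (qstep z s) k)%N /\
  (forall z j k, nresume (tr z j) k <= j)%N.
Proof. by apply: counter_qstep => // *; exact: nresume_step. Qed.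

Lemma dep_qstep (cnt : state R n -> nat) z z' s m :
  (cnt s <= m)%N ->
  (step (xin z') (szin z') (cin z') (ddin z') s = step (xin z) (szin z) (cin z) (ddin z) s \/
   cnt s = m /\ cnt (step (xin z') (szin z') (cin z') (ddin z') s) = m.+1 /\
   cnt (step (xin z) (szin z) (cin z) (ddin z) s) = m.+1) ->
  qstep z' s = qstep z s \/ (m < cnt (qstep z s) /\ m < cnt (qstep z' s))%N.
Proof.
move=> cm h; rewrite /qstep; case: ifP => _; first by left.
by case: h => [->|[_ [-> ->]]]; [left|right].
Qed.

Lemma qstep_size_dep k m z z' s : (narr s k <= m)%N ->
  let z1 := resample (false, true, k, m) z z' in
  qstep z1 s = qstep z s \/ (m < narr (qstep z s) k /\ m < narr (qstep z1 s) k)%N.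
Proof.
move=> cm; apply: (dep_qstep (cnt := fun s => narr s k)) => //.
rewrite resample_xin// resample_cin// resample_ddin//.
by apply: step_size_dep; exact: agree_szin.
Qed.

Lemma qstep_pause_dep k m z z' s : (npause s k <= m)%N ->
  let z1 := resample (true, false, k, m) z z' in
  qstep z1 s = qstep z s \/ (m < npause (qstep z s) k /\ m < npause (qstep z1 s) k)%N.
Proof.
move=> cm; apply: (dep_qstep (cnt := fun s => npause s k)) => //.
rewrite resample_xin// resample_szin// resample_ddin//.
by apply: step_pause_dep; exact: agree_cin.
Qed.

Lemma qstep_resume_dep k m z z' s : (nresume s k <= m)%N ->
  let z1 := resample (true, true, k, m) z z' in
  qstep z1 s = qstep z s \/ (m < nresume (qstep z s) k /\ m < nresume (qstep z1 s) k)%N.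
Proof.
move=> cm; apply: (dep_qstep (cnt := fun s => nresume s k)) => //.
rewrite resample_xin// resample_szin// resample_cin//.
by apply: step_resume_dep; exact: agree_ddin.
Qed.

Definition arrival_tag i m : @tagT n := (false, false, i, m).

Lemma due_epoch z s i : due (xin z) s i = epoch (arrival_tag i) pos z (narr s i).+1.
Proof. by []. Qed.

Lemma due_resample i m z z' s : narr s i = m ->
  due (xin (resample (arrival_tag i m) z z')) s i =
  epoch (arrival_tag i) pos z m + pos (z' (arrival_tag i m)).
Proof. by move=> nm; rewrite due_epoch nm epoch_resampleS// => a b []. Qed.

Lemma due_resample_other i m z z' s j : j != i ->
  due (xin (resample (arrival_tag i m) z z')) s j = due (xin z) s j.
Proof. by move=> ji; apply: agree_arrT; [exact: agree_xin|rewrite ji]. Qed.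

Lemma qstep_before i m z z' s : (narr s i < m)%N ->
  qstep (resample (arrival_tag i m) z z') s = qstep z s.
Proof.
move=> nm; rewrite /qstep; case: ifP => // _.
rewrite resample_szin// resample_cin// resample_ddin//.
apply: step_due_eq => j; apply: agree_arrT; first exact: agree_xin.
by have [->|//] := eqVneq j i; rewrite nm orbT.
Qed.

Lemma qstep_alt i m z z' s : narr s i = m -> (narr (qstep z s) i <= m)%N ->
  now (qstep z s) < epoch (arrival_tag i) pos z m + pos (z' (arrival_tag i m)) ->
  qstep (resample (arrival_tag i m) z z') s = qstep z s.
Proof.
move=> nm; rewrite /qstep; case: ifP => // _ cm lt.
rewrite resample_szin// resample_cin// resample_ddin//.
apply: (@step_delay _ _ _ _ _ _ _ _ i) => [j ji||].
- exact: due_resample_other.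
- by rewrite nm.
- by rewrite due_resample.
Qed.

Lemma qstep_race i m z s : narr s i = m -> cur s <> Idle R n ->
  exists B, forall z', let y := resample (arrival_tag i m) z z' in
    [/\ now (qstep y s) = Num.min (epoch (arrival_tag i) pos z m + pos (z' (arrival_tag i m))) B,
        epoch (arrival_tag i) pos z m + pos (z' (arrival_tag i m)) < B ->
          narr (qstep y s) i = m.+1 &
        B < epoch (arrival_tag i) pos z m + pos (z' (arrival_tag i m)) ->
          narr (qstep y s) i = m].
Proof.
move=> nm busy.
have [B HB] := @step_race_bound _ _ (xin z) (szin z) (cin z) (ddin z) s i busy.
exists B => z' y; rewrite /qstep ifF; last first.
  by rewrite /halted /is_idle; case: (cur s) busy.
rewrite /y resample_szin// resample_cin// resample_ddin//.
have [|h1 h2 h3] := HB (xin y); first by move=> j ji; exact: due_resample_other.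
by rewrite due_resample// nm in h1 h2 h3.
Qed.

Lemma epoch_le_clock i z j : epoch (arrival_tag i) pos z (narr (tr z j) i) <= now (tr z j).
Proof. by have [hc _ _] := sound_tr z j; have /andP[] := con_time hc i. Qed.

Lemma clock_le_epoch i z j :
  now (tr z j) <= epoch (arrival_tag i) pos z (narr (tr z j) i).+1.
Proof. by have [hc _ _] := sound_tr z j; have /andP[] := con_time hc i. Qed.

Lemma piecewise_tr j : piecewise (@state_class _ Z R n) (fun z => tr z j).
Proof.
elim: j => [|j IH].
  apply: piecewise_base.
  rewrite (_ : (fun z => _) = fun z : Z => State ((fun=> 0) z) (fun=> 0%N)
     (fun k => eval_seq ((fun=> [::]) k) z) (fun=> false) (fun=> 0%N) (fun=> 0%N)
     ((fun=> Idle R n) z)) //.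
  apply: StateClass; [exact: measurable_cst| |exact: class_idle].
  by move=> k l; rewrite nth_nil; exact: measurable_cst.
apply: (piecewise_bind (F := fun z s => qstep z s) _ IH) => s cs.
(* [halted] reads only discrete data, so a piece is frozen or running as a whole. *)
have [h|h] : (forall z, halted (s z) = true) \/ (forall z, halted (s z) = false).
  case: cs => nw na qs pz np nr ca _ _ []; rewrite /halted /is_idle /=; try by right.
  by case: [exists i, _]; [left|right].
- rewrite (_ : (fun z => _) = s); first exact: piecewise_base.
  by apply/funext => z; rewrite /qstep h.
- rewrite (_ : (fun z => _) = fun z => step (xin z) (szin z) (cin z) (ddin z) (s z)).
    apply: piecewise_step => // i m; [exact: measurable_xin|exact: measurable_szin|
      exact: measurable_cin|exact: measurable_ddin].
  by apply/funext => z; rewrite /qstep h.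
Qed.

Lemma measurable_tr (g : state R n -> R) j :
  (forall s : Z -> state R n, state_class s -> measurable_fun setT (fun z => g (s z))) ->
  measurable_fun setT (fun z => g (tr z j)).
Proof. by move=> h; apply: (piecewise_measurable (g := g) h (piecewise_tr j)). Qed.

Lemma measurable_now j : measurable_fun setT (fun z => now (tr z j)).
Proof. by apply: measurable_tr => s []. Qed.

Lemma measurable_narr i j : measurable_fun setT (fun z => (narr (tr z j) i)%:R : R).
Proof.
by apply: (measurable_tr (g := fun s => (narr s i)%:R)) => s [] *; exact: measurable_cst.
Qed.

Lemma measurable_npause i j : measurable_fun setT (fun z => (npause (tr z j) i)%:R : R).
Proof.
by apply: (measurable_tr (g := fun s => (npause s i)%:R)) => s [] *; exact: measurable_cst.
Qed.

Lemma measurable_nresume i j : measurable_fun setT (fun z => (nresume (tr z j) i)%:R : R).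
Proof.
by apply: (measurable_tr (g := fun s => (nresume s i)%:R)) => s [] *; exact: measurable_cst.
Qed.

Definition busy s : R := (~~ is_idle s)%:R.

Lemma measurable_busy j : measurable_fun setT (fun z => busy (tr z j)).
Proof.
by apply: measurable_tr => s [nw na qs pz np nr ca _ _ []] *; exact: measurable_cst.
Qed.

Lemma measurable_serving k j : measurable_fun setT (fun z => (serving k (tr z j))%:R : R).
Proof.
by apply: (measurable_tr (g := fun s => (serving k s)%:R)) => s [nw na qs pz np nr ca _ _ []] *;
  exact: measurable_cst.
Qed.

Lemma measurable_paused k j : measurable_fun setT (fun z => (paused (tr z j) k)%:R : R).
Proof.
by apply: (measurable_tr (g := fun s => (paused s k)%:R)) => s [] *; exact: measurable_cst.
Qed.

Lemma measurable_survival (L : R) k j : measurable_fun setT (fun z => survival L k (tr z j)).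
Proof.
apply: measurable_tr => s [nw na qs pz np nr ca mnw _ [|k'|k' e me|k' e b me]];
  rewrite /survival /=;
  try exact: measurable_cst.
case: b; first exact: measurable_cst.
case: eqP => _; last exact: measurable_cst.
apply: measurableT_comp => //; apply: measurable_funM; first exact: measurable_cst.
exact: measurable_funB.
Qed.

End StoppedQueue.

Section QueuePaths.
Context {R : realType} {n : nat}.
Notation Z := (@inputsp R (@tagT n)).
Implicit Types (z : Z) (s : state R n) (i k : 'I_n).
Variable i0 : 'I_n.
Notation tr := (trajectory qstep (fun=> init R n)).

Definition lag z (j : nat) : R := now (tr z j.+1) - now (tr z j).

Definition busy_time z (N : nat) : R := \sum_(j < N) busy (tr z j) * lag z j.

Definition served k z (N : nat) : R :=
  \sum_(j < N) (serving k (tr z j))%:R * lag z j.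

Definition preempted k z (N : nat) : R :=
  \sum_(j < N) (serving k (tr z j))%:R * hits (tr z j) (tr z j.+1) k.

Definition arrivals i z (N : nat) : R := \sum_(j < N)
  busy (tr z j) * ((narr (tr z j.+1) i)%:R - (narr (tr z j) i)%:R).

Definition blocked_time z (N : nat) : R :=
  \sum_(j < N) (blocked (tr z j))%:R * lag z j.

(** Growth of the survival of an unfailed resume, while [survival_loss] collects the grown survival
    at failure. When [L] is the higher-priority rate, the gain compensates the loss and the means
    agree. *)
Definition survival_gain (L : R) k z (N : nat) : R :=
  \sum_(j < N) survival L k (tr z j) * (expR (L * lag z j) - 1).

Definition survival_loss (L : R) k z (N : nat) : R :=
  \sum_(j < N) survival L k (tr z j) *
    (hits (tr z j) (tr z j.+1) k * expR (L * lag z j)).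

Definition busy_steps z (N : nat) : R := \sum_(j < N) busy (tr z j).

Lemma servedS k z N :
  served k z N.+1 = served k z N + (serving k (tr z N))%:R * lag z N.
Proof. exact: big_ord_recr. Qed.

Lemma preemptedS k z N : preempted k z N.+1 =
  preempted k z N + (serving k (tr z N))%:R * hits (tr z N) (tr z N.+1) k.
Proof. exact: big_ord_recr. Qed.

Lemma busy_timeS z N : busy_time z N.+1 = busy_time z N + busy (tr z N) * lag z N.
Proof. exact: big_ord_recr. Qed.

Lemma arrivalsS i z N : arrivals i z N.+1 = arrivals i z N +
  busy (tr z N) * ((narr (tr z N.+1) i)%:R - (narr (tr z N) i)%:R).
Proof. exact: big_ord_recr. Qed.

Lemma blocked_timeS z N :
  blocked_time z N.+1 = blocked_time z N + (blocked (tr z N))%:R * lag z N.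
Proof. exact: big_ord_recr. Qed.

Lemma survival_gainS (L : R) k z N : survival_gain L k z N.+1 =
  survival_gain L k z N + survival L k (tr z N) * (expR (L * lag z N) - 1).
Proof. exact: big_ord_recr. Qed.

Lemma survival_lossS (L : R) k z N : survival_loss L k z N.+1 =
  survival_loss L k z N + survival L k (tr z N) *
    (hits (tr z N) (tr z N.+1) k * expR (L * lag z N)).
Proof. exact: big_ord_recr. Qed.

Lemma busy_stepsS z N : busy_steps z N.+1 = busy_steps z N + busy (tr z N).
Proof. exact: big_ord_recr. Qed.

Lemma halted_tr z j : halted (tr z j) -> tr z j.+1 = tr z j.
Proof. by move=> h; rewrite trajectoryS /qstep h. Qed.

Lemma halted_idle s : halted s -> cur s = Idle R n.
Proof. by rewrite /halted /is_idle; case: (cur s). Qed.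

Lemma running_tr z j : halted (tr z j) = false ->
  tr z j.+1 = step (xin z) (szin z) (cin z) (ddin z) (tr z j).
Proof. by move=> h; rewrite trajectoryS /qstep h. Qed.

Lemma lag_ge0 z j : 0 <= lag z j.
Proof. by rewrite subr_ge0; exact: clock_mono_tr i0 _ _. Qed.

Lemma backlog_ge0 z j k : 0 <= backlog (tr z j) k.
Proof.
have [hc _ _] := sound_tr i0 z j; rewrite /backlog big_seq; apply: sumr_ge0 => r.
by have /allP := con_queue hc k; exact.
Qed.

Lemma residual_ge0 z j : 0 <= residual (tr z j).
Proof.
have [_ ho _] := sound_tr i0 z j; move: ho; rewrite /residual /activity_ok.
by case: (cur _) => [|?|? u|? u ?] //= [_]; rewrite subr_ge0.
Qed.

Lemma served_backlog k z N :
  served k z N + backlog (tr z N) k = admitted (szin z) (tr z N) k.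
Proof.
elim: N => [|N IH].
  by rewrite /served big_ord0 /backlog /admitted /trajectory /= big_nil big_ord0 addr0.
rewrite servedS; case h: (halted (tr z N)).
  rewrite /lag halted_tr// subrr mulr0 addr0; exact: IH.
have := backlog_step (szin z) (cin z) (ddin z) i0 k (sound_tr i0 z N).
by rewrite -running_tr// /lag => e; lra.
Qed.

Lemma overhead_blocked z N :
  blocked_time z N + residual (tr z N) =
  overhead (cin z) (ddin z) (tr z N).
Proof.
elim: N => [|N IH].
  rewrite /blocked_time big_ord0 /residual /overhead /trajectory /= big1 ?addr0// => k _.
  by rewrite !big_ord0 addr0.
rewrite blocked_timeS; case h: (halted (tr z N)).
  rewrite /lag halted_tr// subrr mulr0 addr0; exact: IH.
have := overhead_step (xin z) (szin z) (cin z) (ddin z) i0 (tr z N).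
by rewrite -running_tr// /lag => e; lra.
Qed.

Lemma busyE s : busy s = \sum_k (serving k s)%:R + (blocked s)%:R.
Proof.
rewrite /busy /is_idle /serving /blocked; case: (cur s) => [|j|j u|j u b] /=;
  try by rewrite big1 ?add0r.
by rewrite (bigD1 j)//= eqxx big1 ?addr0// => k /negbTE; rewrite eq_sym => ->.
Qed.

Lemma busy_timeE z N :
  busy_time z N = \sum_k served k z N + blocked_time z N.
Proof.
elim: N => [|N IH].
  rewrite /busy_time /blocked_time !big_ord0 big1 ?addr0// => k _.
  by rewrite /served big_ord0.
rewrite busy_timeS blocked_timeS IH busyE mulrDl addrACA; congr (_ + _).
by rewrite mulr_suml -big_split; apply: eq_bigr => k _; rewrite servedS.
Qed.

Lemma busy_time_le z N : busy_time z N <=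
  \sum_k admitted (szin z) (tr z N) k + overhead (cin z) (ddin z) (tr z N).
Proof.
rewrite -overhead_blocked busy_timeE.
apply: lerD; last by rewrite lerDl residual_ge0.
apply: ler_sum => k _; rewrite -served_backlog lerDl; exact: backlog_ge0.
Qed.

Lemma served_le k z N : served k z N <= admitted (szin z) (tr z N) k.
Proof. by rewrite -served_backlog lerDl backlog_ge0. Qed.

(** From the empty start the only possible event is an arrival, and counters never decrease.
    Idleness after step 0 therefore means that the queue has emptied again. *)
Lemma started z N : [exists i, narr (tr z N.+1) i != 0%N].
Proof.
elim: N => [|N /existsP[i ni]].
  rewrite running_tr /trajectory /=; last first.
    by rewrite /halted /=; apply/existsP => -[].
  case: (stepP (xin z) (szin z) (cin z) (ddin z) i0) => [i t _ _ _ _|e //].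
  by apply/existsP; exists i; rewrite narr_arrive upd_eq.
apply/existsP; exists i; rewrite -lt0n.
apply: (@leq_trans (narr (tr z N.+1) i)); first by rewrite lt0n.
by rewrite [X in (_ <= narr X _)%N]trajectoryS; exact: (@narr_counter R n).1.
Qed.

Lemma idle_halted z N : cur (tr z N.+1) = Idle R n -> halted (tr z N.+1).
Proof. by move=> e; rewrite /halted /is_idle e started. Qed.

Lemma busy0 z : busy (tr z 0) = 0. Proof. by []. Qed.

Lemma busy_or_halted z N : busy (tr z N.+1) = 1 \/ tr z N.+2 = tr z N.+1.
Proof.
case e: (cur (tr z N.+1)) => [|j|j u|j u b];
  try by left; rewrite /busy /is_idle e.
by right; apply: halted_tr; exact: idle_halted.
Qed.

(** The only idle time before freezing is the wait for the first arrival, and class [i0] arrives at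
    [xin z i0 0] at the latest. *)
Lemma now_le z N : now (tr z N) <= xin z i0 0 + busy_time z N.
Proof.
case: N => [|N]; first by rewrite /busy_time big_ord0 addr0 ltW// xin_gt0.
elim: N => [|N IH].
  rewrite /busy_time big_ord1 busy0 mul0r addr0 running_tr /trajectory /=; last first.
    by rewrite /halted /=; apply/existsP => -[].
  case: (stepP (xin z) (szin z) (cin z) (ddin z) i0) => [i t _ /(_ i0) tmin _ _|e //].
  by rewrite now_arrive /= (le_trans tmin)// /due /arrT big_ord1.
rewrite busy_timeS /lag.
case: (busy_or_halted z N) => [->|->]; last by rewrite subrr mulr0 addr0.
by rewrite mul1r; lra.
Qed.

(** The [1] stands for the arrival that opens the busy period, the only one that finds the server
    idle. *)
Lemma narr_le i z N : (narr (tr z N) i)%:R <= 1 + arrivals i z N.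
Proof.
case: N => [|N]; first by rewrite /arrivals big_ord0 /trajectory /= addr0.
elim: N => [|N IH].
  rewrite /arrivals big_ord1 busy0 mul0r addr0 -[leRHS]/(1%:R) ler_nat.
  exact: (@narr_counter R n).2.
rewrite arrivalsS.
case: (busy_or_halted z N) => [->|->]; last by rewrite subrr mulr0 addr0.
by rewrite mul1r; lra.
Qed.

(** [resume_step] telescoped; a frozen state is idle and has survival 0, so frozen steps add
    nothing. *)
Lemma resume_balance (L : R) k z N :
  preempted k z N + survival L k (tr z N) + survival_loss L k z N =
  resume_discount (ddin z) L (tr z N) k + survival_gain L k z N +
  (paused (tr z N) k)%:R.
Proof.
elim: N => [|N IH].
  rewrite /preempted /resume_discount /survival_gain /survival_loss !big_ord0.
  by rewrite /survival /trajectory /= !addr0.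
rewrite preemptedS survival_gainS survival_lossS; case h: (halted (tr z N)).
  have e := halted_idle h; rewrite /lag halted_tr// hits_eq// mulr0 addr0.
  have sv : survival L k (tr z N) = 0 by rewrite /survival e.
  by move: IH; rewrite sv !mul0r !addr0.
have := resume_step (szin z) (cin z) (ddin z) i0 L k (sound_tr i0 z N).
rewrite -running_tr// /= -/(lag z N) => e.
by lra.
Qed.

(** Every running step raises [stage_count - blocked] by one; dropping queue sizes and [blocked]
    leaves counters whose means are controlled. *)
Lemma busy_steps_le z N : busy_steps z N <=
  \sum_k (2 * narr (tr z N) k + npause (tr z N) k + nresume (tr z N) k)%:R.
Proof.
apply: (@le_trans _ _ (stage_count (tr z N) - (blocked (tr z N))%:R)); last first.
  rewrite lerBlDr; apply: (@le_trans _ _ (stage_count (tr z N) + 0)).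
    by rewrite addr0.
  apply: lerD; last by [].
  by apply: ler_sum => k _; rewrite lerBlDr lerDl.
elim: N => [|N IH].
  rewrite /busy_steps big_ord0 /stage_count /blocked /trajectory /= subr0 sumr_ge0//.
rewrite busy_stepsS; case h: (halted (tr z N)).
  by rewrite halted_tr// /busy /is_idle (halted_idle h) addr0.
have := stage_step (szin z) (cin z) (ddin z) i0 (sound_tr i0 z N).
rewrite -running_tr// => ->; apply: lerD => //.
by rewrite /busy; case: (~~ _).
Qed.

Lemma npause_le z N k : (npause (tr z N) k)%:R <= (nresume (tr z N) k)%:R + 1 :> R.
Proof.
have [_ _ hb] := sound_tr i0 z N; rewrite natr1 ler_nat hb -addn1.
by rewrite leq_add2l; case: (_ && _).
Qed.

(** The top class contributes no overhead, so the means of its pauses and resumes stay out of the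
    bounds. *)
Lemma no_pause_top z N k : (k : nat) = 0%N ->
  npause (tr z N) k = 0%N /\ nresume (tr z N) k = 0%N.
Proof.
move=> k0; have [hc _ hb] := sound_tr i0 z N.
have := con_low hc k; rewrite k0 orbF => /eqP p0; split => //.
by apply/eqP; have := hb k; rewrite p0 => /esym/eqP; rewrite addn_eq0 => /andP[].
Qed.

Lemma survival_le1 (L : R) k z j : 0 <= L -> 0 <= survival L k (tr z j) <= 1.
Proof.
move=> L0; have [_ ho _] := sound_tr i0 z j; move: ho; rewrite /survival /activity_ok.
case: (cur _) => [|j'|j' u|j' u b]; rewrite ?lexx ?ler01// => -[_ u0].
case: b; rewrite ?lexx ?ler01//; case: eqP => _; rewrite ?lexx ?ler01//.
by rewrite expR_ge0 -expR0 ler_expR mulNr oppr_le0 mulr_ge0 ?subr_ge0.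
Qed.

Lemma now_step_le z j e : act_end (tr z j) = Some e -> now (tr z j.+1) <= e.
Proof.
move=> ee; have [h|h] := boolP (halted (tr z j)).
  by move: ee; rewrite /act_end (halted_idle h).
rewrite running_tr; last exact: negbTE.
case: (stepP (xin z) (szin z) (cin z) (ddin z) i0) => [i t _ _ te _|e' ee' _].
  by rewrite now_arrive /= ltW// te.
by rewrite now_complete /=; move: ee'; rewrite ee => -[->].
Qed.

(** A step never passes the end of the current activity, where the survival of an unfailed resume
    would be 1. The gain is thus at most 1 per step and has a finite mean. *)
Lemma survival_lag_le1 (L : R) k z j : 0 <= L ->
  survival L k (tr z j) * expR (L * lag z j) <= 1.
Proof.
move=> L0; have le := @now_step_le z j; move: le; rewrite /survival /act_end.
case: (cur _) => [|j'|j' u|j' u b] le; rewrite ?mul0r ?ler01//.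
case: b le => le; rewrite ?mul0r ?ler01//; case: eqP => _; rewrite ?mul0r ?ler01//.
rewrite -expRD -expR0 ler_expR /lag.
rewrite (_ : _ + _ = - (L * (u - now (tr z j.+1)))); last by ring.
by rewrite oppr_le0 mulr_ge0// subr_ge0 le.
Qed.

End QueuePaths.

(** * Expectations in the queue *)

Section ExpectationTools.
Context d (T : measurableType d) (R : realType) (Q : probability T R).
Local Open Scope ereal_scope.

(** Monotone convergence for a function that is, at almost every point, dominated by some [g N]. It
    serves for truncated exponential times, the completion of an isolated job and the emptying
    time. *)
Lemma integral_exhaustion_le (f : T -> \bar R) (g : nat -> T -> R) (K : \bar R) :
  measurable_fun setT f -> (forall z, 0 <= f z) -> (forall N, nnmeas (g N)) ->
  (forall z m N, (m <= N)%N -> (g m z <= g N z)%R) ->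
  {ae Q, forall z, exists N, f z <= (g N z)%:E} -> (forall N, Ex Q (g N) <= K) ->
  \int[Q]_z f z <= K.
Proof.
move=> mf f0 ng gmono fg gK.
have mg N : measurable_fun setT (fun z => (g N z)%:E).
  by apply/measurable_EFinP; exact: (ng N).1.
have g0 N z : setT z -> 0 <= (g N z)%:E by move=> _; rewrite lee_fin (ng N).2.
have ndg z : setT z -> {homo (fun N => (g N z)%:E) : m N / (m <= N)%N >-> m <= N}.
  by move=> _ m N mN; rewrite lee_fin gmono.
have glim z N : (g N z)%:E <= limn (fun N => (g N z)%:E).
  rewrite (cvg_lim _ (ereal_nondecreasing_cvgn (ndg z I)))//.
  by apply: ereal_sup_ubound; exists N.
apply: (@le_trans _ _ (\int[Q]_z limn (fun N => (g N z)%:E))).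
  apply: ae_ge0_le_integral => //.
  - by move=> z _; apply: le_trans (glim z 0%N); exact: g0.
  - apply: (emeasurable_fun_cvg (fun N z => (g N z)%:E)) => // z _.
    by apply: ereal_nondecreasing_is_cvgn; exact: ndg.
  - by apply: filterS fg => z [N fN] _; apply: le_trans fN (glim z N).
rewrite monotone_convergence//; apply: lime_le.
  apply: ereal_nondecreasing_is_cvgn => m N mN; apply: ge0_le_integral => //.
  - by move=> z _; exact: g0.
  - by move=> z _; exact: ndg.
by near=> N; exact: gK.
Unshelve. all: by end_near. Qed.

Lemma Ex_gt0 (f : T -> R) : measurable_fun setT f -> (forall z, 0 < f z)%R -> 0 < Ex Q f.
Proof.
move=> mf f0; rewrite lt0e Ex_ge0 ?andbT; last by move=> z; rewrite ltW.
apply/eqP => e.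
have mE : measurable_fun setT (EFin \o f) by exact/measurable_EFinP.
have /(ae_eq_integral_abs Q measurableT mE)[A [mA A0 sA]] :
    \int[Q]_z `|(EFin \o f) z| = 0.
  rewrite -e; apply: eq_integral => z _.
  by rewrite /= ger0_norm// ltW.
have : Q setT <= Q A.
  apply: le_measure; rewrite ?inE// => z _; apply: sA => /= /(_ I) [f00].
  by have := f0 z; rewrite f00 ltxx.
by rewrite A0 (_ : Q setT = 1) ?lee_fin ?ler10//; exact: probability_setT.
Qed.

End ExpectationTools.

Section RaceFunctions.
Context {R : realType}.
Implicit Types lam L t : R.

Lemma is_derive_exp_gain lam L t : L != 0 ->
  is_derive t 1 (fun t => lam / L * (expR (L * t) - 1)) (lam * expR (L * t)).
Proof.
move=> L0.
have h := is_deriveZ (lam / L) (is_deriveB (is_derive_expRM L t) (is_derive_cst (1 : R) t 1)).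
apply: (is_derive_eq h).
by rewrite /GRing.scale /= subr0; field.
Qed.

End RaceFunctions.

Section InputLaws.
Context {R : realType} {n : nat}.
Notation Z := (@inputsp R (@tagT n)).
Variables (Q : probability Z R) (lam : 'I_n -> R).

Record input_law : Prop := InputLaw {
  law_indep : mutually_independent Q (fun i (z : Z) => z i);
  law_arrival : forall i m A, measurable A ->
    Q ((fun z : Z => z (false, false, i, m)) @^-1` A) = exponential_prob (lam i) A;
  law_copy : forall a b i m A, measurable A ->
    Q ((fun z : Z => z (a, b, i, m)) @^-1` A) =
    Q ((fun z : Z => z (a, b, i, 0%N)) @^-1` A) }.

Hypothesis lam_gt0 : forall i, 0 < lam i.
Hypothesis LQ : input_law.

Lemma Ex_copy a b i m (h : R -> R) : measurable_fun setT h -> (forall v, 0 <= h v) ->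
  Ex Q (fun z => h (z (a, b, i, m))) = Ex Q (fun z => h (z (a, b, i, 0%N))).
Proof.
move=> mh h0.
have push l : Ex Q (fun z => h (z (a, b, i, l))) =
    (\int[measure_function_pushforward__canonical__measure_function_Measure Q
      (measurable_coord ((a, b, i, l) : @tagT n))]_v (h v)%:E)%E.
  rewrite ge0_integral_pushforward//=; last by move=> v _; rewrite lee_fin.
    exact: measurable_coord.
  by apply/measurable_EFinP.
rewrite !push; apply: eq_measure_integral => A mA _.
exact: law_copy.
Qed.

(** The race from 0 against the deadline [b] with [f = 1] reads [lam * E[min(X, b)] = P(0 < X < b)
    <= 1]; then [b] grows. The added 1 pays for the value by which [pos] replaces nonpositive
    inputs. *)
Lemma Ex_interarrival_le i : (Ex Q (fun z => xin z i 0) <= ((lam i)^-1 + 1)%:E)%E.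
Proof.
pose p (v : R) : R := if 0 < v then v else 0.
pose pb (b : nat) (v : R) : R := if 0 < v then Num.min v b%:R else 0.
have mp : measurable_fun setT p.
  apply: measurable_fun_ifT; [|exact: measurable_id|exact: measurable_cst].
  exact: measurable_fun_ltr.
have mpb b : measurable_fun setT (pb b).
  apply: measurable_fun_ifT; last exact: measurable_cst.
    exact: measurable_fun_ltr.
  exact: measurable_minr.
have p0 v : 0 <= p v by rewrite /p; case: ltP => // /ltW.
have pb0 b v : 0 <= pb b v by rewrite /pb; case: ltP => // /ltW v0; rewrite le_min v0 ler0n.
pose t : @tagT n := (false, false, i, 0%N).
have mcoord : measurable_fun setT (fun z : Z => z t) by exact: measurable_coord.
have nnp : nnmeas (fun z : Z => p (z t)) by split => //; exact: measurableT_comp.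
have nnpb b : nnmeas (fun z : Z => pb b (z t)) by split => //; exact: measurableT_comp.
have boundb b : (Ex Q (fun z => pb b (z t)) <= ((lam i)^-1)%:E)%E.
  have : (Ex Q (fun z => lam i * pb b (z t))%R <= 1)%E.
    pose h1 (v : R) : R := ((0 < v) && (v < b%:R))%:R.
    have mh1 : measurable_fun setT h1.
      rewrite (_ : h1 = \1_(`]0, b%:R[)); first exact: measurable_indic.
      by apply/funext => v; rewrite indicE mem_setE in_itv.
    pose mco : measurable_fun setT (fun z : Z => z t : measurableTypeR R) := mcoord.
    pose mu := measure_function_pushforward__canonical__measure_function_Measure Q mco.
    have push (h : R -> R) : measurable_fun setT h -> (forall v, 0 <= h v) ->
        Ex Q (fun z => h (z t)) = (\int[mu]_v (h v)%:E)%E.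
      move=> mh h0; rewrite ge0_integral_pushforward//=.
        by apply/measurable_EFinP.
      by move=> v _; rewrite lee_fin.
    have mlp : measurable_fun setT (fun v => lam i * pb b v).
      by apply: measurable_funM => //; exact: measurable_cst.
    rewrite (push (fun v => lam i * pb b v)) => //; last first.
      by move=> v; rewrite mulr_ge0// ltW.
    rewrite -(@integral_exponential_race _ _ (lam_gt0 i) (fun=> 1) (fun t => lam i * t)
      0 b%:R _ _ _ _ _ mu _ (fun v => (h1 v)%:E)) => //.
    - rewrite -push//.
      rewrite -(Ex_cst Q 1); apply: Ex_le.
      + by split => [|z]; [exact: measurableT_comp|exact: ler0n].
      + exact: nnmeas_cst.
      + by move=> z; rewrite /h1; case: (_ && _).
    - by move=> v; exact: cst_continuous.
    - by rewrite mulr0.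
    - by move=> v v0; rewrite mulr_ge0// ltW.
    - by move=> A mA; exact: law_arrival.
    - exact/measurable_EFinP.
    - exact/measurable_EFinP.
    - by move=> v; rewrite lee_fin ler0n.
    - by move=> v; rewrite lee_fin mulr_ge0// ltW.
    - by move=> v /andP[h3 h4]; have := lt_trans h3 h4; rewrite ltxx.
    - move=> v /[dup] vb /andP[v0 v1]; rewrite /h1 /pb vb v0 subr0; split => //.
      by rewrite (min_idPl (ltW v1)).
    - move=> v bv; have v0 : 0 < v by exact: le_lt_trans bv.
      by rewrite /h1 /pb v0 subr0 ltNge (ltW bv) (min_idPr (ltW bv)).
  rewrite (ExZ _ (ltW (lam_gt0 i)))// => h.
  have := lee_wpmul2l (_ : 0 <= ((lam i)^-1)%:E)%E h; rewrite mule1 muleA -EFinM.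
  by rewrite mulVf ?gt_eqF// mul1e; apply; rewrite lee_fin invr_ge0 ltW.
have pbound : (Ex Q (fun z => p (z t)) <= ((lam i)^-1)%:E)%E.
  apply: (@integral_exhaustion_le _ _ _ Q (fun z => (p (z t))%:E)
    (fun b z => pb b (z t))) => //.
  - by apply/measurable_EFinP; exact: nnp.1.
  - by move=> z; rewrite lee_fin.
  - move=> z b b' bb'; rewrite /pb; case: ifP => // _.
    by rewrite le_min !ge_min lexx /= ler_nat bb' orbT.
  (* Truncation at an integer above the value changes nothing. *)
  - apply: aeW => z; exists (Num.truncn (z t)).+1; rewrite lee_fin /p /pb.
    case: ltP => // v0; rewrite le_min lexx /= ltW//.
    by have /andP[] := truncn_itv (ltW v0).
apply: (@le_trans _ _ (Ex Q (fun z => p (z t) + 1)%R)).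
  apply: Ex_le.
  - by split => [|z]; [exact: measurable_xin|rewrite ltW ?xin_gt0].
  - by apply: (nnmeasD nnp); apply: nnmeas_cst.
  - by move=> z; rewrite /xin /pos /p; case: ifP => _; rewrite ?add0r// lerDl.
rewrite (ExD Q nnp (nnmeas_cst _ _))//.
by rewrite Ex_cst EFinD leeD2r.
Qed.

End InputLaws.

Section QueueExpectations.
Context {R : realType} {n : nat}.
Notation Z := (@inputsp R (@tagT n)).
Variables (Q : probability Z R) (lam : 'I_n -> R).
Hypothesis lam_gt0 : forall i, 0 < lam i.
Hypothesis LQ : input_law Q lam.
Variable i0 : 'I_n.
Notation tr := (trajectory qstep (fun=> init R n)).
Implicit Types (z : Z) (i k : 'I_n) (N j : nat).

Definition higher_rate k : R := \sum_(i < n | (i < k)%N) lam i.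

Lemma higher_rate_ge0 k : 0 <= higher_rate k.
Proof. by apply: sumr_ge0 => i _; exact: ltW. Qed.

Lemma higher_rate_gt0 k : (0 < k)%N -> 0 < higher_rate k.
Proof.
move=> k0; have n0 : (0 < n)%N by apply: leq_ltn_trans (ltn_ord k).
rewrite /higher_rate (bigD1 (Ordinal n0))//= ltr_pwDl// sumr_ge0// => i _.
exact: ltW.
Qed.

(** The weight [g] must vanish on idle states, which offer no deadline for the race. *)
Lemma queue_compensator i (g : state R n -> R) (f F : R -> R) j :
  (forall s, g s != 0 -> cur s <> Idle R n) -> (forall s, 0 <= g s) ->
  (forall j, measurable_fun setT (fun z => g (tr z j))) ->
  continuous f -> (forall t : R, is_derive t 1 F (lam i * f t)) ->
  F 0 = 0 -> (forall t, 0 <= t -> 0 <= f t) -> (forall t, 0 <= t -> 0 <= F t) ->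
  Ex Q (fun z => g (tr z j) *
    (((narr (tr z j.+1) i)%:R - (narr (tr z j) i)%:R) * f (lag z j))) =
  Ex Q (fun z => g (tr z j) * F (lag z j)).
Proof.
move=> gb g0 mg cf dF F0 f0 FF0.
apply: (@compensator _ _ _ qstep (fun=> init R n) (arrival_tag i) pos
  (fun s => narr s i) (@now R n) g _ _ _ _ _ _ _ _ _ _ _ Q (lam i)) => //.
- by move=> a b [].
- exact: pos_id.
- by move=> m z z' s; exact: qstep_before.
- by move=> m z z' s; exact: qstep_alt.
- by move=> m z s nm /gb; exact: qstep_race.
- by move=> z s; exact: narr_counter.1.
- by move=> z l; exact: clock_mono_tr.
- by move=> z l; exact: epoch_le_clock.
- by move=> z l; exact: clock_le_epoch.
- exact: law_indep LQ.
- by move=> m A mA; exact: law_arrival LQ _ _ _ mA.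
- by move=> z l; exact: narr_counter.2.
- by move=> l; exact: measurable_narr.
- by move=> l; exact: measurable_now.
Qed.

Lemma measurable_lag j : measurable_fun setT (fun z => lag z j).
Proof. by apply: measurable_funB; exact: measurable_now. Qed.

Lemma nnmeas_lag j : nnmeas (fun z => lag z j).
Proof. by split; [exact: measurable_lag|move=> z; exact: lag_ge0]. Qed.

Definition jump i z j : R := (narr (tr z j.+1) i)%:R - (narr (tr z j) i)%:R.

Lemma nnmeas_jump i j : nnmeas (fun z => jump i z j).
Proof.
split; first by apply: measurable_funB; exact: measurable_narr.
by move=> z; rewrite subr_ge0 ler_nat trajectoryS; exact: narr_counter.1.
Qed.

Lemma hits_jump z j k :
  hits (tr z j) (tr z j.+1) k = \sum_(i < n | (i < k)%N) jump i z j.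
Proof. by []. Qed.

Lemma nnmeas_hits k j : nnmeas (fun z => hits (tr z j) (tr z j.+1) k).
Proof. by apply: nnmeas_sum => i; exact: nnmeas_jump. Qed.

(** Compensation with [f = 1] and [F t = lam i * t]. *)
Lemma Ex_jump i (g : state R n -> R) j :
  (forall s, g s != 0 -> cur s <> Idle R n) -> (forall s, 0 <= g s) ->
  (forall j, measurable_fun setT (fun z => g (tr z j))) ->
  Ex Q (fun z => g (tr z j) * jump i z j) =
  ((lam i)%:E * Ex Q (fun z => g (tr z j) * lag z j)%R)%E.
Proof.
move=> gb g0 mg.
transitivity (Ex Q (fun z => g (tr z j) * (jump i z j * 1))).
  by apply: Ex_eq => z; rewrite mulr1.
rewrite (@queue_compensator i g (fun=> 1) (fun t => lam i * t) j)//.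
- rewrite -ExZ ?ltW//; last first.
    by apply: nnmeasM; [split|exact: nnmeas_lag].
  by apply: Ex_eq => z; rewrite mulrCA.
- by move=> t; exact: cst_continuous.
- by rewrite mulr0.
- by move=> t t0; rewrite mulr_ge0// ltW.
Qed.

Lemma Ex_hits k (g : state R n -> R) j :
  (forall s, g s != 0 -> cur s <> Idle R n) -> (forall s, 0 <= g s) ->
  (forall j, measurable_fun setT (fun z => g (tr z j))) ->
  Ex Q (fun z => g (tr z j) * hits (tr z j) (tr z j.+1) k) =
  ((higher_rate k)%:E * Ex Q (fun z => g (tr z j) * lag z j)%R)%E.
Proof.
move=> gb g0 mg.
have nng : nnmeas (fun z => g (tr z j)) by split.
transitivity (Ex Q (fun z => \sum_(i < n | (i < k)%N) g (tr z j) * jump i z j)).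
  by apply: Ex_eq => z; rewrite hits_jump mulr_sumr.
rewrite Ex_sum => [|i]; last by apply: nnmeasM => //; exact: nnmeas_jump.
under eq_bigr do rewrite Ex_jump//.
rewrite -ge0_sume_distrl => [|i _]; last by rewrite lee_fin ltW.
by rewrite sumEFin.
Qed.

(** For class [i], [f t = exp (L t)] has the compensator [lam i / L * (exp (L t) - 1)]; as [L] is
    the sum of [lam i] over [i < k], the weights [lam i / L] add up to 1. *)
Lemma Ex_survival k j :
  Ex Q (fun z => survival (higher_rate k) k (tr z j) *
    (hits (tr z j) (tr z j.+1) k * expR (higher_rate k * lag z j))) =
  Ex Q (fun z => survival (higher_rate k) k (tr z j) *
    (expR (higher_rate k * lag z j) - 1)).
Proof.
set L := higher_rate k.
(* The top class has [L = 0], which forbids the division; both sides are then 0. *)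
have [k0|k_gt0] := posnP k.
  apply: Ex_eq => z; rewrite hits_jump big_pred0 => [|i]; last by rewrite k0.
  by rewrite /L /higher_rate big_pred0 ?mul0r ?expR0 ?subrr// => i; rewrite k0.
have L0 : 0 < L by exact: higher_rate_gt0.
have g0 s : 0 <= survival L k s.
  by rewrite /survival; case: cur => // ? ? []//; case: eqP => // *; exact: expR_ge0.
have gb s : survival L k s != 0 -> cur s <> Idle R n.
  by rewrite /survival; case: cur => //; rewrite eqxx.
have mg l : measurable_fun setT (fun z => survival L k (tr z l)).
  exact: measurable_survival.
have nng : nnmeas (fun z => survival L k (tr z j)) by split.
have mexp : measurable_fun setT (fun z => expR (L * lag z j)).
  apply: measurableT_comp => //; apply: measurable_funM; first exact: measurable_cst.
  exact: measurable_lag.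
have nne : nnmeas (fun z => expR (L * lag z j)) by split => // z; exact: expR_ge0.
transitivity (Ex Q (fun z => \sum_(i < n | (i < k)%N)
    survival L k (tr z j) * (jump i z j * expR (L * lag z j)))).
  by apply: Ex_eq => z; rewrite hits_jump mulr_suml mulr_sumr.
rewrite Ex_sum => [|i]; last first.
  by apply: nnmeasM => //; apply: nnmeasM => //; exact: nnmeas_jump.
have gain0 i t : 0 <= t -> 0 <= lam i / L * (expR (L * t) - 1).
  move=> t0; apply: mulr_ge0; first by rewrite divr_ge0// ltW.
  by rewrite subr_ge0 -expR0 ler_expR mulr_ge0// ltW.
transitivity (\sum_(i < n | (i < k)%N)
    Ex Q (fun z => survival L k (tr z j) * (lam i / L * (expR (L * lag z j) - 1)))%R)%E.
  apply: eq_bigr => i _.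
  have dF (t : R) : is_derive t 1 (fun t => lam i / L * (expR (L * t) - 1))
      (lam i * expR (L * t)).
    by apply: is_derive_exp_gain; rewrite gt_eqF.
  apply: (@queue_compensator i (survival L k) (fun t => expR (L * t)) _ j gb g0 mg _ dF).
  - exact: continuous_expRM.
  - by rewrite mulr0 expR0 subrr mulr0.
  - by move=> t _; exact: expR_ge0.
  - exact: gain0.
rewrite -Ex_sum => [|i]; last first.
  apply: nnmeasM => //; split; last by move=> z; apply: gain0; exact: lag_ge0.
  apply: measurable_funM; first exact: measurable_cst.
  by apply: measurable_funB => //; exact: measurable_cst.
apply: Ex_eq => z; rewrite -mulr_sumr -mulr_suml -mulr_suml -/L divff ?gt_eqF//.
by rewrite mul1r.
Qed.

(** Arrivals at a busy server compensate to [lam i] times the busy time; the opening arrival gives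
    the 1. *)
Lemma Ex_narr_le i N :
  (Ex Q (fun z => (narr (tr z N) i)%:R) <=
   1 + (lam i)%:E * Ex Q (fun z => busy_time z N))%E.
Proof.
have nnb j : nnmeas (fun z => busy (tr z j)).
  by split; [exact: measurable_busy|move=> z; exact: ler0n].
have nna : nnmeas (fun z => arrivals i z N).
  by apply: nnmeas_sum => j; apply: nnmeasM => //; exact: nnmeas_jump.
apply: (@le_trans _ _ (Ex Q (fun z => 1 + arrivals i z N)%R)).
  apply: Ex_le.
  - by split => [|z]; [exact: measurable_narr|exact: ler0n].
  - by apply: nnmeasD => //; apply: nnmeas_cst.
  - by move=> z; exact: narr_le.
rewrite (ExD Q (nnmeas_cst Z ler01) nna).
rewrite Ex_cst leeD2l// /arrivals Ex_sum => [|j]; last first.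
  by apply: nnmeasM => //; exact: nnmeas_jump.
rewrite /busy_time Ex_sum => [|j]; last by apply: nnmeasM => //; exact: nnmeas_lag.
rewrite ge0_sume_distrr => [|j _]; last first.
  by apply: Ex_ge0 => z; rewrite mulr_ge0 ?(nnb _).2 ?lag_ge0.
apply: lee_sum => j _; rewrite -Ex_jump//.
- by move=> s; rewrite /busy /is_idle; case: cur => //; rewrite eqxx.
- by move=> l; exact: measurable_busy.
Qed.

Lemma nnmeas_serving k j : nnmeas (fun z => (serving k (tr z j))%:R : R).
Proof. by split; [exact: measurable_serving|move=> z; exact: ler0n]. Qed.

Lemma nnmeas_served k N : nnmeas (fun z => served k z N).
Proof.
by apply: nnmeas_sum => j; apply: nnmeasM; [exact: nnmeas_serving|exact: nnmeas_lag].
Qed.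

Lemma Ex_preempted k N : Ex Q (fun z => preempted k z N) =
  ((higher_rate k)%:E * Ex Q (fun z => served k z N))%E.
Proof.
rewrite /preempted Ex_sum => [|j]; last first.
  by apply: nnmeasM; [exact: nnmeas_serving|exact: nnmeas_hits].
rewrite /served Ex_sum => [|j]; last first.
  by apply: nnmeasM; [exact: nnmeas_serving|exact: nnmeas_lag].
rewrite ge0_sume_distrr => [|j _]; last first.
  by apply: Ex_ge0 => z; rewrite mulr_ge0 ?(nnmeas_serving _ _).2 ?lag_ge0.
apply: eq_bigr => j _.
rewrite (Ex_hits k (g := fun s => (serving k s)%:R))//.
- by move=> s; rewrite /serving; case: cur => //; rewrite eqxx.
- by move=> l; exact: measurable_serving.
Qed.

Lemma wald_size k N (h : R -> R) : measurable_fun setT h -> (forall v, 0 <= h v) ->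
  Ex Q (fun z => \sum_(m < narr (tr z N) k) h (z (false, true, k, m : nat))) =
  (Ex Q (fun z => (narr (tr z N) k)%:R) * Ex Q (fun z => h (z (false, true, k, 0%N))))%E.
Proof.
move=> mh h0; apply: (@wald _ _ _ qstep (fun=> init R n) Q (law_indep LQ)
  (fun s => narr s k) (fun m => (false, true, k, m))) => //.
- by move=> m z z' s; exact: qstep_size_dep.
- by move=> z s; exact: narr_counter.1.
- by move=> z j; exact: narr_counter.2.
- by move=> j; exact: measurable_narr.
- by move=> m; exact: (Ex_copy LQ).
Qed.

Lemma wald_pause k N (h : R -> R) : measurable_fun setT h -> (forall v, 0 <= h v) ->
  Ex Q (fun z => \sum_(m < npause (tr z N) k) h (z (true, false, k, m : nat))) =
  (Ex Q (fun z => (npause (tr z N) k)%:R) * Ex Q (fun z => h (z (true, false, k, 0%N))))%E.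
Proof.
move=> mh h0; apply: (@wald _ _ _ qstep (fun=> init R n) Q (law_indep LQ)
  (fun s => npause s k) (fun m => (true, false, k, m))) => //.
- by move=> m z z' s; exact: qstep_pause_dep.
- by move=> z s; exact: npause_counter.1.
- by move=> z j; exact: npause_counter.2.
- by move=> j; exact: measurable_npause.
- by move=> m; exact: (Ex_copy LQ).
Qed.

Lemma wald_resume k N (h : R -> R) : measurable_fun setT h -> (forall v, 0 <= h v) ->
  Ex Q (fun z => \sum_(m < nresume (tr z N) k) h (z (true, true, k, m : nat))) =
  (Ex Q (fun z => (nresume (tr z N) k)%:R) * Ex Q (fun z => h (z (true, true, k, 0%N))))%E.
Proof.
move=> mh h0; apply: (@wald _ _ _ qstep (fun=> init R n) Q (law_indep LQ)
  (fun s => nresume s k) (fun m => (true, true, k, m))) => //.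
- by move=> m z z' s; exact: qstep_resume_dep.
- by move=> z s; exact: nresume_counter.1.
- by move=> z j; exact: nresume_counter.2.
- by move=> j; exact: measurable_nresume.
- by move=> m; exact: (Ex_copy LQ).
Qed.

(** Its mean is the probability [q_k] that no higher-priority arrival falls into a class-k
    resume. *)
Definition discount k z : R := expR (- higher_rate k * ddin z k 0).

(** Expectation of [resume_balance]: gain and loss cancel, Wald turns the discounts into the left
    side, [paused] is dropped and the current survival is at most 1. *)
Lemma Ex_nresume_le k N :
  (Ex Q (fun z => (nresume (tr z N) k)%:R) * Ex Q (discount k) <=
   Ex Q (fun z => preempted k z N) + 1)%E.
Proof.
set L := higher_rate k.
pose h v : R := expR (- L * nonneg v).
have mh : measurable_fun setT h.
  apply: measurableT_comp => //; apply: measurable_funM; first exact: measurable_cst.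
  exact: measurable_nonneg.
have h0 v : 0 <= h v by exact: expR_ge0.
rewrite -(wald_resume k N mh h0) -/L.
have L0 : 0 <= L by exact: higher_rate_ge0.
have nnsv j : nnmeas (fun z => survival L k (tr z j)).
  split; first exact: measurable_survival.
  by move=> z; have /andP[] := survival_le1 i0 k z j L0.
have nngain : nnmeas (fun z => survival_gain L k z N).
  apply: nnmeas_sum => j; apply: nnmeasM => //; split.
    apply: measurable_funB; last exact: measurable_cst.
    apply: measurableT_comp => //; apply: measurable_funM; first exact: measurable_cst.
    exact: measurable_lag.
  by move=> z; rewrite subr_ge0 -expR0 ler_expR mulr_ge0// lag_ge0.
have nnexp j : nnmeas (fun z => expR (L * lag z j)).
  split; last by move=> z; exact: expR_ge0.
  apply: measurableT_comp => //; apply: measurable_funM; first exact: measurable_cst.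
  exact: measurable_lag.
have nnloss : nnmeas (fun z => survival_loss L k z N).
  apply: nnmeas_sum => j; apply: nnmeasM => //; apply: nnmeasM => //.
  exact: nnmeas_hits.
have nnpre : nnmeas (fun z => preempted k z N).
  by apply: nnmeas_sum => j; apply: nnmeasM; [exact: nnmeas_serving|exact: nnmeas_hits].
have nnpz : nnmeas (fun z => (paused (tr z N) k)%:R : R).
  by split; [exact: measurable_paused|move=> z; exact: ler0n].
have nndis : nnmeas (fun z => \sum_(m < nresume (tr z N) k) h (z (true, true, k, m : nat))).
  apply: (@nnmeas_counter_sum _ _ _ qstep (fun=> init R n) (fun s => nresume s k)
    (fun m => (true, true, k, m))) => //.
    by move=> z j; exact: nresume_counter.2.
  by move=> j; exact: measurable_nresume.
have gainloss : Ex Q (fun z => survival_loss L k z N) = Ex Q (fun z => survival_gain L k z N).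
  rewrite /survival_loss /survival_gain Ex_sum => [|j]; last first.
    by apply: nnmeasM => //; apply: nnmeasM => //; exact: nnmeas_hits.
  rewrite Ex_sum => [|j]; first by apply: eq_bigr => j _; exact: Ex_survival.
  apply: nnmeasM => //; split.
    by apply: measurable_funB; [exact: (nnexp j).1|exact: measurable_cst].
  by move=> z; rewrite subr_ge0 -expR0 ler_expR mulr_ge0// lag_ge0.
(* The mean gain appears on both sides; being at most [N], it can be cancelled. *)
have gain_fin : Ex Q (fun z => survival_gain L k z N) \is a fin_num.
  rewrite /survival_gain; apply: (@Ex_fin _ _ _ Q _ N%:R) => // z.
  apply: (@le_trans _ _ (\sum_(j < N) 1)); last by rewrite sumr_const card_ord.
  apply: ler_sum => j _; rewrite mulrBr mulr1.
  rewrite lerBlDr (le_trans (survival_lag_le1 i0 k z j L0))// lerDl.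
  exact: (nnsv j).2.
have e : (Ex Q (fun z => preempted k z N) + Ex Q (fun z => survival L k (tr z N)) +
    Ex Q (fun z => survival_gain L k z N) =
    Ex Q (fun z => \sum_(m < nresume (tr z N) k) h (z (true, true, k, m : nat)))%R +
    Ex Q (fun z => survival_gain L k z N) +
    Ex Q (fun z => (paused (tr z N) k)%:R))%E.
  rewrite -{1}gainloss -!ExD//; last 2 first.
  - exact: nnmeasD.
  - exact: nnmeasD.
  by apply: Ex_eq => z; exact: (resume_balance i0).
have e2 : (Ex Q (fun z => \sum_(m < nresume (tr z N) k) h (z (true, true, k, m : nat)))%R <=
    Ex Q (fun z => preempted k z N) + Ex Q (fun z => survival L k (tr z N)))%E.
  rewrite -(leeD2rE _ _ gain_fin) e leeDl//.
  by apply: Ex_ge0 => z; exact: ler0n.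
apply: le_trans e2 _; apply: leeD2l.
rewrite -(Ex_cst Q 1); apply: Ex_le => //.
by move=> z; have /andP[] := survival_le1 i0 k z N L0.
Qed.

End QueueExpectations.

(** * The linear inequality for the mean busy time *)

Section QueueBound.
Context {R : realType} {n : nat}.
Notation Z := (@inputsp R (@tagT n)).
Variables (Q : probability Z R) (lam : 'I_n -> R).
Hypothesis lam_gt0 : forall i, 0 < lam i.
Hypothesis LQ : input_law Q lam.
Variable i0 : 'I_n.
Notation tr := (trajectory qstep (fun=> init R n)).
Implicit Types (z : Z) (i k : 'I_n) (N j : nat).
Variables (a mc md q : 'I_n -> R).
Hypothesis aE : forall k, Ex Q (fun z => szin z k 0) = (a k)%:E.
Hypothesis mcE : forall k, (0 < k)%N -> Ex Q (fun z => cin z k 0) = (mc k)%:E.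
Hypothesis mdE : forall k, (0 < k)%N -> Ex Q (fun z => ddin z k 0) = (md k)%:E.
Hypothesis qE : forall k, Ex Q (discount lam k) = (q k)%:E.
Hypothesis q_gt0 : forall k, 0 < q k.

Lemma a_ge0 k : 0 <= a k.
Proof. by rewrite -lee_fin -aE Ex_ge0// => z; rewrite ltW ?szin_gt0. Qed.

Lemma mc_ge0 k : (0 < k)%N -> 0 <= mc k.
Proof. by move=> k0; rewrite -lee_fin -mcE// Ex_ge0// => z; exact: cin_ge0. Qed.

Lemma md_ge0 k : (0 < k)%N -> 0 <= md k.
Proof. by move=> k0; rewrite -lee_fin -mdE// Ex_ge0// => z; exact: ddin_ge0. Qed.

Definition mean_counter (cnt : state R n -> 'I_n -> nat) k N : R :=
  fine (Ex Q (fun z => (cnt (tr z N) k)%:R)).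

Lemma mean_counterE (cnt : state R n -> 'I_n -> nat) k N :
  measurable_fun setT (fun z => (cnt (tr z N) k)%:R : R) ->
  (forall z, cnt (tr z N) k <= N)%N ->
  Ex Q (fun z => (cnt (tr z N) k)%:R) = (mean_counter cnt k N)%:E.
Proof.
move=> mcnt cN; rewrite /mean_counter fineK// (@Ex_fin _ _ _ Q _ N%:R)//.
by move=> z; rewrite ler_nat.
Qed.

Let mnarr k N := mean_counter (@narr R n) k N.
Let mnpause k N := mean_counter (@npause R n) k N.
Let mnresume k N := mean_counter (@nresume R n) k N.

Lemma mnarrE k N : Ex Q (fun z => (narr (tr z N) k)%:R) = (mnarr k N)%:E.
Proof. by apply: mean_counterE; [exact: measurable_narr|move=> z; exact: narr_counter.2]. Qed.
Lemma mnpauseE k N : Ex Q (fun z => (npause (tr z N) k)%:R) = (mnpause k N)%:E.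
Proof. by apply: mean_counterE; [exact: measurable_npause|move=> z; exact: npause_counter.2]. Qed.
Lemma mnresumeE k N : Ex Q (fun z => (nresume (tr z N) k)%:R) = (mnresume k N)%:E.
Proof. by apply: mean_counterE; [exact: measurable_nresume|move=> z; exact: nresume_counter.2]. Qed.

Lemma Ex_admitted k N :
  Ex Q (fun z => admitted (szin z) (tr z N) k) = (mnarr k N * a k)%:E.
Proof.
rewrite EFinM -mnarrE -aE; apply: (wald_size LQ k N measurable_pos) => v.
exact/ltW/pos_gt0.
Qed.

Lemma nnmeas_admitted k N : nnmeas (fun z => admitted (szin z) (tr z N) k).
Proof.
apply: (@nnmeas_counter_sum _ _ _ qstep (fun=> init R n) (fun s => narr s k)
  (fun m => (false, true, k, m)) pos).
- by move=> z j; exact: narr_counter.2.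
- by move=> j; exact: measurable_narr.
- exact: measurable_pos.
- by move=> v; exact/ltW/pos_gt0.
Qed.

Definition pause_sum k z N : R := \sum_(m < npause (tr z N) k) cin z k m.
Definition resume_sum k z N : R := \sum_(m < nresume (tr z N) k) ddin z k m.

Lemma nnmeas_pause_sum k N : nnmeas (fun z => pause_sum k z N).
Proof.
apply: (@nnmeas_counter_sum _ _ _ qstep (fun=> init R n) (fun s => npause s k)
  (fun m => (true, false, k, m)) nonneg).
- by move=> z j; exact: npause_counter.2.
- by move=> j; exact: measurable_npause.
- exact: measurable_nonneg.
- exact: nonneg_ge0.
Qed.

Lemma nnmeas_resume_sum k N : nnmeas (fun z => resume_sum k z N).
Proof.
apply: (@nnmeas_counter_sum _ _ _ qstep (fun=> init R n) (fun s => nresume s k)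
  (fun m => (true, true, k, m)) nonneg).
- by move=> z j; exact: nresume_counter.2.
- by move=> j; exact: measurable_nresume.
- exact: measurable_nonneg.
- exact: nonneg_ge0.
Qed.

Lemma Ex_pause_sum k N : (0 < k)%N ->
  Ex Q (fun z => pause_sum k z N) = (mnpause k N * mc k)%:E.
Proof.
move=> k0; rewrite EFinM -mnpauseE -mcE//.
by apply: (wald_pause LQ k N measurable_nonneg); exact: nonneg_ge0.
Qed.

Lemma Ex_resume_sum k N : (0 < k)%N ->
  Ex Q (fun z => resume_sum k z N) = (mnresume k N * md k)%:E.
Proof.
move=> k0; rewrite EFinM -mnresumeE -mdE//.
by apply: (wald_resume LQ k N measurable_nonneg); exact: nonneg_ge0.
Qed.

Lemma nnmeas_busy_time N : nnmeas (fun z => busy_time z N).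
Proof.
apply: nnmeas_sum => j; apply: nnmeasM; last exact: nnmeas_lag.
by split; [exact: measurable_busy|move=> z; exact: ler0n].
Qed.

(** The overhead sum runs over [k > 0]: only there are the means [mc] and [md] known to be finite,
    and the top class has no overhead. *)
Lemma Ex_busy_time_le N : (Ex Q (fun z => busy_time z N) <=
  (\sum_k (mnarr k N * a k) +
   \sum_(k < n | (0 < k)%N) (mnpause k N * mc k + mnresume k N * md k))%:E)%E.
Proof.
pose U z := \sum_k admitted (szin z) (tr z N) k +
   \sum_(k < n | (0 < k)%N) (pause_sum k z N + resume_sum k z N).
have nn1 : nnmeas (fun z => \sum_k admitted (szin z) (tr z N) k).
  by apply: nnmeas_sum => k; exact: nnmeas_admitted.
have nnpr k : nnmeas (fun z => pause_sum k z N + resume_sum k z N).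
  by apply: nnmeasD; [exact: nnmeas_pause_sum|exact: nnmeas_resume_sum].
have nn2 : nnmeas (fun z => \sum_(k < n | (0 < k)%N) (pause_sum k z N + resume_sum k z N)).
  exact: nnmeas_sum.
apply: (@le_trans _ _ (Ex Q U)).
  apply: Ex_le; [exact: nnmeas_busy_time|exact: nnmeasD|].
  move=> z; apply: (le_trans (busy_time_le i0 z N)); rewrite lerD2l.
  rewrite /overhead [leRHS]big_mkcond /=; apply: ler_sum => k _.
  case: posnP => // k0; have [p0 r0] := no_pause_top i0 z N k0.
  by rewrite p0 r0 !big_ord0 addr0.
rewrite /U ExD// Ex_sum; last by move=> k; exact: nnmeas_admitted.
rewrite Ex_sum// EFinD -!sumEFin; apply: leeD.
  by apply: lee_sum => k _; rewrite Ex_admitted.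
apply: lee_sum => k k0.
by rewrite ExD ?Ex_pause_sum ?Ex_resume_sum//; [exact: nnmeas_pause_sum|exact: nnmeas_resume_sum].
Qed.

Definition mean_busy N : R := fine (Ex Q (fun z => busy_time z N)).

Lemma mean_busyE N : Ex Q (fun z => busy_time z N) = (mean_busy N)%:E.
Proof.
rewrite /mean_busy fineK// ge0_fin_numE; last by apply: Ex_ge0; exact: (nnmeas_busy_time N).2.
by apply: le_lt_trans (Ex_busy_time_le N) _; exact: ltry.
Qed.

Lemma mnarr_le k N : mnarr k N <= 1 + lam k * mean_busy N.
Proof.
by rewrite -lee_fin -mnarrE EFinD EFinM -mean_busyE; exact: Ex_narr_le.
Qed.

Lemma mnarr_ge0 k N : 0 <= mnarr k N.
Proof. by rewrite -lee_fin -mnarrE Ex_ge0// => z; exact: ler0n. Qed.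

Lemma mnresume_le k N :
  mnresume k N <= (higher_rate lam k * (a k * mnarr k N) + 1) / q k.
Proof.
rewrite ler_pdivlMr// -lee_fin EFinM -mnresumeE -qE.
apply: (le_trans (Ex_nresume_le lam_gt0 LQ i0 k N)); rewrite EFinD leeD2r//.
rewrite (Ex_preempted lam_gt0 LQ i0) EFinM; apply: lee_wpmul2l.
  by rewrite lee_fin higher_rate_ge0.
rewrite mulrC -Ex_admitted; apply: Ex_le.
- exact: nnmeas_served.
- exact: nnmeas_admitted.
- by move=> z; exact: served_le.
Qed.

Lemma mnpause_le k N : mnpause k N <= mnresume k N + 1.
Proof.
rewrite -lee_fin EFinD -mnpauseE -mnresumeE -[X in (_ + X)%E](Ex_cst Q 1) -ExD.
- apply: Ex_le.
  + by split; [exact: measurable_npause|move=> z; exact: ler0n].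
  + apply: nnmeasD; last exact: (nnmeas_cst Z ler01).
    by split; [exact: measurable_nresume|move=> z; exact: ler0n].
  + by move=> z; exact: npause_le.
- by split; [exact: measurable_nresume|move=> z; exact: ler0n].
- exact: (nnmeas_cst Z ler01).
Qed.

(** The factor by which overheads stretch the mean size in the lower bound on [E[R_k]]; through it
    [load] is compared with the effective load. *)
Definition inflation k : R :=
  if (0 < k)%N then 1 + higher_rate lam k * (mc k + md k) / q k else 1.

Definition load : R := \sum_k lam k * (a k * inflation k).

Lemma mnresume_ge0 k N : 0 <= mnresume k N.
Proof. by rewrite -lee_fin -mnresumeE Ex_ge0// => z; exact: ler0n. Qed.

Lemma mean_busy_le N : exists c0 : R, (0 <= c0) /\
   forall N, mean_busy N <= c0 + load * mean_busy N.
Proof.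
(* Additive costs: the [1] in [mnresume_le] contributes [(mc + md) / q], the [1] in [mnpause_le]
   contributes [mc]. The [1] in [mnarr_le] accounts for the summand [a k * inflation k] in the
   witness. *)
pose e k : R := if (0 < k)%N then (mc k + md k) / q k + mc k else 0.
exists (\sum_k (a k * inflation k + e k)).
have infl1 k : 1 <= inflation k.
  rewrite /inflation; case: ifP => // k0; rewrite lerDl.
  apply: divr_ge0; last exact: ltW.
  by rewrite mulr_ge0 ?higher_rate_ge0// addr_ge0 ?mc_ge0 ?md_ge0.
split.
  apply: sumr_ge0 => k _; apply: addr_ge0.
    by rewrite mulr_ge0 ?a_ge0// (le_trans ler01).
  rewrite /e; case: ifP => // k0.
  apply: addr_ge0; last exact: mc_ge0.
  by apply: divr_ge0; [rewrite addr_ge0 ?mc_ge0 ?md_ge0|exact: ltW].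
move=> {}N.
have := Ex_busy_time_le N; rewrite mean_busyE lee_fin => /le_trans; apply.
rewrite [X in _ + X]big_mkcond /= -big_split /= /load mulr_suml -big_split /=.
apply: ler_sum => k _.
have nk := mnarr_le k N; have n0 := mnarr_ge0 k N; have ak := a_ge0 k.
apply: (@le_trans _ _ (mnarr k N * (a k * inflation k) + e k)); last first.
  rewrite (_ : _ + lam k * _ * _ = (1 + lam k * mean_busy N) * (a k * inflation k) + e k).
    by rewrite lerD2r ler_wpM2r// mulr_ge0// (le_trans ler01).
  by ring.
rewrite /inflation /e; case: ifP => k0; last by rewrite mulr1 addr0.
have rk := mnresume_le k N; have pk := mnpause_le k N.
have c0 := mc_ge0 k0; have d0 := md_ge0 k0.
apply: (@le_trans _ _ (mnarr k N * a k +
    ((mc k + md k) * ((higher_rate lam k * (a k * mnarr k N) + 1) / q k) + mc k))).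
  rewrite lerD2l; apply: (@le_trans _ _ ((mnresume k N + 1) * mc k + mnresume k N * md k)).
    by rewrite lerD2r ler_wpM2r.
  rewrite (_ : _ + _ * md k = (mc k + md k) * mnresume k N + mc k); last by ring.
  by rewrite lerD2r ler_wpM2l// addr_ge0.
rewrite le_eqVlt; apply/orP; left; apply/eqP; field.
by rewrite gt_eqF.
Qed.

Hypothesis load_lt1 : load < 1.

Lemma queue_bound : exists M : R, forall N,
  (Ex Q (fun z => now (tr z N)) <= M%:E)%E /\
  (Ex Q (fun z => busy_steps z N) <= M%:E)%E.
Proof.
have [c0 [c00 cB]] := mean_busy_le 0.
(* Solution of the linear inequality [B_N <= c0 + load * B_N], uniform in [N]. *)
pose B := c0 / (1 - load).
have BN N : mean_busy N <= B.
  by rewrite ler_pdivlMr ?subr_gt0//; have := cB N; lra.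
have B0 : 0 <= B by rewrite divr_ge0// subr_ge0 ltW.
pose nb k := 1 + lam k * B.
pose rb k := (higher_rate lam k * (a k * nb k) + 1) / q k.
have nN k N : mnarr k N <= nb k.
  by apply: (le_trans (mnarr_le k N)); rewrite lerD2l ler_wpM2l// ltW.
have rN k N : mnresume k N <= rb k.
  apply: (le_trans (mnresume_le k N)); rewrite ler_pM2r ?invr_gt0// lerD2r.
  by rewrite ler_wpM2l ?higher_rate_ge0// ler_wpM2l ?a_ge0.
have nb0 k : 0 <= nb k by apply: le_trans (nN k 0%N); exact: mnarr_ge0.
have rb0 k : 0 <= rb k by apply: le_trans (rN k 0%N); exact: mnresume_ge0.
pose M1 := (lam i0)^-1 + 1 + B.
pose M2 := \sum_k (2 * nb k + (rb k + 1) + rb k).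
exists (M1 + M2) => N.
have M10 : 0 <= M1 by rewrite /M1 !addr_ge0// invr_ge0 ltW.
have M20 : 0 <= M2.
  by apply: sumr_ge0 => k _; rewrite !addr_ge0// mulr_ge0.
split.
  apply: (@le_trans _ _ M1%:E); last by rewrite lee_fin lerDl.
  have nnx : nnmeas (fun z => xin z i0 0).
    by split; [exact: measurable_xin|move=> z; rewrite ltW ?xin_gt0].
  apply: (@le_trans _ _ (Ex Q (fun z => xin z i0 0 + busy_time z N)%R)).
    apply: Ex_le.
    - split; first exact: measurable_now.
      move=> z; have := epoch_le_clock i0 i0 z N; apply: le_trans.
      by apply: sumr_ge0 => l _; rewrite ltW ?xin_gt0.
    - by apply: nnmeasD => //; exact: nnmeas_busy_time.
    - by move=> z; exact: now_le.
  rewrite ExD//; last exact: nnmeas_busy_time.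
  rewrite /M1 EFinD; apply: leeD; first exact: (Ex_interarrival_le lam_gt0 LQ).
  by rewrite mean_busyE lee_fin.
apply: (@le_trans _ _ M2%:E); last by rewrite lee_fin lerDr.
have nnn k : nnmeas (fun z => (narr (tr z N) k)%:R : R).
  by split; [exact: measurable_narr|move=> z; exact: ler0n].
have nnp k : nnmeas (fun z => (npause (tr z N) k)%:R : R).
  by split; [exact: measurable_npause|move=> z; exact: ler0n].
have nnr k : nnmeas (fun z => (nresume (tr z N) k)%:R : R).
  by split; [exact: measurable_nresume|move=> z; exact: ler0n].
have nn2 k : nnmeas (fun z => 2 * (narr (tr z N) k)%:R : R).
  by apply: nnmeasM => //; exact: nnmeas_cst.
apply: (@le_trans _ _ (Ex Q (fun z => \sum_k (2 * (narr (tr z N) k)%:R +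
    (npause (tr z N) k)%:R + (nresume (tr z N) k)%:R))%R)).
  apply: Ex_le.
  - apply: nnmeas_sum => j; split; first exact: measurable_busy.
    by move=> z; exact: ler0n.
  - by apply: nnmeas_sum => k; apply: nnmeasD => //; exact: nnmeasD.
  - move=> z; apply: (le_trans (busy_steps_le i0 z N)).
    by apply: ler_sum => k _; rewrite natrD natrD natrM.
rewrite Ex_sum => [|k]; last by apply: nnmeasD => //; exact: nnmeasD.
rewrite /M2 -sumEFin; apply: lee_sum => k _.
rewrite !ExD//; last exact: nnmeasD.
rewrite ExZ// mnarrE mnpauseE mnresumeE -EFinM -!EFinD lee_fin.
have := nN k N; have := rN k N; have := mnpause_le k N; lra.
Qed.

End QueueBound.

(** * Dynamics of a single job *)

Section JobDynamics.
Context {R : realType} {n : nat}.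
Variables (x c dd : 'I_n -> nat -> R) (k : 'I_n).
Notation st := (jstate R n).
Notation stp := (jstep x c dd k).
Implicit Types (s : st) (i j : 'I_n).

Definition jdue s i : R := arrT x i (jarr s i).

Definition jend s : option R :=
  match jph s with
  | JServe => Some (ju s + jrem s)
  | JPause e => Some e
  | JResume e _ => Some e
  | JDone => None
  end.

(** Tie rules of [jstep]: an arrival at the very end of a pause falls into the pause, one at the end
    of a service or a resume comes too late. *)
Definition beats s (h e : R) : bool := if jph s is JPause _ then h <= e else h < e.

Definition jarrive i h s : st :=
  match jph s with
  | JServe => JState h (jconsume i s) (jrem s - (h - ju s)) (jpc s).+1 (jrc s)
                   (JPause (h + c k (jpc s)))
  | JPause e => JState h (jconsume i s) (jrem s) (jpc s) (jrc s) (JPause e)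
  | JResume e f => JState h (jconsume i s) (jrem s) (jpc s) (jrc s) (JResume e true)
  | JDone => s
  end.

Definition jfinish e s : st :=
  match jph s with
  | JServe => JState e (jarr s) 0 (jpc s) (jrc s) (JDone R)
  | JPause _ => JState e (jarr s) (jrem s) (jpc s) (jrc s).+1
                     (JResume (e + dd k (jrc s)) false)
  | JResume _ f => if f then JState e (jarr s) (jrem s) (jpc s).+1 (jrc s)
                                  (JPause (e + c k (jpc s)))
                 else JState e (jarr s) (jrem s) (jpc s) (jrc s) (JServe R)
  | JDone => s
  end.

Definition higher : seq 'I_n := seq.filter (fun i : 'I_n => (i < k)%N) (enum 'I_n).

Lemma mem_higher i : (i \in higher) = (i < k)%N.
Proof. by rewrite mem_filter mem_enum andbT. Qed.

Lemma jnextE s : jnext x k s = earliest (jdue s) higher.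
Proof. by []. Qed.

(** Writes the step as a race between the next higher-priority arrival and the end of the phase, the
    form in which the arguments for the queue carry over. *)
Lemma jstepE s : stp s =
  if jend s is Some e then
    if earliest (jdue s) higher is Some (i, h) then
      if beats s h e then jarrive i h s else jfinish e s
    else jfinish e s
  else s.
Proof.
rewrite /jstep /jend /beats /jarrive /jfinish -jnextE.
by case: (jph s) => [|e|e f|] //; case: jnext => [[i h]|].
Qed.

Variant jstep_spec s : st -> Type :=
| JStepArrival i t e of (i < k)%N & t = jdue s i &
    (forall j, (j < k)%N -> t <= jdue s j) & jend s = Some e & t <= e :
    jstep_spec s (jarrive i t s)
| JStepFinish e of jend s = Some e & (forall j, (j < k)%N -> e <= jdue s j) :
    jstep_spec s (jfinish e s)
| JStepStop of jend s = None : jstep_spec s s.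

Lemma beats_le s h e : beats s h e -> h <= e.
Proof. by rewrite /beats; case: (jph s) => // *; exact: ltW. Qed.

Lemma beatsN_le s h e : ~~ beats s h e -> e <= h.
Proof.
move=> b; rewrite leNgt; apply: contraNN b => eh; rewrite /beats.
by case: (jph s) => // *; exact: ltW.
Qed.

Lemma beats_trans s h h' e : h <= h' -> beats s h' e -> beats s h e.
Proof.
move=> hh'; rewrite /beats.
by case: (jph s) => [|_|_ _|]; [exact: le_lt_trans|exact: le_trans|exact: le_lt_trans..].
Qed.

Lemma jstepP s : jstep_spec s (stp s).
Proof.
rewrite jstepE; case ee: (jend s) => [e|]; last exact: JStepStop.
case en: (earliest _ _) => [[i h]|]; last first.
  apply: JStepFinish => // j jk; have := earliest_none en.
  by move=> h; have := mem_higher j; rewrite h jk.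
have [ih hE hmin] := earliest_some en.
have hmin' j : (j < k)%N -> h <= jdue s j by move=> jk; apply: hmin; rewrite mem_higher.
case: ifPn => b.
  by apply: (@JStepArrival _ _ _ e) => //; [rewrite -mem_higher|exact: beats_le b].
by apply: JStepFinish => // j jk; apply: (le_trans (beatsN_le b)); exact: hmin'.
Qed.

Record jsound (s : st) : Prop := JSound {
  jcon_time : forall i, (i < k)%N ->
    \sum_(l < jarr s i) x i l <= ju s <= jdue s i;
  jcon_rem : 0 <= jrem s;
  jcon_end : forall e, jend s = Some e -> ju s <= e;
  jcon_balance : jpc s = (jrc s + (if jph s is JPause _ then 1 else 0))%N;
  jcon_done : is_done s -> jrem s = 0 }.

Hypothesis x_gt0 : forall i m, 0 < x i m.
Hypothesis c_ge0 : forall i m, 0 <= c i m.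
Hypothesis dd_ge0 : forall i m, 0 <= dd i m.

Lemma jsound_init sz : 0 <= sz k 0%N -> jsound (jinit sz k).
Proof.
move=> s0; split => //=.
- by move=> i _; rewrite big_ord0 lexx /jdue /arrT /= big_ord1 ltW.
- by move=> e; rewrite /jend /= => -[<-]; rewrite add0r.
Qed.

Lemma jsound_step s : jsound s -> jsound (stp s) /\ ju s <= ju (stp s).
Proof.
move=> ss; case: (jstepP s) => [i t e ik tE tmin ee te|e ee emin|//].
  have st : ju s <= t by rewrite tE; have /andP[] := jcon_time ss ik.
  have ct j : (j < k)%N -> \sum_(l < jconsume i s j) x j l <= t <= arrT x j (jconsume i s j).
    move=> jk; have /andP[h1 h2] := jcon_time ss jk.
    rewrite /jconsume /upd; case: eqP => [->|_].
      by rewrite -arrTS -/(jdue s i) -tE lexx /= arrTS big_ord_recr /=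
        -arrTS -/(jdue s i) -tE lerDl ltW.
    by rewrite (le_trans h1)//=; exact: tmin.
  have := jcon_balance ss; move: ee; rewrite /jarrive /jend /is_done.
  case ph: (jph s) => [|u|u b|] //= -[eE] hb; split => //; split => //=.
  - by rewrite subr_ge0; lra.
  - by move=> ?; rewrite /jend /= => -[<-]; rewrite lerDl.
  - by rewrite hb addn0 addn1.
  - exact: jcon_rem.
  - by move=> ?; rewrite /jend /= => -[<-]; rewrite eE.
  - exact: jcon_rem.
  - by move=> ?; rewrite /jend /= => -[<-]; rewrite eE.
have se : ju s <= e by exact: jcon_end ss _ ee.
have ct j : (j < k)%N -> \sum_(l < jarr s j) x j l <= e <= arrT x j (jarr s j).
  by move=> jk; have /andP[h1 h2] := jcon_time ss jk; rewrite (le_trans h1)//=; exact: emin.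
have := jcon_balance ss; move: ee; rewrite /jfinish /jend /is_done.
case ph: (jph s) => [|u|u b|] //= -[eE] hb.
- split => //; split => //=; first exact: jcon_rem.
    by move=> ?; rewrite /jend /= => -[<-]; rewrite lerDl.
  by rewrite hb addn0 addn1.
- case: b ph => ph; split => //; split => //=; try exact: jcon_rem.
  + by move=> ?; rewrite /jend /= => -[<-]; rewrite lerDl.
  + by rewrite hb addn0 addn1.
  + by move=> ?; rewrite /jend /= => -[<-]; rewrite lerDl jcon_rem.
Qed.

Definition jserving s : bool := if jph s is JServe then true else false.
Definition jblocked s : bool :=
  match jph s with JPause _ => true | JResume _ _ => true | _ => false end.

Definition jresidual s : R :=
  match jph s with JPause e => e - ju s | JResume e _ => e - ju s | _ => 0 end.

Definition jsurvival (L : R) s : R :=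
  if jph s is JResume e false then expR (- L * (e - ju s)) else 0.

Definition jhits s s' : R :=
  \sum_(i < n | (i < k)%N) ((jarr s' i)%:R - (jarr s i)%:R).

Definition jpauses s : R := \sum_(m < jpc s) c k m.
Definition jresumes s : R := \sum_(m < jrc s) dd k m.
Definition jdiscount (L : R) s : R := \sum_(m < jrc s) expR (- L * dd k m).

Lemma ju_arrive i t s : jend s <> None -> ju (jarrive i t s) = t.
Proof. by rewrite /jend /jarrive; case: (jph s). Qed.

Lemma ju_finish e s : jend s <> None -> ju (jfinish e s) = e.
Proof. by rewrite /jend /jfinish; case: (jph s) => // ? []. Qed.

Lemma jarr_arrive i t s : jend s <> None -> jarr (jarrive i t s) = upd (jarr s) i (jarr s i).+1.
Proof. by rewrite /jend /jarrive; case: (jph s). Qed.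

Lemma jarr_finish e s : jarr (jfinish e s) = jarr s.
Proof. by rewrite /jfinish; case: (jph s) => // ? []. Qed.

Lemma jarr_step s i : jarr (stp s) i = jarr s i \/ jarr (stp s) i = (jarr s i).+1.
Proof.
case: (jstepP s) => [j t e _ _ _ ee _|e _ _|_]; last by left.
  rewrite jarr_arrive ?ee// /upd; case: eqP => [->|_]; [by right|by left].
by rewrite jarr_finish; left.
Qed.

Lemma jpc_step s : jpc (stp s) = jpc s \/ jpc (stp s) = (jpc s).+1.
Proof.
case: (jstepP s) => [j t e _ _ _ ee _|e _ _|_]; last by left.
  by rewrite /jarrive; case: (jph s); [right|left|left|left].
by rewrite /jfinish; case: (jph s) => [|?|? []|]; [left|left|right|left|left].
Qed.

Lemma jrc_step s : jrc (stp s) = jrc s \/ jrc (stp s) = (jrc s).+1.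
Proof.
case: (jstepP s) => [j t e _ _ _ ee _|e _ _|_]; last by left.
  by rewrite /jarrive; case: (jph s); left.
by rewrite /jfinish; case: (jph s) => [|?|? []|]; [left|right|left|left|left].
Qed.

Lemma jhits_eq s s' : jarr s' = jarr s -> jhits s s' = 0.
Proof. by move=> e; rewrite /jhits e big1 // => i _; rewrite subrr. Qed.

Lemma jhits_arrival s s' i : (i < k)%N -> jarr s' = upd (jarr s) i (jarr s i).+1 ->
  jhits s s' = 1.
Proof.
move=> ik e; rewrite /jhits e (bigD1 i)//= upd_eq big1 ?addr0.
  by rewrite mulrSr addrAC subrr add0r.
by move=> j /andP[_ ji]; rewrite upd_neq// subrr.
Qed.

Lemma jrem_step s : jrem (stp s) = jrem s - (jserving s)%:R * (ju (stp s) - ju s).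
Proof.
case: (jstepP s) => [i t e _ _ _ ee _|e ee _|ee].
- move: ee; rewrite /jend /jarrive /jserving.
  by case: (jph s) => [|u|u b|] //= _; rewrite ?mul1r ?mul0r ?subr0.
- move: ee; rewrite /jend /jfinish /jserving.
  case: (jph s) => [|u|u b|] //= -[eE]; rewrite ?mul1r ?mul0r ?subr0 //.
    by rewrite -eE; ring.
  by case: b.
- by rewrite subrr mulr0 subr0.
Qed.

(** Time passes at the expense of the remaining size or of the residual, and a new overhead enters
    the residual and its sum alike. *)
Lemma jwork_step s :
  ju (stp s) + jrem (stp s) + jresidual (stp s) - jpauses (stp s) - jresumes (stp s) =
  ju s + jrem s + jresidual s - jpauses s - jresumes s.
Proof.
case: (jstepP s) => [i t e _ _ _ ee _|e ee _|//].
- move: ee; rewrite /jend /jarrive /jresidual /jpauses /jresumes.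
  by case: (jph s) => [|u|u b|] //= _; rewrite ?big_ord_recr /=; ring.
- move: ee; rewrite /jend /jfinish /jresidual /jpauses /jresumes.
  case: (jph s) => [|u|u b|] //= -[eE].
  + by rewrite -eE; ring.
  + by rewrite big_ord_recr /= -eE; ring.
  + by case: b; rewrite /= ?big_ord_recr /= -eE; ring.
Qed.

(** Same bookkeeping as for the queue. An isolated job never waits: it is paused exactly while in a
    pause or a resume, so [jblocked] takes the place of [paused]. *)
Lemma jresume_step (L : R) s :
  let s' := stp s in let h := jhits s s' in
  jsurvival L s' - (jblocked s')%:R - jdiscount L s' + (jserving s)%:R * h =
  jsurvival L s - (jblocked s)%:R - jdiscount L s +
  jsurvival L s * (expR (L * (ju s' - ju s)) - 1) -
  jsurvival L s * (h * expR (L * (ju s' - ju s))).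
Proof.
rewrite /=; case: (jstepP s) => [i t e ik _ _ ee _|e ee _|ee].
- rewrite (@jhits_arrival s _ i)//; last by rewrite jarr_arrive ?ee.
  rewrite ju_arrive ?ee//; move: ee.
  rewrite /jend /jarrive /jsurvival /jblocked /jdiscount /jserving.
  case: (jph s) => [|u|u b|] //= _; rewrite ?mulr1n ?mulr0n; try by ring.
- rewrite jhits_eq ?jarr_finish// ju_finish ?ee//; move: ee.
  rewrite /jend /jfinish /jsurvival /jblocked /jdiscount /jserving.
  case: (jph s) => [|u|u b|] //= -[eE]; rewrite ?mulr1n ?mulr0n; try by ring.
    rewrite big_ord_recr /=.
    by rewrite (_ : e + dd k (jrc s) - e = dd k (jrc s)); ring.
  case: b => /=; rewrite ?mulr1n ?mulr0n; first by ring.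
  have -> : expR (- L * (u - ju s)) * (expR (L * (e - ju s)) - 1) =
      1 - expR (- L * (u - ju s)).
    by rewrite mulrBr mulr1 -expRD eE mulNr addNr expR0.
  by ring.
- rewrite jhits_eq//; move: ee.
  rewrite /jend /jsurvival /jblocked /jdiscount /jserving.
  by case: (jph s) => //= _; ring.
Qed.

Lemma done_step s : is_done s -> stp s = s.
Proof. by rewrite /is_done jstepE /jend; case: (jph s). Qed.

End JobDynamics.

Section JobDependence.
Context {R : realType} {n : nat}.
Implicit Types (x c dd : 'I_n -> nat -> R) (s : jstate R n) (i j k : 'I_n).

Lemma jstep_due_eq x x' c dd k s : (forall i, (i < k)%N -> jdue x' s i = jdue x s i) ->
  jstep x' c dd k s = jstep x c dd k s.
Proof.
move=> e; rewrite !jstepE.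
have -> : earliest (jdue x' s) (higher k) = earliest (jdue x s) (higher k).
  rewrite /earliest; have : {subset higher k <= higher k} by [].
  elim: {1 3 4}(higher k) => [//|h l IH] sub /=.
  rewrite IH => [|i il]; last by apply: sub; rewrite inE il orbT.
  by rewrite e// -mem_higher sub// inE eqxx.
by [].
Qed.

Lemma jstep_delay x x' c dd k s i : (i < k)%N ->
  (forall j, j != i -> jdue x' s j = jdue x s j) ->
  (jarr (jstep x c dd k s) i <= jarr s i)%N ->
  ju (jstep x c dd k s) < jdue x' s i ->
  jstep x' c dd k s = jstep x c dd k s.
Proof.
move=> ik xx'; rewrite !jstepE; case ee: (jend s) => [e|//].
have se : jend s <> None by rewrite ee.
case en: (earliest (jdue x s) (higher k)) => [[j t]|]; last first.
  by have := mem_higher k i; rewrite (earliest_none en) ik.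
have [jl tE tmin] := earliest_some en.
have [j' [t' en']] : exists j' t', earliest (jdue x' s) (higher k) = Some (j', t').
  case en': (earliest _ _) => [[j' t']|]; first by exists j', t'.
  by move: jl; rewrite (earliest_none en').
case: ifPn => b.
  rewrite jarr_arrive// ju_arrive// => ni ti.
  have ji : j != i by apply: contraTneq ni => ->; rewrite upd_eq ltnn.
  by rewrite (earliest_delay xx' ti ji en) b.
rewrite ju_finish// => _ ei; rewrite en' ifN//.
have [j'l t'E _] := earliest_some en'.
apply: contra b => b'.
have [j'i|j'i] := eqVneq j' i.
  by have := beats_le b'; rewrite t'E j'i leNgt ei.
by apply: beats_trans b'; rewrite t'E xx'//; exact: tmin.
Qed.

(** The competitors of arrival [i] are now the end of the phase and the arrivals of the other
    classes below [k]. *)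
Lemma jstep_race_bound x c dd k s i : (i < k)%N -> jend s <> None ->
  exists B, forall x', (forall j, j != i -> jdue x' s j = jdue x s j) ->
    [/\ ju (jstep x' c dd k s) = Num.min (jdue x' s i) B,
        jdue x' s i < B -> jarr (jstep x' c dd k s) i = (jarr s i).+1 &
        B < jdue x' s i -> jarr (jstep x' c dd k s) i = jarr s i].
Proof.
move=> ik; case ee: (jend s) => [e|//] _.
have se : jend s <> None by rewrite ee.
pose B := \big[Num.min/e]_(j < n | (j < k)%N && (j != i)) jdue x s j.
have Be : B <= e.
  by rewrite /B; elim/big_rec: _ => // j y _ h; rewrite ge_min h orbT.
have Bj j : (j < k)%N -> j != i -> B <= jdue x s j.
  by move=> jk ji; rewrite /B (bigD1 j) ?jk//= ge_min lexx.
have Bge y : y <= e -> (forall j, (j < k)%N -> j != i -> y <= jdue x s j) -> y <= B.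
  move=> ye yj; rewrite /B; elim/big_rec: _ => // j z /andP[jk ji] h.
  by rewrite le_min h yj.
exists B => x' xx'; case: (jstepP x' c dd k s) => [j t e' jk tE tmin|u|]; rewrite ee //.
  move=> [<-] te; rewrite ju_arrive// jarr_arrive//; have [ji|ji] := eqVneq j i.
    rewrite ji in tE *; rewrite -tE upd_eq.
    have tB : t <= B.
      by apply: Bge => // j' j'k j'i; rewrite -xx'//; exact: tmin.
    by split => //; [rewrite (min_idPl tB)|rewrite ltNge tB].
  have tB : B = t.
    apply/eqP; rewrite eq_le {1}tE xx'// Bj//=.
    by apply: Bge => // j' j'k j'i; rewrite -xx'//; exact: tmin.
  rewrite upd_neq 1?eq_sym// tB; split => //; first by rewrite (min_idPr (tmin _ ik)).
  by rewrite ltNge tmin.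
move=> [<-] emin; rewrite ju_finish// jarr_finish.
have eB : B = e.
  apply/eqP; rewrite eq_le Be/=; apply: Bge => // j' j'k j'i.
  by rewrite -xx'//; exact: emin.
rewrite eB; split => //; first by rewrite (min_idPr (emin _ ik)).
by rewrite ltNge emin.
Qed.

Lemma jstep_pause_dep x c c' dd k s m : agree_off k m c c' ->
  jstep x c' dd k s = jstep x c dd k s \/
  jpc s = m /\ jpc (jstep x c' dd k s) = m.+1 /\ jpc (jstep x c dd k s) = m.+1.
Proof.
move=> ag; rewrite !jstepE; case: (jend s) => [e|]; last by left.
have [pm|pm] := eqVneq (jpc s) m; last first.
  have agE : c' k (jpc s) = c k (jpc s) by apply: ag; apply/eqP => -[/eqP]; rewrite (negbTE pm).
  by left; rewrite /jarrive /jfinish agE.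
have A i t : jarrive c' k i t s = jarrive c k i t s \/ jpc s = m /\
    jpc (jarrive c' k i t s) = m.+1 /\ jpc (jarrive c k i t s) = m.+1.
  by rewrite /jarrive; case: (jph s) => [|?|? ?|]; [right; rewrite /= pm|left|left|left].
have F : jfinish c' dd k e s = jfinish c dd k e s \/ jpc s = m /\
    jpc (jfinish c' dd k e s) = m.+1 /\ jpc (jfinish c dd k e s) = m.+1.
  by rewrite /jfinish; case: (jph s) => [|?|? []|]; [left|left|right; rewrite /= pm|left|left].
by case: (earliest _ _) => [[i h]|] //; case: ifP.
Qed.

Lemma jstep_resume_dep x c dd dd' k s m : agree_off k m dd dd' ->
  jstep x c dd' k s = jstep x c dd k s \/
  jrc s = m /\ jrc (jstep x c dd' k s) = m.+1 /\ jrc (jstep x c dd k s) = m.+1.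
Proof.
move=> ag; rewrite !jstepE; case: (jend s) => [e|]; last by left.
have [pm|pm] := eqVneq (jrc s) m; last first.
  have agE : dd' k (jrc s) = dd k (jrc s) by apply: ag; apply/eqP => -[/eqP]; rewrite (negbTE pm).
  by left; rewrite /jfinish agE.
have F : jfinish c dd' k e s = jfinish c dd k e s \/ jrc s = m /\
    jrc (jfinish c dd' k e s) = m.+1 /\ jrc (jfinish c dd k e s) = m.+1.
  by rewrite /jfinish; case: (jph s) => [|?|? []|]; [left|right; rewrite /= pm|left|left|left].
by case: (earliest _ _) => [[i h]|] //; case: ifP => _ //; left.
Qed.

End JobDependence.

(** The values of the first hitting index give a countable measurable cover, and the function is
    explicit on each piece. *)
Lemma measurable_first_hit d (Z : measurableType d) {R : realType}
    (b : Z -> nat -> bool) (v : nat -> Z -> R) (F : Z -> \bar R) :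
  (forall N, measurable [set z | b z N]) ->
  (forall N, measurable_fun setT (v N)) ->
  (forall z N, b z N -> (forall m, b z m -> (N <= m)%N) -> F z = (v N z)%:E) ->
  (forall z, ~ (exists N, b z N) -> F z = +oo%E) ->
  measurable_fun setT F.
Proof.
move=> mb mv Fv Foo.
(* Index 0 is the piece where nothing is ever hit; index [m.+1] is a first hit at [m]. *)
pose A N := if N is m.+1 then
    [set z | b z m] `\` \bigcup_(l in [set l | (l < m)%N]) [set z | b z l]
  else ~` \bigcup_l [set z | b z l].
apply: (@measurable_glue _ _ _ _ A
  (fun N z => if N is m.+1 then (v m z)%:E else +oo%E)).
- case=> [|m] /=; first by apply: measurableC; exact: bigcupT_measurable.
  by apply: measurableD => //; exact: bigcup_measurable.
- move=> z; have [ex|nd] := pselect (exists N, b z N); last first.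
    by exists 0%N => -[N _ bN]; apply: nd; exists N.
  case: (ex_minnP ex) => m bm mmin; exists m.+1; split => //= -[l /= lm bl].
  by have := mmin _ bl; rewrite leqNgt lm.
- move=> [|m] z /=; first by move=> h; apply: Foo => -[N bN]; apply: h; exists N.
  move=> [bm h]; apply: Fv => // l bl; rewrite leqNgt; apply/negP => lm.
  by apply: h; exists l.
- by case=> [|m] /=; [exact: measurable_cst|apply/measurable_EFinP].
Qed.

Section JobMeasurability.
Context d (Z : measurableType d) {R : realType} {n : nat}.
Variables (x sz c dd : Z -> 'I_n -> nat -> R) (k : 'I_n).
Hypothesis mx : forall i m, measurable_fun setT (fun z => x z i m).
Hypothesis mc : forall i m, measurable_fun setT (fun z => c z i m).
Hypothesis mdd : forall i m, measurable_fun setT (fun z => dd z i m).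
Notation mfunR := (fun f : Z -> R => measurable_fun setT f).

Inductive phase_class : (Z -> jphase R) -> Prop :=
| class_jserve : phase_class (fun=> JServe R)
| class_jpause e : mfunR e -> phase_class (fun z => JPause (e z))
| class_jresume e b : mfunR e -> phase_class (fun z => JResume (e z) b)
| class_jdone : phase_class (fun=> JDone R).

Inductive jstate_class : (Z -> jstate R n) -> Prop :=
| JStateClass u na r pc rc ph : mfunR u -> mfunR r -> phase_class ph ->
    jstate_class (fun z => JState (u z) na (r z) pc rc (ph z)).

Lemma jstate_class_arrive i h s : mfunR h -> jstate_class s ->
  jstate_class (fun z => jarrive (c z) k i (h z) (s z)).
Proof.
move=> mh [u na r pc rc ph mu mr [|e me|e b me|]]; rewrite /jarrive /jconsume /=.
- apply: (@JStateClass h _ (fun z => r z - (h z - u z)) _ _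
    (fun z => JPause (h z + c z k pc))) => //.
    by apply: measurable_funB => //; exact: measurable_funB.
  by apply: class_jpause; exact: measurable_funD.
- by apply: (@JStateClass h _ r _ _ (fun z => JPause (e z))) => //; exact: class_jpause.
- apply: (@JStateClass h _ r _ _ (fun z => JResume (e z) true)) => //.
  exact: class_jresume.
- by apply: (@JStateClass u _ r _ _ (fun=> JDone R)) => //; exact: class_jdone.
Qed.

Lemma jstate_class_finish e s : mfunR e -> jstate_class s ->
  jstate_class (fun z => jfinish (c z) (dd z) k (e z) (s z)).
Proof.
move=> me' [u na r pc rc ph mu mr [|e' me|e' b me|]]; rewrite /jfinish /=.
- apply: (@JStateClass e na (fun=> 0) _ _ (fun=> JDone R)) => //.
  exact: class_jdone.
- apply: (@JStateClass e na r _ _ (fun z => JResume (e z + dd z k rc) false)) => //.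
  by apply: class_jresume; exact: measurable_funD.
- case: b.
    apply: (@JStateClass e na r _ _ (fun z => JPause (e z + c z k pc))) => //.
    by apply: class_jpause; exact: measurable_funD.
  by apply: (@JStateClass e na r _ _ (fun=> JServe R)) => //; exact: class_jserve.
- by apply: (@JStateClass u na r _ _ (fun=> JDone R)) => //; exact: class_jdone.
Qed.

Lemma piecewise_jstep s : jstate_class s ->
  piecewise jstate_class (fun z => jstep (x z) (c z) (dd z) k (s z)).
Proof.
move=> cs; case: (cs) => u na r pc rc ph mu mr mph.
pose s' z := JState (u z) na (r z) pc rc (ph z).
rewrite -/s' in cs *.
have next := piecewise_next mx na (higher k).
have [[e [me eE]]|eE] : (exists e, mfunR e /\ forall z, jend (s' z) = Some (e z)) \/
    (forall z, jend (s' z) = None).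
  rewrite /s' /jend /=; case: mph {cs s'} => [|e me|e b me|]; last by right.
  - by left; exists (fun z => u z + r z); split => //; exact: measurable_funD.
  - by left; exists e.
  - by left; exists e.
- rewrite (_ : (fun z => _) = fun z => match earliest (jdue (x z) (s' z)) (higher k) with
     | Some (i, h) => if beats (s' z) h (e z) then jarrive (c z) k i h (s' z)
                      else jfinish (c z) (dd z) k (e z) (s' z)
     | None => jfinish (c z) (dd z) k (e z) (s' z) end); last first.
    by apply/funext => z; rewrite jstepE eE.
  apply: (piecewise_bind (F := fun z o => match o with
     | Some (i, h) => if beats (s' z) h (e z) then jarrive (c z) k i h (s' z)
                      else jfinish (c z) (dd z) k (e z) (s' z)
     | None => jfinish (c z) (dd z) k (e z) (s' z) end) _ next) => _ [|i h mh].
    by apply: piecewise_base; exact: jstate_class_finish.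
  apply: piecewise_if.
  + rewrite /beats /s' /=; case: mph {cs s' eE} => [|? ?|? ? ?|] /=;
      try exact: measurable_ltr; exact: measurable_ler.
  + by apply: piecewise_base; exact: jstate_class_arrive.
  + by apply: piecewise_base; exact: jstate_class_finish.
- rewrite (_ : (fun z => _) = s'); first exact: piecewise_base.
  by apply/funext => z; rewrite jstepE eE.
Qed.

Hypothesis msz : forall i m, measurable_fun setT (fun z => sz z i m).
Notation js z j := (iter j (jstep (x z) (c z) (dd z) k) (jinit (sz z) k)).

Lemma measurable_jiter (g : jstate R n -> R) j :
  (forall s : Z -> jstate R n, jstate_class s -> measurable_fun setT (fun z => g (s z))) ->
  measurable_fun setT (fun z => g (js z j)).
Proof.
move=> h; apply: (piecewise_measurable (g := g) h (s := fun z => js z j)).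
elim: j => [|j IH].
  apply: piecewise_base.
  apply: (@JStateClass (fun=> 0) (fun=> 0%N) (fun z => sz z k 0) 0 0 (fun=> JServe R)).
  - exact: measurable_cst.
  - exact: msz.
  - exact: class_jserve.
apply: (piecewise_bind (F := fun z => jstep (x z) (c z) (dd z) k) _ IH) => s.
exact: piecewise_jstep.
Qed.

Lemma measurable_effective_size :
  measurable_fun setT (fun z => effective_size (x z) (sz z) (c z) (dd z) k).
Proof.
apply: (@measurable_first_hit _ _ _ (fun z N => is_done (js z N)) (fun N z => ju (js z N))).
- move=> N; apply: (measurable_bool (R := R)).
  apply: (measurable_jiter (g := fun s => (is_done s)%:R)) => s.
  by case=> u na r pc rc ph _ _ [] *; exact: measurable_cst.
- by move=> N; apply: measurable_jiter => s [].
- move=> z N dN Nmin; rewrite /effective_size; case: pselect => [H|]; last by case; exists N.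
  case: ex_minnP => m dm mmin; congr (ju (iter _ _ _))%:E.
  by apply/eqP; rewrite eqn_leq Nmin// mmin.
- by move=> z nd; rewrite /effective_size; case: pselect.
Qed.

End JobMeasurability.

Section JobPaths.
Context {R : realType} {n : nat}.
Notation Z := (@inputsp R (@tagT n)).
Variable k : 'I_n.
Implicit Types (z : Z) (i : 'I_n) (N j : nat).

Definition jobstep z : jstate R n -> jstate R n := jstep (xin z) (cin z) (ddin z) k.
Definition jobinit z : jstate R n := jinit (szin z) k.
Notation js := (trajectory jobstep jobinit).

Lemma jsound_tr z j : jsound (xin z) k (js z j).
Proof.
elim: j => [|j IH].
  by apply: jsound_init; [move=> i m; exact: xin_gt0|rewrite ltW ?szin_gt0].
by apply: (jsound_step (xin_gt0 z) (cin_ge0 z) (ddin_ge0 z) IH).1.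
Qed.

Lemma job_clock_mono z j : ju (js z j) <= ju (js z j.+1).
Proof. exact: (jsound_step (xin_gt0 z) (cin_ge0 z) (ddin_ge0 z) (jsound_tr z j)).2. Qed.

Lemma job_counter (cnt : jstate R n -> nat) :
  (forall x c dd s, cnt (jstep x c dd k s) = cnt s \/ cnt (jstep x c dd k s) = (cnt s).+1) ->
  (forall z, cnt (jobinit z) = 0%N) ->
  (forall z s, cnt s <= cnt (jobstep z s))%N /\ (forall z j, cnt (js z j) <= j)%N.
Proof.
move=> h c0; have h1 z s : (cnt s <= cnt (jobstep z s) <= (cnt s).+1)%N.
  by rewrite /jobstep; case: (h (xin z) (cin z) (ddin z) s) => ->; rewrite ?leqnn ?leqnSn.
split=> [z s|z j]; first by have /andP[] := h1 z s.
elim: j => [|j IH]; first by rewrite /trajectory /= c0.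
by rewrite trajectoryS; have /andP[_ h2] := h1 z (js z j); rewrite (leq_trans h2).
Qed.

Lemma jarr_counter i : (forall z s, jarr s i <= jarr (jobstep z s) i)%N /\
  (forall z j, jarr (js z j) i <= j)%N.
Proof. by apply: (job_counter (cnt := fun s => jarr s i)) => // *; exact: jarr_step. Qed.

Lemma jpc_counter : (forall z s, jpc s <= jpc (jobstep z s))%N /\
  (forall z j, jpc (js z j) <= j)%N.
Proof. by apply: job_counter => // *; exact: jpc_step. Qed.

Lemma jrc_counter : (forall z s, jrc s <= jrc (jobstep z s))%N /\
  (forall z j, jrc (js z j) <= j)%N.
Proof. by apply: job_counter => // *; exact: jrc_step. Qed.

Definition jlag z j : R := ju (js z j.+1) - ju (js z j).

Lemma jlag_ge0 z j : 0 <= jlag z j.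
Proof. by rewrite subr_ge0; exact: job_clock_mono. Qed.

Definition jserved z N : R := \sum_(j < N) (jserving (js z j))%:R * jlag z j.
Definition jpreempted z N : R :=
  \sum_(j < N) (jserving (js z j))%:R * jhits k (js z j) (js z j.+1).
Definition jgain (L : R) z N : R :=
  \sum_(j < N) jsurvival L (js z j) * (expR (L * jlag z j) - 1).
Definition jloss (L : R) z N : R := \sum_(j < N) jsurvival L (js z j) *
    (jhits k (js z j) (js z j.+1) * expR (L * jlag z j)).
Definition jwork z N : R := szin z k 0 + jpauses (cin z) k (js z N) + jresumes (ddin z) k (js z N).

Lemma jrem_served z N : jserved z N + jrem (js z N) = szin z k 0.
Proof.
elim: N => [|N IH]; first by rewrite /jserved big_ord0 add0r.
have -> : jserved z N.+1 = jserved z N + (jserving (js z N))%:R * jlag z N.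
  exact: big_ord_recr.
rewrite -IH /jlag trajectoryS /jobstep jrem_step; lra.
Qed.

Lemma jwork_clock z N : ju (js z N) + jrem (js z N) + jresidual (js z N) = jwork z N.
Proof.
rewrite /jwork; elim: N => [|N IH].
  rewrite /trajectory /= /jresidual /jpauses /jresumes /= !big_ord0.
  by rewrite add0r !addr0.
have := jwork_step (xin z) (cin z) (ddin z) k (js z N).
by rewrite -[jstep _ _ _ _ _]/(js z N.+1) => e; lra.
Qed.

Lemma jresume_balance (L : R) z N :
  jpreempted z N + jsurvival L (js z N) + jloss L z N =
  jdiscount (ddin z) k L (js z N) + jgain L z N + (jblocked (js z N))%:R.
Proof.
elim: N => [|N IH].
  rewrite /jpreempted /jgain /jloss !big_ord0 /jdiscount /jsurvival /jblocked.
  by rewrite /trajectory /= big_ord0 !addr0.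
have -> : jpreempted z N.+1 = jpreempted z N +
    (jserving (js z N))%:R * jhits k (js z N) (js z N.+1) by exact: big_ord_recr.
have -> : jgain L z N.+1 = jgain L z N + jsurvival L (js z N) * (expR (L * jlag z N) - 1).
  exact: big_ord_recr.
have -> : jloss L z N.+1 = jloss L z N + jsurvival L (js z N) *
    (jhits k (js z N) (js z N.+1) * expR (L * jlag z N)) by exact: big_ord_recr.
have := jresume_step (xin z) (cin z) (ddin z) k L (js z N).
by rewrite -[jstep _ _ _ _ _]/(js z N.+1) /= -/(jlag z N) => e; lra.
Qed.

Lemma done_stable z N M : (N <= M)%N -> is_done (js z N) -> js z M = js z N.
Proof.
move=> NM dN; rewrite -(subnKC NM); elim: (M - N)%N => [|l IH]; first by rewrite addn0.
by rewrite addnS trajectoryS IH /jobstep done_step.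
Qed.

Lemma jwork_mono z N M : (N <= M)%N -> jwork z N <= jwork z M.
Proof.
move=> NM; have mono (F : nat -> R) a b : (a <= b)%N -> (forall m, 0 <= F m) ->
    \sum_(m < a) F m <= \sum_(m < b) F m.
  move=> ab F0; rewrite -(subnKC ab) big_split_ord /= lerDl; exact: sumr_ge0.
have homo (cnt : jstate R n -> nat) : (forall z s, cnt s <= cnt (jobstep z s))%N ->
    (cnt (js z N) <= cnt (js z M))%N.
  by move=> h; apply: (homo_leq leqnn leq_trans (f := fun j => cnt (js z j))) => // l; exact: h.
rewrite /jwork -!addrA lerD2l; apply: lerD.
  by apply: mono; [apply: homo; exact: jpc_counter.1|move=> m; exact: cin_ge0].
by apply: mono; [apply: homo; exact: jrc_counter.1|move=> m; exact: ddin_ge0].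
Qed.

Definition esize z : \bar R := effective_size (xin z) (szin z) (cin z) (ddin z) k.

(** A completed job has no remainder and no residual, so its effective size is its work at
    completion; work is nondecreasing in [N] and constant afterwards. A job that never completes has
    effective size [+oo]. *)
Lemma esize_ge z N : ((jwork z N)%:E <= esize z)%E.
Proof.
rewrite /esize /effective_size; case: pselect => [H|_]; last exact: leey.
rewrite lee_fin; case: ex_minnP => m dm _.
rewrite -[iter _ _ _]/(js z m) in dm *.
have -> : ju (js z m) = jwork z m.
  rewrite -jwork_clock (jcon_done (jsound_tr z m) dm) /jresidual.
  by move: dm; rewrite /is_done; case: (jph _) => // _; rewrite !addr0.
have [Nm|mN] := leqP N m; first exact: jwork_mono.
rewrite [leLHS](_ : _ = jwork z m)//; rewrite /jwork.
by rewrite (done_stable (ltnW mN) dm).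
Qed.

Lemma esize_done z : (esize z < +oo)%E -> exists N, is_done (js z N).
Proof. by rewrite /esize /effective_size; case: pselect. Qed.

Lemma served_done z N : szin z k 0 * (is_done (js z N))%:R <= jserved z N.
Proof.
have rem0 := jcon_rem (jsound_tr z N); rewrite -(jrem_served z N).
case d: (is_done (js z N)).
  by rewrite (jcon_done (jsound_tr z N) d) addr0 mulr1.
by rewrite mulr0; apply: sumr_ge0 => j _; rewrite mulr_ge0 ?jlag_ge0.
Qed.

Lemma jblocked_done z N :
  (jblocked (js z N))%:R + (is_done (js z N))%:R <= 1 :> R.
Proof. by rewrite /jblocked /is_done; case: (jph _) => *; rewrite ?addr0 ?add0r. Qed.

Lemma jsurvival_ge0 (L : R) s : 0 <= jsurvival (n := n) L s.
Proof. by rewrite /jsurvival; case: jph => // ? []// *; exact: expR_ge0. Qed.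

Lemma jlag_end z j e : jend (js z j) = Some e -> ju (js z j.+1) <= e.
Proof.
move=> ee; rewrite trajectoryS /jobstep.
case: (jstepP (xin z) (cin z) (ddin z) k (js z j)) => [i t e' _ _ _ ee' te|e' ee' _|ee'].
- by rewrite ju_arrive ?ee'//; move: ee'; rewrite ee => -[->].
- by rewrite ju_finish ?ee'//; move: ee'; rewrite ee => -[->].
- by rewrite ee' in ee.
Qed.

Lemma jsurvival_lag_le1 (L : R) z j : 0 <= L ->
  jsurvival L (js z j) * expR (L * jlag z j) <= 1.
Proof.
move=> L0; have le := @jlag_end z j; move: le; rewrite /jsurvival /jend.
case: (jph _) => [|u|u b|] le; rewrite ?mul0r ?ler01//.
case: b le => le; rewrite ?mul0r ?ler01//.
rewrite -expRD -expR0 ler_expR /jlag.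
rewrite (_ : _ + _ = - (L * (u - ju (js z j.+1)))); last by ring.
by rewrite oppr_le0 mulr_ge0// subr_ge0 le.
Qed.

Lemma jobstep_dep (cnt : jstate R n -> nat) z z' s m :
  (jobstep z' s = jobstep z s \/
   cnt s = m /\ cnt (jobstep z' s) = m.+1 /\ cnt (jobstep z s) = m.+1) ->
  jobstep z' s = jobstep z s \/ (m < cnt (jobstep z s) /\ m < cnt (jobstep z' s))%N.
Proof. by case=> [->|[_ [-> ->]]]; [left|right]. Qed.

Lemma jobstep_pause_dep m z z' s :
  let z1 := resample (true, false, k, m) z z' in
  jobstep z1 s = jobstep z s \/ (m < jpc (jobstep z s) /\ m < jpc (jobstep z1 s))%N.
Proof.
apply: (jobstep_dep (cnt := @jpc R n)).
rewrite /jobstep resample_xin// resample_ddin//.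
by apply: jstep_pause_dep; exact: agree_cin.
Qed.

Lemma jobstep_resume_dep m z z' s :
  let z1 := resample (true, true, k, m) z z' in
  jobstep z1 s = jobstep z s \/ (m < jrc (jobstep z s) /\ m < jrc (jobstep z1 s))%N.
Proof.
apply: (jobstep_dep (cnt := @jrc R n)).
rewrite /jobstep resample_xin// resample_cin//.
by apply: jstep_resume_dep; exact: agree_ddin.
Qed.

Lemma jdue_resample i m z z' s : jarr s i = m ->
  jdue (xin (resample (arrival_tag i m) z z')) s i =
  epoch (arrival_tag i) pos z m + pos (z' (arrival_tag i m)).
Proof.
move=> nm; rewrite /jdue nm -[arrT _ _ _]/(epoch (arrival_tag i) pos _ m.+1).
by rewrite epoch_resampleS// => a b [].
Qed.

Lemma jdue_resample_other i m z z' s (j : 'I_n) : j != i ->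
  jdue (xin (resample (arrival_tag i m) z z')) s j = jdue (xin z) s j.
Proof. by move=> ji; apply: agree_arrT; [exact: agree_xin|rewrite ji]. Qed.

Lemma jobstep_before i m z z' s : (jarr s i < m)%N ->
  jobstep (resample (arrival_tag i m) z z') s = jobstep z s.
Proof.
move=> nm; rewrite /jobstep resample_cin// resample_ddin//.
apply: jstep_due_eq => j _; apply: agree_arrT; first exact: agree_xin.
by have [->|//] := eqVneq j i; rewrite nm orbT.
Qed.

Lemma jobstep_alt i m z z' s : (i < k)%N -> jarr s i = m ->
  (jarr (jobstep z s) i <= m)%N ->
  ju (jobstep z s) < epoch (arrival_tag i) pos z m + pos (z' (arrival_tag i m)) ->
  jobstep (resample (arrival_tag i m) z z') s = jobstep z s.
Proof.
move=> ik nm; rewrite /jobstep => cm lt.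
rewrite resample_cin// resample_ddin//.
apply: (@jstep_delay _ _ _ _ _ _ _ _ i) => // [j ji||].
- exact: jdue_resample_other.
- by rewrite nm.
- by rewrite jdue_resample.
Qed.

Lemma jobstep_race i m z s : (i < k)%N -> jarr s i = m -> jend s <> None ->
  exists B, forall z', let y := resample (arrival_tag i m) z z' in
    [/\ ju (jobstep y s) = Num.min (epoch (arrival_tag i) pos z m + pos (z' (arrival_tag i m))) B,
        epoch (arrival_tag i) pos z m + pos (z' (arrival_tag i m)) < B ->
          jarr (jobstep y s) i = m.+1 &
        B < epoch (arrival_tag i) pos z m + pos (z' (arrival_tag i m)) ->
          jarr (jobstep y s) i = m].
Proof.
move=> ik nm busy.
have [B HB] := @jstep_race_bound _ _ (xin z) (cin z) (ddin z) k s i ik busy.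
exists B => z' y; rewrite /jobstep /y resample_cin// resample_ddin//.
have [|h1 h2 h3] := HB (xin y); first by move=> j ji; exact: jdue_resample_other.
by rewrite jdue_resample// nm in h1 h2 h3.
Qed.

Lemma measurable_js (g : jstate R n -> R) j :
  (forall s : Z -> jstate R n, jstate_class s -> measurable_fun setT (fun z => g (s z))) ->
  measurable_fun setT (fun z => g (js z j)).
Proof.
by apply: measurable_jiter => i m;
  [exact: measurable_xin|exact: measurable_cin|exact: measurable_ddin|exact: measurable_szin].
Qed.

Lemma measurable_ju j : measurable_fun setT (fun z => ju (js z j)).
Proof. by apply: measurable_js => s []. Qed.

Lemma measurable_jarr i j : measurable_fun setT (fun z => (jarr (js z j) i)%:R : R).
Proof.
by apply: (measurable_js (g := fun s => (jarr s i)%:R)) => s [] *; exact: measurable_cst.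
Qed.

Lemma measurable_jpc j : measurable_fun setT (fun z => (jpc (js z j))%:R : R).
Proof.
by apply: (measurable_js (g := fun s => (jpc s)%:R)) => s [] *; exact: measurable_cst.
Qed.

Lemma measurable_jrc j : measurable_fun setT (fun z => (jrc (js z j))%:R : R).
Proof.
by apply: (measurable_js (g := fun s => (jrc s)%:R)) => s [] *; exact: measurable_cst.
Qed.

Lemma measurable_jserving j : measurable_fun setT (fun z => (jserving (js z j))%:R : R).
Proof.
by apply: (measurable_js (g := fun s => (jserving s)%:R)) => s [? ? ? ? ? ? _ _ []] *;
  exact: measurable_cst.
Qed.

Lemma measurable_jblocked j : measurable_fun setT (fun z => (jblocked (js z j))%:R : R).
Proof.
by apply: (measurable_js (g := fun s => (jblocked s)%:R)) => s [? ? ? ? ? ? _ _ []] *;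
  exact: measurable_cst.
Qed.

Lemma measurable_jdone j : measurable_fun setT (fun z => (is_done (js z j))%:R : R).
Proof.
by apply: (measurable_js (g := fun s => (is_done s)%:R)) => s [? ? ? ? ? ? _ _ []] *;
  exact: measurable_cst.
Qed.

Lemma measurable_jsurvival (L : R) j : measurable_fun setT (fun z => jsurvival L (js z j)).
Proof.
apply: measurable_js => s [u na r pc rc ph mu mr [|e me|e b me|]]; rewrite /jsurvival /=;
  try exact: measurable_cst.
case: b; first exact: measurable_cst.
apply: measurableT_comp => //; apply: measurable_funM; first exact: measurable_cst.
exact: measurable_funB.
Qed.

Lemma measurable_esize : measurable_fun setT esize.
Proof.
by apply: measurable_effective_size => i m;
  [exact: measurable_xin|exact: measurable_cin|exact: measurable_ddin|exact: measurable_szin].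
Qed.

End JobPaths.

(** * Expectations for a single job *)

Section JobExpectations.
Context {R : realType} {n : nat}.
Notation Z := (@inputsp R (@tagT n)).
Variables (Q : probability Z R) (lam : 'I_n -> R).
Hypothesis lam_gt0 : forall i, 0 < lam i.
Hypothesis LQ : input_law Q lam.
Variable k : 'I_n.
Notation js := (trajectory (jobstep k) (jobinit k)).
Implicit Types (z : Z) (i : 'I_n) (N j : nat).
Notation L := (higher_rate lam k).

Lemma job_compensator i (g : jstate R n -> R) (f F : R -> R) j : (i < k)%N ->
  (forall s, g s != 0 -> jend s <> None) -> (forall s, 0 <= g s) ->
  (forall j, measurable_fun setT (fun z => g (js z j))) ->
  continuous f -> (forall t : R, is_derive t 1 F (lam i * f t)) ->
  F 0 = 0 -> (forall t, 0 <= t -> 0 <= f t) -> (forall t, 0 <= t -> 0 <= F t) ->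
  Ex Q (fun z => g (js z j) *
    (((jarr (js z j.+1) i)%:R - (jarr (js z j) i)%:R) * f (jlag k z j))) =
  Ex Q (fun z => g (js z j) * F (jlag k z j)).
Proof.
move=> ik gb g0 mg cf dF F0 f0 FF0.
apply: (@compensator _ _ _ (jobstep k) (jobinit k) (arrival_tag i) pos
  (fun s => jarr s i) (@ju R n) g _ _ _ _ _ _ _ _ _ _ _ Q (lam i)) => //.
- by move=> a b [].
- exact: pos_id.
- by move=> m z z' s; exact: jobstep_before.
- by move=> m z z' s; exact: jobstep_alt.
- by move=> m z s nm /gb; exact: jobstep_race.
- by move=> z s; exact: (jarr_counter k i).1.
- by move=> z l; exact: job_clock_mono.
- by move=> z l; have /andP[] := jcon_time (jsound_tr k z l) ik.
- by move=> z l; have /andP[] := jcon_time (jsound_tr k z l) ik.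
- exact: law_indep LQ.
- by move=> m A mA; exact: law_arrival LQ _ _ _ mA.
- by move=> z l; exact: (jarr_counter k i).2.
- by move=> l; exact: measurable_jarr.
- by move=> l; exact: measurable_ju.
Qed.

Lemma nnmeas_jlag j : nnmeas (fun z => jlag k z j).
Proof.
by split; [apply: measurable_funB; exact: measurable_ju|move=> z; exact: jlag_ge0].
Qed.

Definition jjump i z j : R := (jarr (js z j.+1) i)%:R - (jarr (js z j) i)%:R.

Lemma nnmeas_jjump i j : nnmeas (fun z => jjump i z j).
Proof.
split; first by apply: measurable_funB; exact: measurable_jarr.
by move=> z; rewrite subr_ge0 ler_nat trajectoryS; exact: (jarr_counter k i).1.
Qed.

Lemma jhits_jump z j :
  jhits k (js z j) (js z j.+1) = \sum_(i < n | (i < k)%N) jjump i z j.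
Proof. by []. Qed.

Lemma nnmeas_jhits j : nnmeas (fun z => jhits k (js z j) (js z j.+1)).
Proof. by apply: nnmeas_sum => i; exact: nnmeas_jjump. Qed.

Lemma nnmeas_jserving j : nnmeas (fun z => (jserving (js z j))%:R : R).
Proof. by split; [exact: measurable_jserving|move=> z; exact: ler0n]. Qed.

Lemma nnmeas_jserved N : nnmeas (fun z => jserved k z N).
Proof.
by apply: nnmeas_sum => j; apply: nnmeasM; [exact: nnmeas_jserving|exact: nnmeas_jlag].
Qed.

Lemma Ex_jpreempted N : Ex Q (fun z => jpreempted k z N) =
  (L%:E * Ex Q (fun z => jserved k z N))%E.
Proof.
rewrite /jpreempted Ex_sum => [|j]; last first.
  by apply: nnmeasM; [exact: nnmeas_jserving|exact: nnmeas_jhits].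
rewrite /jserved Ex_sum => [|j]; last first.
  by apply: nnmeasM; [exact: nnmeas_jserving|exact: nnmeas_jlag].
rewrite ge0_sume_distrr => [|j _]; last first.
  by apply: Ex_ge0 => z; rewrite mulr_ge0 ?(nnmeas_jserving _).2 ?jlag_ge0.
apply: eq_bigr => j _.
have nng := nnmeas_jserving j.
transitivity (Ex Q (fun z => \sum_(i < n | (i < k)%N) (jserving (js z j))%:R * jjump i z j)).
  by apply: Ex_eq => z; rewrite jhits_jump mulr_sumr.
rewrite Ex_sum => [|i]; last by apply: nnmeasM => //; exact: nnmeas_jjump.
rewrite -sumEFin ge0_sume_distrl => [|i _]; last by rewrite lee_fin ltW.
apply: eq_bigr => i ik.
transitivity (Ex Q (fun z => (jserving (js z j))%:R * (jjump i z j * 1))).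
  by apply: Ex_eq => z; rewrite mulr1.
rewrite (@job_compensator i (fun s => (jserving s)%:R) (fun=> 1) (fun t => lam i * t) j)//.
- rewrite -ExZ ?ltW//; last by apply: nnmeasM => //; exact: nnmeas_jlag.
  by apply: Ex_eq => z; rewrite mulrCA.
- by move=> s; rewrite /jserving /jend; case: jph => //=; rewrite eqxx.
- by move=> l; exact: measurable_jserving.
- by move=> t; exact: cst_continuous.
- by rewrite mulr0.
- by move=> t t0; rewrite mulr_ge0// ltW.
Qed.

Let nnjexp j : nnmeas (fun z => expR (L * jlag k z j)).
Proof.
split; last by move=> z; exact: expR_ge0.
apply: measurableT_comp => //; apply: measurable_funM; first exact: measurable_cst.
exact: (nnmeas_jlag j).1.
Qed.

Let nnjexp1 j : nnmeas (fun z => expR (L * jlag k z j) - 1).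
Proof.
split; first by apply: measurable_funB; [exact: (nnjexp j).1|exact: measurable_cst].
by move=> z; rewrite subr_ge0 -expR0 ler_expR mulr_ge0 ?jlag_ge0 ?higher_rate_ge0.
Qed.

Let nnjsurvival j : nnmeas (fun z => jsurvival L (js z j)).
Proof. by split; [exact: measurable_jsurvival|move=> z; exact: jsurvival_ge0]. Qed.

Lemma Ex_jloss N : (0 < k)%N ->
  Ex Q (fun z => jloss k L z N) = Ex Q (fun z => jgain k L z N).
Proof.
move=> k_gt0; have L0 : 0 < L by exact: higher_rate_gt0.
rewrite /jloss /jgain Ex_sum => [|j]; last first.
  by apply: nnmeasM => //; apply: nnmeasM => //; exact: nnmeas_jhits.
rewrite Ex_sum => [|j]; last exact: nnmeasM.
apply: eq_bigr => j _.
have gb (s : jstate R n) : jsurvival L s != 0 -> jend s <> None.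
  by rewrite /jsurvival /jend; case: jph => //; rewrite eqxx.
have g0 (s : jstate R n) : 0 <= jsurvival L s by exact: jsurvival_ge0.
have mg l : measurable_fun setT (fun z => jsurvival L (js z l)) by exact: measurable_jsurvival.
have gain0 i t : 0 <= t -> 0 <= lam i / L * (expR (L * t) - 1).
  move=> t0; apply: mulr_ge0; first by rewrite divr_ge0// ltW.
  by rewrite subr_ge0 -expR0 ler_expR mulr_ge0// ltW.
transitivity (Ex Q (fun z => \sum_(i < n | (i < k)%N)
    jsurvival L (js z j) * (jjump i z j * expR (L * jlag k z j)))).
  by apply: Ex_eq => z; rewrite jhits_jump mulr_suml mulr_sumr.
rewrite Ex_sum => [|i]; last first.
  by apply: nnmeasM => //; apply: nnmeasM => //; exact: nnmeas_jjump.
transitivity (\sum_(i < n | (i < k)%N)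
    Ex Q (fun z => jsurvival L (js z j) * (lam i / L * (expR (L * jlag k z j) - 1)))%R)%E.
  apply: eq_bigr => i ik.
  have dF (t : R) : is_derive t 1 (fun t => lam i / L * (expR (L * t) - 1))
      (lam i * expR (L * t)).
    by apply: is_derive_exp_gain; rewrite gt_eqF.
  apply: (@job_compensator i (jsurvival L) (fun t => expR (L * t)) _ j ik gb g0 mg _ dF).
  - exact: continuous_expRM.
  - by rewrite mulr0 expR0 subrr mulr0.
  - by move=> t _; exact: expR_ge0.
  - exact: gain0.
rewrite -Ex_sum => [|i]; last first.
  apply: nnmeasM => //; split; last by move=> z; apply: gain0; exact: jlag_ge0.
  by apply: measurable_funM; [exact: measurable_cst|exact: (nnjexp1 j).1].
apply: Ex_eq => z; rewrite -mulr_sumr -mulr_suml -mulr_suml divff ?gt_eqF//.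
by rewrite mul1r.
Qed.

Lemma wald_jpause N (h : R -> R) : measurable_fun setT h -> (forall v, 0 <= h v) ->
  Ex Q (fun z => \sum_(m < jpc (js z N)) h (z (true, false, k, m : nat))) =
  (Ex Q (fun z => (jpc (js z N))%:R) * Ex Q (fun z => h (z (true, false, k, 0%N))))%E.
Proof.
move=> mh h0; apply: (@wald _ _ _ (jobstep k) (jobinit k) Q (law_indep LQ)
  (@jpc R n) (fun m => (true, false, k, m))) => //.
- by move=> m z z' s _; exact: jobstep_pause_dep.
- by move=> z s; exact: (jpc_counter k).1.
- by move=> z j; exact: (jpc_counter k).2.
- by move=> j; exact: measurable_jpc.
- by move=> m; exact: (Ex_copy LQ).
Qed.

Lemma wald_jresume N (h : R -> R) : measurable_fun setT h -> (forall v, 0 <= h v) ->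
  Ex Q (fun z => \sum_(m < jrc (js z N)) h (z (true, true, k, m : nat))) =
  (Ex Q (fun z => (jrc (js z N))%:R) * Ex Q (fun z => h (z (true, true, k, 0%N))))%E.
Proof.
move=> mh h0; apply: (@wald _ _ _ (jobstep k) (jobinit k) Q (law_indep LQ)
  (@jrc R n) (fun m => (true, true, k, m))) => //.
- by move=> m z z' s _; exact: jobstep_resume_dep.
- by move=> z s; exact: (jrc_counter k).1.
- by move=> z j; exact: (jrc_counter k).2.
- by move=> j; exact: measurable_jrc.
- by move=> m; exact: (Ex_copy LQ).
Qed.

Let nnsz : nnmeas (fun z => szin z k 0).
Proof. by split; [exact: measurable_szin|move=> z; rewrite ltW ?szin_gt0]. Qed.

Let nnjpauses N : nnmeas (fun z => jpauses (cin z) k (js z N)).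
Proof.
apply: (@nnmeas_counter_sum _ _ _ (jobstep k) (jobinit k) (@jpc R n)
  (fun m => (true, false, k, m)) nonneg).
- by move=> z j; exact: (jpc_counter k).2.
- by move=> j; exact: measurable_jpc.
- exact: measurable_nonneg.
- exact: nonneg_ge0.
Qed.

Let nnjresumes N : nnmeas (fun z => jresumes (ddin z) k (js z N)).
Proof.
apply: (@nnmeas_counter_sum _ _ _ (jobstep k) (jobinit k) (@jrc R n)
  (fun m => (true, true, k, m)) nonneg).
- by move=> z j; exact: (jrc_counter k).2.
- by move=> j; exact: measurable_jrc.
- exact: measurable_nonneg.
- exact: nonneg_ge0.
Qed.

Lemma Ex_jwork N : Ex Q (fun z => jwork k z N) =
  (Ex Q (fun z => szin z k 0) +
   Ex Q (fun z => (jpc (js z N))%:R) * Ex Q (fun z => cin z k 0) +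
   Ex Q (fun z => (jrc (js z N))%:R) * Ex Q (fun z => ddin z k 0))%E.
Proof.
rewrite /jwork !ExD//; last exact: nnmeasD.
by rewrite -(wald_jpause N measurable_nonneg nonneg_ge0)
  -(wald_jresume N measurable_nonneg nonneg_ge0).
Qed.

Lemma nnmeas_jrc N : nnmeas (fun z => (jrc (js z N))%:R : R).
Proof. by split; [exact: measurable_jrc|move=> z; exact: ler0n]. Qed.

(** Each resume follows a pause, so [jpc >= jrc], and the number of resumes alone bounds both kinds
    of overhead from below. *)
Lemma Ex_esize_ge N :
  (Ex Q (fun z => szin z k 0) + Ex Q (fun z => (jrc (js z N))%:R) *
    (Ex Q (fun z => cin z k 0) + Ex Q (fun z => ddin z k 0)) <= \int[Q]_z esize k z)%E.
Proof.
have e0 : (0 <= Ex Q (fun z => cin z k 0))%E by apply: Ex_ge0 => z; exact: cin_ge0.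
have e1 : (0 <= Ex Q (fun z => ddin z k 0))%E by apply: Ex_ge0 => z; exact: ddin_ge0.
apply: (@le_trans _ _ (Ex Q (fun z => jwork k z N))).
  rewrite Ex_jwork ge0_muleDr// addeA; apply: leeD => //; apply: leeD => //.
  apply: lee_wpmul2r => //; apply: Ex_le; first exact: nnmeas_jrc.
    by split; [exact: measurable_jpc|move=> z; exact: ler0n].
  by move=> z; rewrite ler_nat (jcon_balance (jsound_tr k z N)) leq_addr.
have nnw : nnmeas (fun z => jwork k z N) by apply: nnmeasD => //; exact: nnmeasD.
apply: ge0_le_integral => //.
- by move=> z _; rewrite lee_fin nnw.2.
- by apply/measurable_EFinP; exact: nnw.1.
- exact: measurable_esize.
- by move=> z _; exact: esize_ge.
Qed.

(** The balance of the isolated job read in the other direction: a completed job has been served in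
    full, so preemptions have mean at least [L * E[S; done]]. The indicator of [is_done] is added on
    both sides because it excludes [jblocked]: the remaining 1 then cancels in the limit, where the
    job is done almost surely. *)
Lemma Ex_done_le N : (0 < k)%N ->
  (Ex Q (fun z => (L * szin z k 0 + 1) * (is_done (js z N))%:R)%R <=
   Ex Q (fun z => (jrc (js z N))%:R) * Ex Q (discount lam k) + 1)%E.
Proof.
move=> k0; have L0 := higher_rate_ge0 lam_gt0 k.
pose h v : R := expR (- L * nonneg v).
have mh : measurable_fun setT h.
  apply: measurableT_comp => //; apply: measurable_funM; first exact: measurable_cst.
  exact: measurable_nonneg.
have h0 v : 0 <= h v by exact: expR_ge0.
rewrite -(wald_jresume N mh h0).
have nndis : nnmeas (fun z => \sum_(m < jrc (js z N)) h (z (true, true, k, m : nat))).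
  apply: (@nnmeas_counter_sum _ _ _ (jobstep k) (jobinit k) (@jrc R n)
    (fun m => (true, true, k, m))) => //.
    by move=> z j; exact: (jrc_counter k).2.
  by move=> j; exact: measurable_jrc.
have nngain : nnmeas (fun z => jgain k L z N).
  by apply: nnmeas_sum => j; exact: nnmeasM.
have nnloss : nnmeas (fun z => jloss k L z N).
  apply: nnmeas_sum => j; apply: nnmeasM => //; apply: nnmeasM => //.
  exact: nnmeas_jhits.
have nnpre : nnmeas (fun z => jpreempted k z N).
  by apply: nnmeas_sum => j; apply: nnmeasM; [exact: nnmeas_jserving|exact: nnmeas_jhits].
have nnbl : nnmeas (fun z => (jblocked (js z N))%:R : R).
  by split; [exact: measurable_jblocked|move=> z; exact: ler0n].
have nndone : nnmeas (fun z => (is_done (js z N))%:R : R).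
  by split; [exact: measurable_jdone|move=> z; exact: ler0n].
have gain_fin : Ex Q (fun z => jgain k L z N) \is a fin_num.
  rewrite /jgain; apply: (@Ex_fin _ _ _ Q _ N%:R) => // z.
  apply: (@le_trans _ _ (\sum_(j < N) 1)); last by rewrite sumr_const card_ord.
  apply: ler_sum => j _; rewrite mulrBr mulr1.
  rewrite lerBlDr (le_trans (jsurvival_lag_le1 k z j L0))// lerDl.
  exact: (nnjsurvival j).2.
have e : (Ex Q (fun z => jpreempted k z N) + Ex Q (fun z => jsurvival L (js z N)) +
    Ex Q (fun z => jgain k L z N) =
    Ex Q (fun z => \sum_(m < jrc (js z N)) h (z (true, true, k, m : nat)))%R +
    Ex Q (fun z => jgain k L z N) +
    Ex Q (fun z => (jblocked (js z N))%:R))%E.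
  rewrite -{1}(Ex_jloss N k0) -!ExD//; last 2 first.
  - exact: nnmeasD.
  - exact: nnmeasD.
  by apply: Ex_eq => z; exact: jresume_balance.
have e2 : (Ex Q (fun z => jpreempted k z N) <=
    Ex Q (fun z => \sum_(m < jrc (js z N)) h (z (true, true, k, m : nat)))%R +
    Ex Q (fun z => (jblocked (js z N))%:R))%E.
  rewrite -(leeD2rE _ _ gain_fin).
  apply: (@le_trans _ _ (Ex Q (fun z => jpreempted k z N) +
    Ex Q (fun z => jsurvival L (js z N)) + Ex Q (fun z => jgain k L z N))%E).
    rewrite leeD2r// leeDl//; apply: Ex_ge0 => z; exact: jsurvival_ge0.
  by rewrite e addeAC.
apply: (@le_trans _ _ (Ex Q (fun z => jpreempted k z N) +
    Ex Q (fun z => (is_done (js z N))%:R))%E).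
  rewrite Ex_jpreempted -ExZ//; last exact: nnmeas_jserved.
  rewrite -ExD//; last by apply: nnmeasM; [exact: nnmeas_cst|exact: nnmeas_jserved].
  apply: Ex_le.
  - apply: nnmeasM => //; apply: nnmeasD; last exact: (nnmeas_cst Z ler01).
    by apply: nnmeasM => //; exact: nnmeas_cst.
  - apply: nnmeasD => //; apply: nnmeasM; last exact: nnmeas_jserved.
    exact: nnmeas_cst.
  - move=> z; rewrite mulrDl mul1r -mulrA lerD2r ler_wpM2l//.
    exact: served_done.
apply: (@le_trans _ _ (Ex Q (fun z => \sum_(m < jrc (js z N)) h (z (true, true, k, m : nat)))%R +
    (Ex Q (fun z => (jblocked (js z N))%:R) + Ex Q (fun z => (is_done (js z N))%:R)))%E).
  by rewrite [leRHS]addeA; apply: leeD2r.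
apply: leeD2l; rewrite -ExD// -(Ex_cst Q 1); apply: Ex_le.
- exact: nnmeasD.
- exact: (nnmeas_cst Z ler01).
- by move=> z; exact: jblocked_done.
Qed.

Hypothesis esize_fin : (\int[Q]_z esize k z < +oo)%E.

Lemma esize_ge0 z : (0 <= esize k z)%E.
Proof.
apply: le_trans (esize_ge k z 0); rewrite lee_fin !addr_ge0 ?(ltW (szin_gt0 _ _ _))//.
  by apply: sumr_ge0 => m _; exact: cin_ge0.
by apply: sumr_ge0 => m _; exact: ddin_ge0.
Qed.

(** A job that never completes has infinite effective size, which a finite mean excludes almost
    surely. *)
Lemma ae_done : {ae Q, forall z, exists N, is_done (js z N)}.
Proof.
have : Q.-integrable setT (esize k).
  apply/integrableP; split; first exact: measurable_esize.
  by under eq_integral do rewrite gee0_abs ?esize_ge0//.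
move=> /(integrable_ae measurableT); apply: filterS => z /(_ I) ef.
by apply: (@esize_done _ _ k); rewrite ltey_eq ef.
Qed.

Lemma size_mean_le : (Ex Q (fun z => szin z k 0) <= \int[Q]_z esize k z)%E.
Proof.
apply: le_trans (Ex_esize_ge 0); rewrite leeDl// mule_ge0//.
  by apply: Ex_ge0 => z; exact: ler0n.
by apply: adde_ge0; apply: Ex_ge0 => z; [exact: cin_ge0|exact: ddin_ge0].
Qed.

(** The estimate [q * E[resumes] >= L * E[S]] is used in this form: every upper bound [K] of the
    means [J N] satisfies [L * a <= K * q]. The upper bound to insert is the one imposed by [E[R_k]
    = r]. *)
Lemma job_bound (a q r : R) : (0 < k)%N ->
  Ex Q (fun z => szin z k 0) = a%:E -> Ex Q (discount lam k) = q%:E -> 0 < q ->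
  (\int[Q]_z esize k z)%E = r%:E ->
  exists mc md : R, [/\ Ex Q (fun z => cin z k 0) = mc%:E,
    Ex Q (fun z => ddin z k 0) = md%:E & a * (1 + L * (mc + md) / q) <= r].
Proof.
move=> k0 aE qE q0 rE.
have L0 : 0 < L by exact: higher_rate_gt0.
have a0 : 0 < a.
  by rewrite -lte_fin -aE; apply: Ex_gt0; [exact: measurable_szin|move=> z; exact: szin_gt0].
pose J N := fine (Ex Q (fun z => (jrc (js z N))%:R)).
have JE N : Ex Q (fun z => (jrc (js z N))%:R) = (J N)%:E.
  rewrite /J fineK// (@Ex_fin _ _ _ Q _ N%:R)//; first exact: nnmeas_jrc.
  by move=> z; rewrite ler_nat; exact: (jrc_counter k).2.
have J0 N : 0 <= J N by rewrite -lee_fin -JE; apply: Ex_ge0 => z; exact: ler0n.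
have limit (K : R) : (forall N, J N <= K) -> L * a <= K * q.
  move=> JK; have nnt : nnmeas (fun z => L * szin z k 0 + 1).
    apply: nnmeasD; last exact: (nnmeas_cst Z ler01).
    by apply: nnmeasM => //; apply: nnmeas_cst; exact: ltW.
  have nnd N : nnmeas (fun z => (is_done (js z N))%:R : R).
    by split; [exact: measurable_jdone|move=> z; exact: ler0n].
  have : (\int[Q]_z (L * szin z k 0 + 1)%:E <= (K * q + 1)%:E)%E.
    apply: (@integral_exhaustion_le _ _ _ Q _
      (fun N z => (L * szin z k 0 + 1) * (is_done (js z N))%:R)).
    - by apply/measurable_EFinP; exact: nnt.1.
    - by move=> z; rewrite lee_fin nnt.2.
    - by move=> N; exact: nnmeasM.
    - move=> z m N mN; rewrite ler_wpM2l ?nnt.2//.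
      case d: (is_done (js z m)); last exact: ler0n.
      by rewrite (done_stable mN d) d.
    - by apply: filterS ae_done => z [N dN]; exists N; rewrite dN mulr1.
    - move=> N; apply: (le_trans (Ex_done_le N k0)).
      by rewrite JE qE -EFinM lee_fin lerD2r ler_wpM2r// ltW.
  have nnLs : nnmeas (fun z => L * szin z k 0) by apply: nnmeasM => //; exact: nnmeas_cst (ltW L0).
  have -> : (\int[Q]_z (L * szin z k 0 + 1)%:E = (L * a + 1)%:E)%E.
    transitivity (Ex Q (fun z => L * szin z k 0 + 1)%R); first by [].
    rewrite (ExD Q nnLs (nnmeas_cst Z ler01)) Ex_cst.
    by rewrite (ExZ _ (ltW L0) nnsz) aE -EFinM -EFinD.
  by rewrite lee_fin lerD2r.
(* Otherwise [K = 0] would be an upper bound and give [L * a <= 0]. *)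
have [N JN] : exists N, 0 < J N.
  apply: contrapT => h; have /limit : forall N, J N <= 0.
    by move=> N; rewrite leNgt; apply/negP => JN; apply: h; exists N.
  by rewrite mul0r leNgt mulr_gt0.
set EC := Ex Q (fun z => cin z k 0); set ED := Ex Q (fun z => ddin z k 0).
have EC0 : (0 <= EC)%E by apply: Ex_ge0 => z; exact: cin_ge0.
have ED0 : (0 <= ED)%E by apply: Ex_ge0 => z; exact: ddin_ge0.
have bound M : (a%:E + (J M)%:E * (EC + ED) <= r%:E)%E.
  by rewrite -JE -aE -rE; exact: Ex_esize_ge.
(* An infinite overhead mean, multiplied by [J N > 0], would exceed the finite [r]. *)
have fin : (EC + ED < +oo)%E.
  rewrite ltNge leye_eq; apply/negP => /eqP e; have := bound N.
  by rewrite e gt0_muley ?lte_fin// addey// leye_eq.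
have ECf : EC \is a fin_num.
  by rewrite ge0_fin_numE// (le_lt_trans _ fin)// leeDl.
have EDf : ED \is a fin_num.
  by rewrite ge0_fin_numE// (le_lt_trans _ fin)// leeDr.
exists (fine EC), (fine ED); split; rewrite ?fineK//.
set mc := fine EC; set md := fine ED.
have m0 : 0 <= mc + md by rewrite addr_ge0 ?fine_ge0.
have bnd M : a + J M * (mc + md) <= r.
  by rewrite -lee_fin EFinD EFinM EFinD (fineK ECf) (fineK EDf); exact: bound.
(* Overheads of mean zero leave nothing to divide by; the bound at step 0 is then [a <= r]. *)
have [m_eq0|m_neq0] := eqVneq (mc + md) 0.
  rewrite m_eq0 mulr0 mul0r addr0 mulr1.
  by have := bnd 0%N; rewrite m_eq0 mulr0 addr0.
have m_gt0 : 0 < mc + md by rewrite lt0r m_neq0.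
(* The lower bound on the mean effective size, solved for [J N], provides this [K]. *)
have := limit ((r - a) / (mc + md)) _.
have JK M : J M <= (r - a) / (mc + md).
  by rewrite ler_pdivlMr// lerBrDl.
move=> /(_ JK) h.
rewrite mulrDr mulr1 -lerBrDl mulrA ler_pdivrMr// (mulrCA a).
by move: h; rewrite mulrAC ler_pdivlMr// mulrA.
Qed.

End JobExpectations.

(** * The first busy period *)

Lemma measurable_first_empty_time d (Z : measurableType d) {R : realType} {n : nat}
    (x sz c dd : Z -> 'I_n -> nat -> R) :
  (forall i m, measurable_fun setT (fun z => x z i m)) ->
  (forall i m, measurable_fun setT (fun z => sz z i m)) ->
  (forall i m, measurable_fun setT (fun z => c z i m)) ->
  (forall i m, measurable_fun setT (fun z => dd z i m)) ->
  measurable_fun setT (fun z => first_empty_time (x z) (sz z) (c z) (dd z)).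
Proof.
move=> mx msz mc md.
pose it z j := iter j (step (x z) (sz z) (c z) (dd z)) (init R n).
have mit (g : state R n -> R) j :
    (forall s : Z -> state R n, state_class s -> measurable_fun setT (fun z => g (s z))) ->
    measurable_fun setT (fun z => g (it z j)).
  move=> h; apply: (piecewise_measurable (g := g) h (s := it^~ j)).
  elim: j => [|j IH].
    apply: piecewise_base.
    rewrite (_ : it^~ 0 = fun z : Z => State ((fun=> 0) z) (fun=> 0%N)
       (fun k => eval_seq ((fun=> [::]) k) z) (fun=> false) (fun=> 0%N) (fun=> 0%N)
       ((fun=> Idle R n) z)) //.
    apply: StateClass; [exact: measurable_cst| |exact: class_idle].
    by move=> k l; rewrite nth_nil; exact: measurable_cst.
  apply: (piecewise_bind (F := fun z => step (x z) (sz z) (c z) (dd z)) _ IH) => s.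
  exact: piecewise_step.
apply: (@measurable_first_hit _ _ _ (fun z N => (0 < N)%N && is_idle (it z N))
  (fun N z => now (it z N))).
- case=> [|N] /=; first by rewrite (_ : [set z | _] = set0)//; apply/seteqP; split.
  apply: (measurable_bool (R := R)); apply: (mit (fun s => (is_idle s)%:R) N.+1) => s.
  by case=> nw na qs pz np nr ca _ _ [] *; exact: measurable_cst.
- by move=> N; apply: mit => s [].
- move=> z N dN Nmin; rewrite /first_empty_time; case: pselect => [H|]; last by case; exists N.
  case: ex_minnP => m dm mmin; congr (now (iter _ _ _))%:E.
  by apply/eqP; rewrite eqn_leq Nmin// mmin.
- by move=> z nd; rewrite /first_empty_time; case: pselect.
Qed.

Section FirstBusyPeriod.
Context {R : realType} {n : nat}.
Notation Z := (@inputsp R (@tagT n)).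
Variable i0 : 'I_n.
Notation tr := (trajectory qstep (fun=> init R n)).
Implicit Types (z : Z) (N : nat).

Definition emptying z : \bar R := first_empty_time (xin z) (szin z) (cin z) (ddin z).

Lemma measurable_emptying : measurable_fun setT emptying.
Proof.
by apply: measurable_first_empty_time => i m;
  [exact: measurable_xin|exact: measurable_szin|exact: measurable_cin|exact: measurable_ddin].
Qed.

Lemma tr_iter z N : (forall m, (m < N)%N -> ~~ halted (tr z m)) ->
  tr z N = iter N (step (xin z) (szin z) (cin z) (ddin z)) (init R n).
Proof.
elim: N => [//|N IH] h; rewrite running_tr; last by apply/negbTE/h.
by rewrite IH// => m mN; apply: h; exact: ltnW.
Qed.

Lemma clock_homo z m N : (m <= N)%N -> now (tr z m) <= now (tr z N).
Proof.
move=> mN; apply: (homo_leq (f := fun j => now (tr z j)) (r := <=%R)) mN => //.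
  by move=> ? ? ?; exact: le_trans.
by move=> l; exact: clock_mono_tr i0 _ _.
Qed.

Lemma emptying_halted z N : halted (tr z N) ->
  exists m, (0 < m <= N)%N /\ emptying z = (now (tr z m))%:E.
Proof.
move=> hN; case: (ex_minnP (ex_intro (fun m => halted (tr z m)) N hN)) => m hm mmin.
have itE l : (l <= m)%N ->
    tr z l = iter l (step (xin z) (szin z) (cin z) (ddin z)) (init R n).
  move=> lm; apply: tr_iter => l' l'l; apply/negP => /mmin; rewrite leqNgt.
  by rewrite (leq_trans l'l).
have m0 : (0 < m)%N.
  rewrite lt0n; apply/eqP => m0; move: hm; rewrite m0 /halted /=.
  by move=> /existsP[].
exists m; rewrite m0 mmin//; split => //.
have im : is_idle (tr z m) by move: hm => /andP[].
rewrite /emptying /first_empty_time; case: pselect => [H|]; last first.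
  by case; exists m; rewrite m0 -itE.
case: ex_minnP => l /andP[l0 il] lmin.
have lm : (l <= m)%N by apply: lmin; rewrite m0 -itE.
have hl : halted (tr z l).
  move: il; rewrite -itE//; case: l l0 {lmin lm} => // l _.
  by rewrite /is_idle => il; apply: (idle_halted i0); case: (cur _) il.
have ml := mmin _ hl.
by rewrite -itE//; congr (now (tr z _))%:E; apply/eqP; rewrite eqn_leq lm.
Qed.

Lemma emptying_ge0 z : (0 <= emptying z)%E.
Proof.
have [[N hN]|nh] := pselect (exists N, halted (tr z N)).
  by have [m [_ ->]] := emptying_halted hN; rewrite lee_fin; exact: (clock_homo z (leq0n m)).
rewrite /emptying /first_empty_time; case: pselect => // H; exfalso.
case: H => N /andP[N0 iN].
have itE l : tr z l = iter l (step (xin z) (szin z) (cin z) (ddin z)) (init R n).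
  by apply: tr_iter => m _; apply/negP => hm; apply: nh; exists m.
apply: nh; exists N; move: iN; rewrite -itE; case: N N0 => // N _.
by rewrite /is_idle => il; apply: (idle_halted i0); case: (cur _) il.
Qed.

(** Only the initial state is idle in a run that never freezes, hence [N] busy states among the
    first [N.+1]. *)
Lemma busy_steps_running z N : (forall m, ~~ halted (tr z m)) ->
  busy_steps z N.+1 = N%:R.
Proof.
move=> nh; elim: N => [|N IH]; first by rewrite /busy_steps big_ord1 busy0.
rewrite busy_stepsS IH /busy -natr1; congr (_ + _).
have := nh N.+1; rewrite /is_idle; case e: (cur _) => //.
by rewrite (idle_halted i0 e).
Qed.

Variables (Q : probability Z R) (M : R).
Hypothesis now_bound : forall N, (Ex Q (fun z => now (tr z N)) <= M%:E)%E.
Hypothesis steps_bound : forall N, (Ex Q (fun z => busy_steps z N) <= M%:E)%E.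

(** By [busy_steps_running], [N * P(never frozen) <= M] for every [N]. The bound on the clock would
    not suffice here, as it says nothing about the number of steps. *)
Lemma ae_halted : {ae Q, forall z, exists N, halted (tr z N)}.
Proof.
pose A : set Z := \bigcap_N ~` [set z | halted (tr z N)].
have mh N : measurable [set z | halted (tr z N)].
  apply: (measurable_bool (R := R)).
  apply: (measurable_tr (g := fun s => (halted s)%:R)) => s.
  case=> nw na qs pz np nr ca _ _ [] *; rewrite /halted /is_idle /=;
    exact: measurable_cst.
have mA : measurable A by apply: bigcapT_measurable => N; exact: measurableC.
have nA : nnmeas (\1_A : Z -> R).
  by split; [exact: measurable_indic|move=> z; rewrite indicE ler0n].
have QA : Q A = (fine (Q A))%:E by rewrite fineK// fin_num_measure.
have bound N : N%:R * fine (Q A) <= M.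
  rewrite -lee_fin EFinM -QA; apply: le_trans (steps_bound N.+1).
  have -> : Q A = Ex Q (\1_A : Z -> R) by rewrite /Ex integral_indic// setIT.
  rewrite -ExZ//; apply: Ex_le.
  - by apply: nnmeasM => //; exact: nnmeas_cst.
  - apply: nnmeas_sum => j; split; first exact: measurable_busy.
    by move=> z; exact: ler0n.
  - move=> z; rewrite indicE; have [/set_mem Az|_] := boolP (z \in A).
      by rewrite mulr1 busy_steps_running// => m; apply/negP; exact: Az m I.
    by rewrite mulr0; apply: sumr_ge0 => j _; exact: ler0n.
exists A; split => //; last first.
  by move=> z /= nh N _ hN; apply: nh; exists N.
rewrite QA; congr _%:E; apply/eqP; rewrite eq_le fine_ge0// andbT leNgt.
apply/negP => Q0; have M0 : 0 <= M by have := bound 0%N; rewrite mul0r.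
have := bound (Num.truncn (M / fine (Q A))).+1.
rewrite leNgt -ltr_pdivrMr//.
by have /andP[_ ->] := truncn_itv (divr_ge0 M0 (ltW Q0)).
Qed.

(** Almost surely the emptying time is one of the clock values, which are nondecreasing in [N] and
    have means at most [M]. *)
Lemma integral_emptying_le : (\int[Q]_z emptying z <= M%:E)%E.
Proof.
apply: (@integral_exhaustion_le _ _ _ Q emptying (fun N z => now (tr z N))) => //.
- exact: measurable_emptying.
- exact: emptying_ge0.
- by move=> N; split; [exact: measurable_now|move=> z; exact: (clock_homo z (leq0n N))].
- by move=> z m N; exact: clock_homo.
- apply: filterS ae_halted => z [N hN]; exists N.
  have [m [/andP[_ mN] ->]] := emptying_halted hN.
  by rewrite lee_fin clock_homo.
Qed.

End FirstBusyPeriod.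

(** With no class nothing ever happens: after step 1 the system is idle, still at time 0. *)
Lemma first_empty_time_no_class {R : realType} (x sz c dd : 'I_0 -> nat -> R) :
  first_empty_time x sz c dd = 0%E.
Proof.
have e0 : step x sz c dd (init R 0) = init R 0.
  rewrite /step /next_arr (_ : enum 'I_0 = [::])//.
  by apply: size0nil; rewrite size_enum_ord.
have eN N : iter N (step x sz c dd) (init R 0) = init R 0.
  by elim: N => //= N ->.
rewrite /first_empty_time; case: pselect => [H|]; first by rewrite eN.
by case; exists 1%N; rewrite eN.
Qed.

Lemma exponential_prob_le0 {R : realType} (l : R) : 0 < l ->
  exponential_prob l [set v | v <= 0] = 0%E.
Proof.
move=> l0; rewrite (_ : [set v | v <= 0] = `]-oo, 0]%classic); last first.
  by apply/seteqP; split => v /=; rewrite in_itv.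
rewrite /exponential_prob -integral_itv_bndo_bndc; last first.
  by apply/measurable_EFinP; apply: measurable_funTS; exact: measurable_exponential_pdf.
apply: integral0_eq => v; rewrite /= in_itv /= => v0.
by rewrite lt0_exponential_pdf.
Qed.

Section FiniteMeanEmptying.
Context {R : realType} {n : nat}.
Notation Z := (@inputsp R (@tagT n)).
Variables (Q : probability Z R) (lam : 'I_n -> R).
Hypothesis lam_gt0 : forall i, 0 < lam i.
Hypothesis LQ : input_law Q lam.

(** Finite [E[R_k]] makes the means of sizes and discounts real numbers, and [job_bound] gives
    [load <= \sum_k lam k * r k < 1], as [queue_bound] requires. *)
Lemma emptying_mean_finite (i0 : 'I_n) (r : 'I_n -> R) :
  (forall k, (\int[Q]_z esize k z)%E = (r k)%:E) -> \sum_k lam k * r k < 1 ->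
  (\int[Q]_z emptying z < +oo)%E.
Proof.
move=> rE load1.
have rfin k : (\int[Q]_z esize k z < +oo)%E by rewrite rE ltry.
pose a k := fine (Ex Q (fun z => szin z k 0)).
have aE k : Ex Q (fun z => szin z k 0) = (a k)%:E.
  rewrite /a fineK// ge0_fin_numE; last by apply: Ex_ge0 => z; rewrite ltW ?szin_gt0.
  by apply: le_lt_trans (rfin k); exact: (size_mean_le LQ).
have a_le k : a k <= r k by rewrite -lee_fin -aE -rE; exact: (size_mean_le LQ).
pose q k := fine (Ex Q (discount lam k)).
have mdisc k : measurable_fun setT (discount (R := R) lam k).
  apply: measurableT_comp => //; apply: measurable_funM; first exact: measurable_cst.
  exact: measurable_ddin.
have qE k : Ex Q (discount lam k) = (q k)%:E.
  rewrite /q fineK//; apply: (@Ex_fin _ _ _ Q _ 1).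
    by split => // z; exact: expR_ge0.
  move=> z; rewrite /discount -expR0 ler_expR mulNr oppr_le0 mulr_ge0 ?ddin_ge0//.
  exact: higher_rate_ge0.
have q0 k : 0 < q k.
  by rewrite -lte_fin -qE; apply: Ex_gt0 => // z; exact: expR_gt0.
(* Finite overhead means are available only for [k > 0]; the top class gets a dummy pair. *)
have /choice[m mP] : forall k : 'I_n, exists m : R * R, (0 < k)%N ->
    [/\ Ex Q (fun z => cin z k 0) = m.1%:E, Ex Q (fun z => ddin z k 0) = m.2%:E &
      a k * (1 + higher_rate lam k * (m.1 + m.2) / q k) <= r k].
  move=> k; have [k0|k0] := posnP k; first by exists (0, 0).
  have [mc [md h]] := job_bound lam_gt0 LQ (rfin k) k0 (aE k) (qE k) (q0 k) (rE k).
  by exists (mc, md).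
have [|||M hM] := @queue_bound _ _ Q lam lam_gt0 LQ i0 a (fun k => (m k).1)
    (fun k => (m k).2) q aE _ _ qE q0.
- by move=> k /mP[].
- by move=> k /mP[].
- apply: le_lt_trans load1; apply: ler_sum => k _; apply: ler_wpM2l; first exact: ltW.
  rewrite /inflation; case: ifPn => [k0|_]; last by rewrite mulr1.
  by have [] := mP k k0.
apply: (@le_lt_trans _ _ M%:E); last exact: ltry.
by apply: (integral_emptying_le i0) => N; have [] := hM N.
Qed.

End FiniteMeanEmptying.

(** * From the given probability space to the coordinate space *)

Section JointLaw.
Context {R : realType} {n : nat} d (T : measurableType d) (P : probability T R).
Notation Z := (@inputsp R (@tagT n)).
Variables (lam : 'I_n -> R) (X S C D : 'I_n -> nat -> T -> R).
Hypothesis lam_gt0 : forall i, 0 < lam i.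
Hypothesis mX : forall i m, measurable_fun setT (X i m).
Hypothesis mS : forall i m, measurable_fun setT (S i m).
Hypothesis mC : forall i m, measurable_fun setT (C i m).
Hypothesis mD : forall i m, measurable_fun setT (D i m).
Hypothesis lawX : forall i m B, measurable B ->
  P (X i m @^-1` B) = exponential_prob (lam i) B.
Hypothesis lawS : forall i m B, measurable B -> P (S i m @^-1` B) = P (S i 0 @^-1` B).
Hypothesis S_gt0 : forall i m, P [set w | S i m w <= 0] = 0%E.
Hypothesis lawC : forall i m B, measurable B -> P (C i m @^-1` B) = P (C i 0 @^-1` B).
Hypothesis lawD : forall i m B, measurable B -> P (D i m @^-1` B) = P (D i 0 @^-1` B).
Hypothesis C_ge0 : forall i m, P [set w | C i m w < 0] = 0%E.
Hypothesis D_ge0 : forall i m, P [set w | D i m w < 0] = 0%E.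
Hypothesis indep : mutually_independent P (inputs X S C D).

Definition joint (w : T) : Z := fun t => inputs X S C D t w.

Lemma measurable_inputs t : measurable_fun setT (inputs X S C D t).
Proof. by case: t => [[[[] []] i] m]; rewrite /inputs. Qed.

Lemma measurable_joint : measurable_fun setT joint.
Proof. by apply: measurable_to_inputsp => t; exact: measurable_inputs. Qed.

Definition joint_mfun : {mfun T >-> Z} := mfun_Sub (mem_set measurable_joint).

Definition joint_law : probability Z R := distribution P joint_mfun.

Lemma joint_lawE A : joint_law A = P (joint @^-1` A).
Proof. by []. Qed.

Lemma input_law_joint : input_law joint_law lam.
Proof.
split.
- move=> J B uJ mB; rewrite joint_lawE.
  rewrite (_ : _ @^-1` _ = \big[setI/setT]_(j <- J) (inputs X S C D j @^-1` B j)); last first.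
    by rewrite -!bigcap_seq; apply/seteqP; split.
  by rewrite indep.
- by move=> i m A mA; rewrite joint_lawE -(lawX i m mA).
- move=> a b i m A mA; rewrite !joint_lawE; case: a; case: b.
  + exact: (lawD i m mA).
  + exact: (lawC i m mA).
  + exact: (lawS i m mA).
  + exact: (etrans (lawX i m mA) (esym (lawX i 0%N mA))).
Qed.

Lemma ae_all_inputs (Y : 'I_n -> nat -> T -> R) (p : pred R) :
  (forall i m, measurable [set w | ~~ p (Y i m w)]) ->
  (forall i m, P [set w | ~~ p (Y i m w)] = 0%E) ->
  {ae P, forall w, forall i m, p (Y i m w)}.
Proof.
move=> mp P0; apply: filter_forall => i; apply/ae_foralln => m.
by exists [set w | ~~ p (Y i m w)]; split; [exact: mp|exact: P0|move=> w /= /negP].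
Qed.

(** Nonpositive interarrival times are null by the exponential law, nonpositive sizes and negative
    overheads by hypothesis; countably many null sets are removed. *)
Lemma ae_clamped : {ae P, forall w, [/\ xin (joint w) = at_ X w, szin (joint w) = at_ S w,
  cin (joint w) = at_ C w & ddin (joint w) = at_ D w]}.
Proof.
have gt0 (Y : 'I_n -> nat -> T -> R) : (forall i m, measurable_fun setT (Y i m)) ->
    (forall i m, P [set w | Y i m w <= 0] = 0%E) ->
    {ae P, forall w, forall i m, 0 < Y i m w}.
  move=> mY Y0; have e i m : [set w | ~~ (0 < Y i m w)] = [set w | Y i m w <= 0].
    by apply/seteqP; split => w /=; rewrite leNgt.
  apply: (@ae_all_inputs Y (fun v => 0 < v)) => i m; rewrite e//.
  by apply: measurable_ler => //; exact: measurable_cst.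
have ge0 (Y : 'I_n -> nat -> T -> R) : (forall i m, measurable_fun setT (Y i m)) ->
    (forall i m, P [set w | Y i m w < 0] = 0%E) ->
    {ae P, forall w, forall i m, 0 <= Y i m w}.
  move=> mY Y0; have e i m : [set w | ~~ (0 <= Y i m w)] = [set w | Y i m w < 0].
    by apply/seteqP; split => w /=; rewrite ltNge.
  apply: (@ae_all_inputs Y (fun v => 0 <= v)) => i m; rewrite e//.
  by apply: measurable_ltr => //; exact: measurable_cst.
have X0 i m : P [set w | X i m w <= 0] = 0%E.
  rewrite -(exponential_prob_le0 (lam_gt0 i)) -(lawX i m)//.
  exact: measurable_ler.
have h1 := gt0 _ mX X0; have h2 := gt0 _ mS S_gt0.
have h3 := ge0 _ mC C_ge0; have h4 := ge0 _ mD D_ge0.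
near=> w; have w1 := near h1 w; have w2 := near h2 w.
have w3 := near h3 w; have w4 := near h4 w.
split; apply/funext => i; apply/funext => m.
- by rewrite /xin /pos /joint /= w1.
- by rewrite /szin /pos /joint /= w2.
- by rewrite /cin /nonneg /joint /= w3.
- by rewrite /ddin /nonneg /joint /= w4.
Unshelve. all: by end_near. Qed.

(** Clamping changes the inputs on a null set only, so a functional of the given inputs and its
    clamped form on the coordinate space have equal integrals. *)
Lemma integral_joint (F : ('I_n -> nat -> R) -> ('I_n -> nat -> R) ->
    ('I_n -> nat -> R) -> ('I_n -> nat -> R) -> \bar R) (G : Z -> \bar R) :
  measurable_fun setT (fun w => F (at_ X w) (at_ S w) (at_ C w) (at_ D w)) ->
  measurable_fun setT G -> (forall z, 0 <= G z)%E ->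
  (forall z, G z = F (xin z) (szin z) (cin z) (ddin z)) ->
  (\int[P]_w F (at_ X w) (at_ S w) (at_ C w) (at_ D w) = \int[joint_law]_z G z)%E.
Proof.
move=> mF mG G0 GE; rewrite ge0_integral_distribution//.
apply: ae_eq_integral => //.
  by apply: measurableT_comp => //; exact: measurable_joint.
apply: filterS ae_clamped => w [e1 e2 e3 e4] _.
by rewrite /= GE e1 e2 e3 e4.
Qed.

End JointLaw.

Theorem mainTheorem4 (R : realType) (d : measure_display) (T : measurableType d)
    (P : probability T R) (n : nat) (lam : 'I_n -> R)
    (X S C D : 'I_n -> nat -> T -> R) :
  (forall i, 0 < lam i) ->
  (* measurability of all inputs *)
  (forall i m, measurable_fun setT (X i m)) ->
  (forall i m, measurable_fun setT (S i m)) ->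
  (forall i m, measurable_fun setT (C i m)) ->
  (forall i m, measurable_fun setT (D i m)) ->
  (* Poisson arrivals: i.i.d. exponential(lam i) interarrival times *)
  (forall i m B, measurable B -> P (X i m @^-1` B) = exponential_prob (lam i) B) ->
  (* i.i.d. positive sizes *)
  (forall i m B, measurable B -> P (S i m @^-1` B) = P (S i 0 @^-1` B)) ->
  (forall i m, P [set w | S i m w <= 0] = 0%E) ->
  (* i.i.d. nonnegative overhead lengths *)
  (forall k m B, measurable B -> P (C k m @^-1` B) = P (C k 0 @^-1` B)) ->
  (forall k m B, measurable B -> P (D k m @^-1` B) = P (D k 0 @^-1` B)) ->
  (forall k m, P [set w | C k m w < 0] = 0%E) ->
  (forall k m, P [set w | D k m w < 0] = 0%E) ->
  (* everything independent *)
  mutually_independent P (inputs X S C D) ->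
  (total_effective_load P lam X S C D < 1)%E ->
  stable P X S C D.
Proof.
(* With no class there is no witness [i0] for the general argument, so that case is settled
   separately. *)
case: n lam X S C D => [|n] lam X S C D lam0 mX mS mC mD lX lS S0 lC lD C0 D0 ind.
  move=> _; rewrite /stable.
  under eq_integral do rewrite first_empty_time_no_class.
  by rewrite integral0 ltry.
rewrite /total_effective_load /stable => load1.
pose Q := joint_law P mX mS mC mD.
have LQ : input_law Q lam by exact: input_law_joint lX lS lC lD ind.
have es k : (\int[P]_w effective_size (at_ X w) (at_ S w) (at_ C w) (at_ D w) k =
    \int[Q]_z esize k z)%E.
  apply: (integral_joint lam0 mX mS mC mD lX S0 C0 D0
    (F := fun x s c e => effective_size x s c e k)) => //.
  - exact: measurable_effective_size.
  - exact: measurable_esize.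
  - exact: esize_ge0.
have e0 k : (0 <= \int[Q]_z esize k z)%E by apply: integral_ge0 => z _; exact: esize_ge0.
have {}load1 : (\sum_k (lam k)%:E * \int[Q]_z esize k z < 1)%E.
  by move: load1; under eq_bigr do rewrite es.
(* As every [lam k] is positive, one infinite mean would make the whole load infinite. *)
have efin k : (\int[Q]_z esize k z < +oo)%E.
  rewrite ltNge leye_eq; apply/negP => /eqP ek; move: load1.
  rewrite (bigD1 k)//= ek gt0_muley ?lte_fin// addye ?ltNge ?leey//.
  rewrite gt_eqF// (lt_le_trans ltNy0)// sume_ge0// => j _.
  by rewrite mule_ge0// lee_fin ltW.
pose r k := fine (\int[Q]_z esize k z)%E.
have rE k : (\int[Q]_z esize k z)%E = (r k)%:E by rewrite /r fineK// ge0_fin_numE.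
rewrite (_ : (\int[P]_w _)%E = (\int[Q]_z emptying z)%E).
  apply: (emptying_mean_finite lam0 LQ ord0 rE).
  rewrite -lte_fin -sumEFin; under eq_bigr do rewrite EFinM -rE.
  exact: load1.
apply: (integral_joint lam0 mX mS mC mD lX S0 C0 D0 (F := @first_empty_time R n.+1)) => //.
- exact: measurable_first_empty_time.
- exact: measurable_emptying.
- exact: (emptying_ge0 ord0).
Qed.
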